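(* Let $\bar{C}$ be the algebra of complex polynomial functions on $M_6(\mathbb{C})$ invariant under conjugation by $\mathrm{Sp}_6$. For $z\in M_6(\mathbb{C})$ put $x=\tfrac12(z+z^* )$ and $y=\tfrac12(z-z^* )$, where $z^*$ is the symplectic adjoint of $z$. Consider the following list $W_2$ of $28$ words in $x$ and $y$: \begin{align*} W_2=\{\,& x;\ x^2,\ y^2;\ x^3,\ xy^2;\ x^2y^2,\ (xy)^2,\ y^4;\ x^2yxy,\ xy^4;\\ & (x^2y)^2,\ x^2y^2xy,\ xy^3xy,\ (xy^2)^2,\ y^6;\ x^2yxy^3;\\ & x^2yxy^2xy,\ x^2y^4xy,\ (xy^3)^2;\ x^2y^3(xy)^2,\ x^2y^3xy^3;\\ & x^2y^3xyx^2y,\ xy^3(xy)^3,\ xy^4xy^2xy;\ xy^3xy^2(xy)^2;\\ & x^2y^4(xy)^3,\ xy^5xy^3xy;\ xy^5(xy)^2xy^2\,\}. \end{align*} For $1\le k\le 28$ let $j_k=\mathrm{tr}\,w(x,y)\in\bar{C}$, where $w$ is the $k$th word in this list. Let $\bar{C}^{\#}$ be the subalgebra of $\bar{C}$ generated by the $15$ invariants $j_1,j_2,\ldots,j_{13},j_{15},j_{19}$, and let $J$ be the set of $36$ invariants \begin{align*} J=\{\,& 1,\ j_{14},\ j_{16},\ j_{17},\ j_{18},\ j_{20},\ j_{21},\ j_{22},\ j_{23},\ j_{24},\ j_{25},\ j_{26},\ j_{14}^2,\\ & j_{27},\ j_{14}j_{16},\ j_{28},\ j_{14}j_{17},\ j_{14}j_{18},\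 j_{14}j_{20},\ j_{14}j_{21},\ j_{14}j_{22},\\ & j_{14}j_{23},\ j_{17}j_{20},\ j_{16}j_{23},\ j_{16}j_{24},\ j_{14}j_{26},\ j_{16}j_{26},\ j_{18}j_{25},\ j_{14}j_{28},\\ & j_{18}j_{26},\ j_{17}j_{27},\ j_{17}j_{28},\ j_{18}j_{28},\ j_{22}j_{27},\ j_{25}j_{26},\ j_{14}j_{25}j_{26}\,\}. \end{align*} Then $J$ is a free basis of $\bar{C}$ considered as a $\bar{C}^{\#}$-module, and the set $\mathrm{tr}\,W_2=\{j_1,\ldots,j_{28}\}$ is a minimal set of homogeneous generators (MSG) of $\bar{C}$.
   Context: $M_k=M_k(\mathbb{C})$ is the algebra of complex $k\times k$ matrices and $X^T$ is the transpose of $X$. The symplectic group is $\mathrm{Sp}_{2n}=\{A\in \mathrm{GL}_{2n}(\mathbb{C}) : A^TJ_0A=J_0\}$ with $J_0=\begin{bmatrix}0&-I_n\\ I_n&0\end{bmatrix}$. The symplectic adjoint of $X\in M_{2n}$ is $X^*=J_0^{-1}X^TJ_0$; the map $X\mapsto X^*$ is an involutory anti-automorphism of the algebra $M_{2n}$. Here $n=3$. $\bar{C}$ is the algebra of complex (holomorphic) polynomial functions on $M_6$ invariant under the action $a\cdot z=aza^{-1}$, $a\in\mathrm{Sp}_6$. Writing $z=x+y$ with $x^*=x$ and $y^*=-y$, the algebra $\bar{C}$ is $\mathbb{Z}^2$-graded by the degrees in the entries of $x$ and of $y$; the function $z\mapsto\mathrm{tr}\,w(x,y)$ is a bihomogeneous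 invariant whose bidegree is the pair (number of occurrences of $x$ in $w$, number of occurrences of $y$ in $w$). The total degree is the sum of the two degrees. A minimal set of homogeneous generators (MSG) of $\bar{C}$ is a set of homogeneous elements that generates $\bar{C}$ as a $\mathbb{C}$-algebra and no proper subset of which generates $\bar{C}$. *)

(* Defs.v *)
From mathcomp Require Import all_boot all_algebra.
From mathcomp Require Import complex classical_sets functions reals.
From mathcomp Require Import mpoly.

Set Implicit Arguments.
Unset Strict Implicit.
Unset Printing Implicit Defensive.

Import GRing.Theory.
Local Open Scope ring_scope.
Local Open Scope classical_set_scope.

(** ** Algebras of functions [X -> K] (with the pointwise operations) *)

Section FunctionAlgebras.
Variables (X : Type) (K : comNzRingType).
Implicit Types (A B S hom : set (X -> K)).

Definition subalgebra A : Prop :=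
  [/\ forall a : K, A (cst a),
      forall f g, A f -> A g -> A (f + g)
    & forall f g, A f -> A g -> A (f * g)].

Definition generated_subalgebra S : set (X -> K) := smallest subalgebra S.

(* The set equality says at once that the members of [e] lie in [A], that [A]
   absorbs multiplication by [B], and that [e] spans the [B]-module [A].  The
   family is indexed, so independence also makes its members distinct. *)
Definition free_basis B A (e : seq (X -> K)) : Prop :=
  A = [set f | exists2 c : 'I_(size e) -> (X -> K),
                 (forall i, B (c i)) & f = \sum_i c i * e`_i]
  /\ (forall c : 'I_(size e) -> (X -> K),
        (forall i, B (c i)) -> \sum_i c i * e`_i = 0 -> forall i, c i = 0).

(* Here [hom] is the set of homogeneous elements of the ambient grading. *)
Definition minimal_homogeneous_generators hom A S : Prop :=
  [/\ S `<=` A,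
      S `<=` hom,
      generated_subalgebra S = A
    & forall T, T `<` S -> generated_subalgebra T <> A].

End FunctionAlgebras.

(** ** The symplectic group and the symplectic adjoint *)

Section Symplectic.
Variables (K : fieldType) (n : nat).

Definition J0 : 'M[K]_(n + n) := block_mx 0 (- 1%:M) 1%:M 0.

Definition Sp : set 'M[K]_(n + n) :=
  [set a | a \in unitmx /\ a^T *m J0 *m a = J0].

Definition sadj (z : 'M[K]_(n + n)) : 'M[K]_(n + n) :=
  invmx J0 *m z^T *m J0.

Definition xpart (z : 'M[K]_(n + n)) : 'M[K]_(n + n) := 2^-1 *: (z + sadj z).
Definition ypart (z : 'M[K]_(n + n)) : 'M[K]_(n + n) := 2^-1 *: (z - sadj z).

(** ** Polynomial invariants and their bigrading *)

Definition polynomial_function : set ('M[K]_(n + n) -> K) :=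
  [set f | exists p : {mpoly K[(n + n) * (n + n)]},
             forall z, f z = p.@[fun k => mxvec z 0 k]].

Definition Sp_invariant : set ('M[K]_(n + n) -> K) :=
  [set f | forall a, Sp a -> forall z, f (a *m z *m invmx a) = f z].

Definition Cbar : set ('M[K]_(n + n) -> K) :=
  polynomial_function `&` Sp_invariant.

(* [f] is given by a polynomial in the entries of [x] (the first block of
   variables) and of [y] (the second block), all of whose monomials have degree
   [d] in the former and [e] in the latter. *)
Definition bihomogeneous_of (d e : nat) : set ('M[K]_(n + n) -> K) :=
  [set f | exists2 p : {mpoly K[(n + n) * (n + n) + (n + n) * (n + n)]},
      (forall m, m \in msupp p ->
         (\sum_k m (lshift _ k) = d)%N /\ (\sum_k m (rshift _ k) = e)%N)
    & forall z,
        f z = p.@[fun k => row_mx (mxvec (xpart z)) (mxvec (ypart z)) 0 k]].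

Definition bihomogeneous : set ('M[K]_(n + n) -> K) :=
  [set f | exists d e, bihomogeneous_of d e f].

End Symplectic.

(** ** The words and the invariants *)

Definition W2 (A : pzRingType) (x y : A) : seq A :=
  [:: x;
      x ^+ 2; y ^+ 2;
      x ^+ 3; x * y ^+ 2;
      x ^+ 2 * y ^+ 2; (x * y) ^+ 2; y ^+ 4;
      x ^+ 2 * y * x * y; x * y ^+ 4;
      (x ^+ 2 * y) ^+ 2; x ^+ 2 * y ^+ 2 * x * y; x * y ^+ 3 * x * y;
      (x * y ^+ 2) ^+ 2; y ^+ 6;
      x ^+ 2 * y * x * y ^+ 3;
      x ^+ 2 * y * x * y ^+ 2 * x * y; x ^+ 2 * y ^+ 4 * x * y;
      (x * y ^+ 3) ^+ 2;
      x ^+ 2 * y ^+ 3 * (x * y) ^+ 2; x ^+ 2 * y ^+ 3 * x * y ^+ 3;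
      x ^+ 2 * y ^+ 3 * x * y * x ^+ 2 * y; x * y ^+ 3 * (x * y) ^+ 3;
      x * y ^+ 4 * x * y ^+ 2 * x * y;
      x * y ^+ 3 * x * y ^+ 2 * (x * y) ^+ 2;
      x ^+ 2 * y ^+ 4 * (x * y) ^+ 3; x * y ^+ 5 * x * y ^+ 3 * x * y;
      x * y ^+ 5 * (x * y) ^+ 2 * x * y ^+ 2].

Section Invariants.
Variable K : fieldType.

(* Indices start at 1, hence the predecessor. *)
Definition j (k : nat) : 'M[K]_(3 + 3) -> K :=
  fun z => \tr (nth 0 (W2 (xpart z) (ypart z)) k.-1).

Definition trW2 : set ('M[K]_(3 + 3) -> K) :=
  [set j k | k in [set k | (1 <= k <= 28)%N]].

Definition Csharp : set ('M[K]_(3 + 3) -> K) :=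
  generated_subalgebra
    [set j k | k in [set k | (1 <= k <= 13)%N \/ k = 15%N \/ k = 19%N]].

Definition Jset : seq ('M[K]_(3 + 3) -> K) :=
  [:: 1; j 14; j 16; j 17; j 18; j 20; j 21; j 22; j 23; j 24; j 25; j 26;
      j 14 ^+ 2;
      j 27; j 14 * j 16; j 28; j 14 * j 17; j 14 * j 18; j 14 * j 20;
      j 14 * j 21; j 14 * j 22;
      j 14 * j 23; j 17 * j 20; j 16 * j 23; j 16 * j 24; j 14 * j 26;
      j 16 * j 26; j 18 * j 25; j 14 * j 28;
      j 18 * j 26; j 17 * j 27; j 17 * j 28; j 18 * j 28; j 22 * j 27;
      j 25 * j 26; j 14 * j 25 * j 26].

End Invariants.

(* Main.v *)
(* Fix y, and write P_k for the monomials in the twelve base invariants involving x times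
   the elements of J.

   For y = e regular nilpotent, the elements of J are linearly independent over the
   polynomials in the base invariants: at 36 explicit points the base invariants take the
   same values and have independent differentials, while the matrix of values of J is
   invertible, so that the lowest order terms of a linear relation, expanded at those
   points, cannot cancel. A one-parameter torus contracts a slice through e, so the
   independence spreads to all y in the slice, hence to all generic y by conjugation.

   Conversely let y be diagonal and generic. An invariant of degree d in x is then a
   combination of monomials in the 15 coordinates of x fixed by the diagonal torus. These
   monomials are circulations on a graph with four vertices, and there are as many of them
   as of P_k of degree d; by independence the P_k span. The coefficients along the slice
   are quotients of determinants (Cramer) with a denominator that does not vanish at e, and
   they are homogeneous for the contracting torus, so they are polynomials in the
   coordinates of the slice, that is, in the traces of y^2, y^4 and y^6. Density of the
   diagonalizable y concludes.

   The 28 words have degree at most 13, and a product of at least two of the 13 secondary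
   generators has such a degree only if it belongs to J; so, by independence at e, no
   generator involving x is a polynomial in the others. For the traces of y^2, y^4, y^6,
   take two points with x = 0 that only the given trace separates. *)

Require Import Defs.
From Stdlib Require ZArith.
From mathcomp Require Import all_boot all_order all_algebra all_field.
From mathcomp Require Import complex classical_sets functions reals boolp.
From mathcomp Require Import mpoly ring zify ssrZ.

Set Implicit Arguments.
Unset Strict Implicit.
Unset Printing Implicit Defensive.
Import Order.TTheory GRing.Theory Num.Theory.
Local Open Scope ring_scope.

(** The two kinds of y complement each other. At e, independence can be tested at finitely many
    points, but the stabilizer of e is unipotent up to sign and offers no torus for counting. At a
    diagonal y counting is easy, but the elements of J are hard to tell apart. The slice joins the
    two, since [ydiag b] is conjugate to [ymat (celem b)] for generic b. The 36 points are 4 times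
    9: one point is written over a quartic field Q(w), the four roots w give four points, and the
    nine values of u with u^9 j_12 = 1 move each of them by the torus. Among the twelve base
    invariants only j_10, of torus weight 0, and j_12, of weight 9, are non-zero there, whence the
    common values. J has four elements in each class of weights modulo 9, so that the matrix of
    values is inverted block by block. The graph comes from the weights of the diagonal torus on x:
    zero, three times, and the twelve roots of type D_3 = A_3, that is, the arrows of the complete
    graph on four vertices. Degrees are counted in x only; no generators of the algebra of
    invariants are presupposed. *)

Ltac ord6 i := case: i => [[|[|[|[|[|[|//]]]]]] ?].

(** * Polynomial functions and linear independence *)

Section PolynomialFunctions.
Variable K : numClosedFieldType.

Lemma poly_fun0 (P : {poly K}) : (forall t, P.[t] = 0) -> P = 0.
Proof.
move=> P0; apply/eqP; apply/negPn/negP => nzP.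
pose rs : seq K := [seq i%:R | i <- iota 0 (size P)].
have : (size rs < size P)%N.
  apply: max_poly_roots => //; first by apply/allP => x _; rewrite /root P0.
  by rewrite map_inj_uniq ?iota_uniq // => i k /eqP; rewrite eqr_nat => /eqP.
by rewrite size_map size_iota ltnn.
Qed.

Definition upoly (F : K -> K) := exists P : {poly K}, forall t, F t = P.[t].

Lemma upoly_cst c : upoly (fun=> c).
Proof. by exists c%:P => t; rewrite hornerC. Qed.

Lemma upoly_id : upoly id.
Proof. by exists 'X => t; rewrite hornerX. Qed.

Lemma upolyD F G : upoly F -> upoly G -> upoly (fun t => F t + G t).
Proof. by case=> P FP [Q GQ]; exists (P + Q) => t; rewrite hornerD FP GQ. Qed.

Lemma upolyM F G : upoly F -> upoly G -> upoly (fun t => F t * G t).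
Proof. by case=> P FP [Q GQ]; exists (P * Q) => t; rewrite hornerM FP GQ. Qed.

Lemma upoly_sum I (r : seq I) (p : pred I) (F : I -> K -> K) :
  (forall i, upoly (F i)) -> upoly (fun t => \sum_(i <- r | p i) F i t).
Proof.
move=> /choice[P FP]; exists (\sum_(i <- r | p i) P i) => t.
by rewrite horner_sum; apply: eq_bigr => i _.
Qed.

Lemma upoly_prod I (r : seq I) (p : pred I) (F : I -> K -> K) :
  (forall i, upoly (F i)) -> upoly (fun t => \prod_(i <- r | p i) F i t).
Proof.
move=> /choice[P FP]; exists (\prod_(i <- r | p i) P i) => t.
by rewrite horner_prod; apply: eq_bigr => i _.
Qed.

Lemma upolyX F n : upoly F -> upoly (fun t => F t ^+ n).
Proof. by case=> P FP; exists (P ^+ n) => t; rewrite horner_exp FP. Qed.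

Lemma eq_upoly F G : F =1 G -> upoly F -> upoly G.
Proof. by move=> FG [P FP]; exists P => t; rewrite -FG. Qed.

(** The product of the two polynomials vanishes everywhere, and K[t] has no zero divisors. In this
    form a density argument only asks for a line through one good point. *)
Lemma upoly_dense F G t0 : upoly F -> upoly G -> G t0 != 0 ->
  (forall t, G t != 0 -> F t = 0) -> forall t, F t = 0.
Proof.
case=> P FP [Q GQ] nzG F0 t.
suff : P * Q = 0.
  move/eqP; rewrite mulf_eq0 => /orP[/eqP P0 | /eqP Q0]; first by rewrite FP P0 horner0.
  by rewrite GQ Q0 horner0 eqxx in nzG.
apply: poly_fun0 => s; rewrite hornerM -FP -GQ.
by have [->|/F0->] := eqVneq (G s) 0; rewrite ?mulr0 ?mul0r.
Qed.

Definition mfun n (f : ('I_n -> K) -> K) :=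
  exists p : {mpoly K[n]}, forall v, f v = p.@[v].

Lemma mfun_cst n c : mfun (fun _ : 'I_n -> K => c).
Proof. by exists c%:MP => v; rewrite mevalC. Qed.

Lemma mfun_var n (i : 'I_n) : mfun (fun v : 'I_n -> K => v i).
Proof. by exists 'X_i => v; rewrite mevalXU. Qed.

Lemma mfunD n (f g : ('I_n -> K) -> K) :
  mfun f -> mfun g -> mfun (fun v => f v + g v).
Proof. by case=> p fp [q gq]; exists (p + q) => v; rewrite mevalD fp gq. Qed.

Lemma mfunM n (f g : ('I_n -> K) -> K) :
  mfun f -> mfun g -> mfun (fun v => f v * g v).
Proof. by case=> p fp [q gq]; exists (p * q) => v; rewrite mevalM fp gq. Qed.

Lemma mfun_sum n I (r : seq I) (p : pred I) (F : I -> ('I_n -> K) -> K) :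
  (forall i, mfun (F i)) -> mfun (fun v => \sum_(i <- r | p i) F i v).
Proof.
move=> /choice[P FP]; exists (\sum_(i <- r | p i) P i) => v.
by rewrite raddf_sum; apply: eq_bigr => i _.
Qed.

Lemma mfun_prod n I (r : seq I) (p : pred I) (F : I -> ('I_n -> K) -> K) :
  (forall i, mfun (F i)) -> mfun (fun v => \prod_(i <- r | p i) F i v).
Proof.
move=> /choice[P FP]; exists (\prod_(i <- r | p i) P i) => v.
by rewrite rmorph_prod; apply: eq_bigr => i _.
Qed.

Lemma mfunX n (f : ('I_n -> K) -> K) k : mfun f -> mfun (fun v => f v ^+ k).
Proof. by case=> p fp; exists (p ^+ k) => v; rewrite rmorphXn fp. Qed.

Lemma eq_mfun n (f g : ('I_n -> K) -> K) : f =1 g -> mfun f -> mfun g.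
Proof. by move=> fg [p fp]; exists p => v; rewrite -fg. Qed.

Lemma mpoly_evalE n (p : {mpoly K[n]}) v :
  p.@[v] = \sum_(m <- msupp p) p@_m * \prod_i v i ^+ m i.
Proof. by rewrite mevalE. Qed.

Lemma upoly_meval n (p : {mpoly K[n]}) (F : 'I_n -> K -> K) :
  (forall i, upoly (F i)) -> upoly (fun t => p.@[fun i => F i t]).
Proof.
move=> uF; apply: (@eq_upoly (fun t => \sum_(m <- msupp p) p@_m * \prod_i F i t ^+ m i)).
  by move=> t; rewrite mpoly_evalE.
apply: upoly_sum => m; apply: upolyM; first exact: upoly_cst.
by apply: upoly_prod => i; apply: upolyX.
Qed.

Lemma mfun_meval n k (p : {mpoly K[n]}) (F : 'I_n -> ('I_k -> K) -> K) :
  (forall i, mfun (F i)) -> mfun (fun t => p.@[fun i => F i t]).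
Proof.
move=> uF; apply: (@eq_mfun k (fun t => \sum_(m <- msupp p) p@_m * \prod_i F i t ^+ m i)).
  by move=> t; rewrite mpoly_evalE.
apply: mfun_sum => m; apply: mfunM; first exact: mfun_cst.
by apply: mfun_prod => i; apply: mfunX.
Qed.

Lemma upoly_mfun n (f : ('I_n -> K) -> K) (F : 'I_n -> K -> K) :
  mfun f -> (forall i, upoly (F i)) -> upoly (fun t => f (fun i => F i t)).
Proof.
case=> p fp uF; apply: eq_upoly (upoly_meval p uF) => t.
by rewrite fp.
Qed.

Lemma upoly_det n (A : K -> 'M[K]_n) :
  (forall i j, upoly (fun t => A t i j)) -> upoly (fun t => \det (A t)).
Proof.
move=> uA; apply: upoly_sum => s; apply: upolyM; first exact: upoly_cst.
by apply: upoly_prod => i; apply: uA.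
Qed.

Lemma mfun_det k n (A : ('I_k -> K) -> 'M[K]_n) :
  (forall i j, mfun (fun t => A t i j)) -> mfun (fun t => \det (A t)).
Proof.
move=> uA; apply: mfun_sum => s; apply: mfunM; first exact: mfun_cst.
by apply: mfun_prod => i; apply: uA.
Qed.

(** Uniqueness of expansions in base D: it keeps the monomials apart under the substitution v_i =
    t^(D^i). *)
Lemma digits_inj n D (f g : nat -> nat) :
  (forall i, (f i < D)%N) -> (forall i, (g i < D)%N) ->
  (\sum_(i < n) f i * D ^ i = \sum_(i < n) g i * D ^ i)%N ->
  forall i, (i < n)%N -> f i = g i.
Proof.
elim: n f g => // n IHn f g fD gD.
rewrite !big_ord_recl !expn0 !muln1 => E.
have shift (h : nat -> nat) :
    (\sum_(i < n) h (bump 0 i) * D ^ bump 0 i =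
     (\sum_(i < n) h i.+1 * D ^ i) * D)%N.
  by rewrite big_distrl /=; apply: eq_bigr => i _; rewrite /bump /= add1n expnSr mulnA.
rewrite !shift in E.
have D0 : (0 < D)%N by apply: leq_trans (fD 0%N).
have E0 : f 0%N = g 0%N.
  by move: (congr1 (modn^~ D) E); rewrite /= ![(_ + _ * D)%N]addnC !modnMDl !modn_small.
case=> // i; rewrite ltnS => lt_in; apply: (IHn (f \o succn) (g \o succn)) => //; try by move=> k /=.
by move: E; rewrite E0 => /addnI /eqP; rewrite eqn_pmul2r // => /eqP.
Qed.

(* Kronecker substitution. *)
Lemma mpoly_fun0 n (p : {mpoly K[n]}) : (forall v, p.@[v] = 0) -> p = 0.
Proof.
move=> p0; pose D := msize p.
pose phi (m : 'X_{1..n}) := (\sum_(i < n) m i * D ^ i)%N.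
pose P : {poly K} := \sum_(m <- msupp p) p@_m *: 'X^(phi m).
have P0 : P = 0.
  apply: poly_fun0 => t; rewrite -[RHS](p0 (fun i => t ^+ (D ^ i))).
  rewrite mpoly_evalE horner_sum; apply: eq_bigr => m _.
  rewrite hornerZ hornerXn; congr (_ * _).
  by rewrite expr_sum; apply: eq_bigr => i _; rewrite mulnC exprM.
apply/mpolyP => m; rewrite mcoeff0.
have [ms|] := boolP (m \in msupp p); last exact: memN_msupp_eq0.
have := congr1 (fun q : {poly K} => q`_(phi m)) P0.
rewrite coef0 coef_sum (bigD1_seq m) ?msupp_uniq //= coefZ coefXn eqxx mulr1.
rewrite big_seq_cond big1 ?addr0 // => m' /andP[m's nm].
rewrite coefZ coefXn; case: eqP => [E|]; last by rewrite mulr0.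
case/eqP: nm; apply/mnmP => i.
have bnd (k : 'X_{1..n}) : k \in msupp p -> forall j, (k j < D)%N.
  move=> kp j; apply: leq_ltn_trans (msize_mdeg_lt kp).
  by rewrite mdegE (bigD1 j) //= leq_addr.
pose F (k : 'X_{1..n}) (i : nat) := if insub i is Some j then k j else 0%N.
have FE k (j : 'I_n) : F k j = k j by rewrite /F valK.
have := @digits_inj n D (F m') (F m) _ _ _ i (ltn_ord i); rewrite !FE; apply.
- by move=> j; rewrite /F; case: insub => [?|]; [exact: bnd | exact: leq_ltn_trans (bnd _ ms i)].
- by move=> j; rewrite /F; case: insub => [?|]; [exact: bnd | exact: leq_ltn_trans (bnd _ ms i)].
- by under eq_bigr do rewrite FE; under [RHS]eq_bigr do rewrite FE; rewrite -/(phi _) -E.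
Qed.

End PolynomialFunctions.

Section LinearIndependence.
Variables (K : fieldType) (X : Type).

Definition indep_funs N (g : 'I_N -> X -> K) :=
  forall c : 'I_N -> K, (forall x, \sum_k c k * g k x = 0) -> forall k, c k = 0.

(** Induction on N: choose points for all functions but the first. With one more, free point y, the
    expansion of the determinant along its first row is a combination of the g k y in which g 0 has
    a non-zero coefficient, so it cannot vanish for all y. *)
Lemma indep_points N (g : 'I_N -> X -> K) : indep_funs g ->
  exists x : 'I_N -> X, \det (\matrix_(l, k) g k (x l)) != 0.
Proof.
elim: N g => [|N IHN] g ind.
  by exists (fun i : 'I_0 => match notF (ltn_ord i) with end); rewrite det_mx00 oner_eq0.
have [x dx] : exists x : 'I_N -> X,
    \det (\matrix_(l, k) g (lift ord0 k) (x l)) != 0.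
  apply: (IHN (fun k => g (lift ord0 k))) => c c0 k.
  have := ind (fun i => oapp c 0 (unlift ord0 i)) _ (lift ord0 k).
  rewrite liftK; apply => y; rewrite big_ord_recl unlift_none mul0r add0r.
  by rewrite -[RHS](c0 y); apply: eq_bigr => i _; rewrite liftK.
pose xx y (l : 'I_N.+1) := oapp x y (unlift ord0 l).
apply: contrapT => noy.
pose M y := \matrix_(l, k) g k (xx y l).
have D0 y : \det (M y) = 0.
  by apply/eqP/negPn/negP => nz; apply: noy; exists (xx y).
(* X is inhabited, since on an empty X every relation would hold. *)
have [y0 _] : exists y0 : X, True.
  apply: contrapT => noX; move/eqP: (oner_neq0 K); apply.
  have := ind (fun=> 1) _ ord0; apply => y.
  by case: noX; exists y.
have Cy y k : cofactor (M y) ord0 k = cofactor (M y0) ord0 k.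
  by congr (_ * \det _); apply/matrixP => i j; rewrite !mxE /xx !liftK.
have := ind (fun k => cofactor (M y0) ord0 k) _ ord0.
rewrite /cofactor addn0 expr0 mul1r => H; move/eqP: dx; apply.
rewrite -[RHS]H.
  by congr (\det _); apply/matrixP => i j; rewrite !mxE /xx liftK.
move=> y; rewrite -[RHS](D0 y) (expand_det_row _ ord0); apply: eq_bigr => k _.
by rewrite Cy mulrC mxE /xx unlift_none.
Qed.

(** Independence makes M row-free, so that n <= N forces it to be square and invertible, and the g l
    can be solved for in terms of the P k. With circulations for g and monomials in the invariants
    for P, a comparison of counts yields spanning. *)
Lemma indep_span N n (P : 'I_N -> X -> K) (g : 'I_n -> X -> K) (f : X -> K)
    (M : 'M[K]_(N, n)) (a : 'I_n -> K) :
  (n <= N)%N -> indep_funs P ->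
  (forall k x, P k x = \sum_l M k l * g l x) ->
  (forall x, f x = \sum_l a l * g l x) ->
  exists c : 'I_N -> K, forall x, f x = \sum_k c k * P k x.
Proof.
move=> le_nN ind PM fa.
have fM : row_free M.
  apply/inj_row_free => v vM0; apply/rowP => k; rewrite mxE.
  apply: (ind (fun k => v 0 k)) => x.
  under eq_bigr do rewrite PM mulr_sumr.
  rewrite exchange_big big1 //= => l _.
  under eq_bigr do rewrite mulrA.
  rewrite -mulr_suml (_ : \sum_i _ = 0) ?mul0r //.
  by have := congr1 (fun A : 'rV_n => A 0 l) vM0; rewrite !mxE.
have rM : row_full M.
  by rewrite /row_full eqn_leq rank_leq_col /= (eqP fM).
have [L LM] := row_fullP rM.
pose u := (\row_l a l) *m L.
exists (fun k => u 0 k) => x; rewrite fa.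
have -> : \sum_l a l * g l x = ((\row_l a l) *m (\col_l g l x)) 0 0.
  by rewrite mxE; apply: eq_bigr => l _; rewrite !mxE.
have -> : \sum_k u 0 k * P k x = (u *m (\col_k P k x)) 0 0.
  by rewrite mxE; apply: eq_bigr => l _; rewrite !mxE.
rewrite (_ : \col_k P k x = M *m \col_l g l x).
  by rewrite mulmxA -(mulmxA _ L) LM mulmx1.
by apply/colP => k; rewrite !mxE PM; apply: eq_bigr => l _; rewrite !mxE.
Qed.

End LinearIndependence.

(* [runs [:: a; b; c; ...]] is the word x^a y^b x^c ... ([true] stands for x). *)
Fixpoint runs_from (b : bool) (s : seq nat) : seq bool :=
  if s is n :: s' then nseq n b ++ runs_from (~~ b) s' else [::].
Definition runs := runs_from true.

Definition words : seq (seq bool) := map runs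
  [:: [:: 1]; [:: 2]; [:: 0; 2]; [:: 3]; [:: 1; 2]; [:: 2; 2]; [:: 1; 1; 1; 1];
      [:: 0; 4]; [:: 2; 1; 1; 1]; [:: 1; 4]; [:: 2; 1; 2; 1]; [:: 2; 2; 1; 1];
      [:: 1; 3; 1; 1]; [:: 1; 2; 1; 2]; [:: 0; 6]; [:: 2; 1; 1; 3];
      [:: 2; 1; 1; 2; 1; 1]; [:: 2; 4; 1; 1]; [:: 1; 3; 1; 3];
      [:: 2; 3; 1; 1; 1; 1]; [:: 2; 3; 1; 3]; [:: 2; 3; 1; 1; 2; 1];
      [:: 1; 3; 1; 1; 1; 1; 1; 1]; [:: 1; 4; 1; 2; 1; 1];
      [:: 1; 3; 1; 2; 1; 1; 1; 1]; [:: 2; 4; 1; 1; 1; 1; 1; 1];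
      [:: 1; 5; 1; 3; 1; 1]; [:: 1; 5; 1; 1; 1; 1; 1; 2]]%N.

Definition wordm (A : pzRingType) (w : seq bool) (x y : A) : A :=
  foldr (fun (b : bool) a => (if b then x else y) * a) 1 w.

Lemma W2E (A : pzRingType) (x y : A) i :
  (i < 28)%N -> nth 0 (W2 x y) i = wordm (nth [::] words i) x y.
Proof.
do 28?[case: i => [_|i] /=; first by rewrite /wordm /= ?exprS ?expr0 ?mulr1 -?mulrA].
by [].
Qed.

Definition degx (w : seq bool) := count id w.
Definition degy (w : seq bool) := count negb w.

(* Indices into [words] start at 0, so that [k] stands for j_(k+1). The generators of
   [Csharp] are those listed in [baseL], whose words involve x, and the traces of
   y^2, y^4 and y^6 (indices 2, 7 and 14); [basisL] lists the products in [Jset]. *)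
Definition baseL : seq nat := [:: 3; 0; 4; 9; 1; 5; 6; 12; 18; 8; 11; 10].
Definition basisL : seq (seq nat) :=
  [:: [::]; [:: 13]; [:: 15]; [:: 16]; [:: 17]; [:: 19]; [:: 20]; [:: 21];
      [:: 22]; [:: 23]; [:: 24]; [:: 25]; [:: 13; 13]; [:: 26]; [:: 13; 15];
      [:: 27]; [:: 13; 16]; [:: 13; 17]; [:: 13; 19]; [:: 13; 20]; [:: 13; 21];
      [:: 13; 22]; [:: 16; 19]; [:: 15; 22]; [:: 15; 23]; [:: 13; 25];
      [:: 15; 25]; [:: 17; 24]; [:: 13; 27]; [:: 17; 25]; [:: 16; 26];
      [:: 16; 27]; [:: 17; 27]; [:: 21; 26]; [:: 24; 25]; [:: 13; 24; 25]]%N.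

Definition wdx k := degx (nth [::] words k).
Definition wdy k := degy (nth [::] words k).

(** * Trace invariants, their monomials and the contracting torus *)

Section Invariants.
Variable K : numClosedFieldType.
Local Notation M6 := 'M[K]_(3 + 3).
Implicit Types (x y z g : M6).

Definition jw k x y : K := \tr (wordm (nth [::] words k) x y).

Lemma jE k z : (1 <= k <= 28)%N -> j k z = jw k.-1 (xpart z) (ypart z).
Proof. by case: k => // k /andP[_ le_k]; rewrite /j /jw W2E. Qed.

Lemma wordm_inter w g x y x' y' s t :
  x' *m g = s *: (g *m x) -> y' *m g = t *: (g *m y) ->
  wordm w x' y' *m g = (s ^+ degx w * t ^+ degy w) *: (g *m wordm w x y).
Proof.
move=> xg yg; elim: w => [|b w IH] /=.
  by rewrite !expr0 mulr1 scale1r mul1mx mulmx1.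
rewrite -!mulmxE -mulmxA IH -scalemxAr !mulmxA.
case: b => /=; rewrite ?xg ?yg -scalemxAl scalerA.
  by rewrite add0n add1n exprS mulrC mulrA.
by rewrite add0n add1n exprS; congr (_ *: _); ring.
Qed.

Lemma jw_inter k g x y x' y' s t : g \in unitmx ->
  x' *m g = s *: (g *m x) -> y' *m g = t *: (g *m y) ->
  jw k x' y' = s ^+ wdx k * t ^+ wdy k * jw k x y.
Proof.
move=> gu xg yg; rewrite /jw -[X in \tr X](mulmxK gu) (wordm_inter _ xg yg).
by rewrite -scalemxAl mxtraceZ mxtrace_mulC mulmxA mulVmx // mul1mx.
Qed.

Definition base x y (l : 'I_12) : K := jw (nth 0%N baseL l) x y.
Definition basis (i : nat) x y : K := \prod_(k <- nth [::] basisL i) jw k x y.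
Definition mono (p : 'I_36 * 'X_{1..12}) x y : K :=
  (\prod_l base x y l ^+ p.2 l) * basis p.1 x y.

Definition basex l := wdx (nth 0%N baseL l).
Definition basey l := wdy (nth 0%N baseL l).
Definition basisx i := sumn (map wdx (nth [::] basisL i)).
Definition basisy i := sumn (map wdy (nth [::] basisL i)).
Definition monox (p : 'I_36 * 'X_{1..12}) := (\sum_(l < 12) basex l * p.2 l + basisx p.1)%N.
Definition monoy (p : 'I_36 * 'X_{1..12}) := (\sum_(l < 12) basey l * p.2 l + basisy p.1)%N.

Lemma basis_inter i g x y x' y' s t : g \in unitmx ->
  x' *m g = s *: (g *m x) -> y' *m g = t *: (g *m y) ->
  basis i x' y' = s ^+ basisx i * t ^+ basisy i * basis i x y.
Proof.
move=> gu xg yg; rewrite /basis /basisx /basisy.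
elim: (nth _ _ _) => [|k r IH] /=; first by rewrite !big_nil !expr0 !mulr1.
by rewrite !big_cons IH (jw_inter _ gu xg yg) !exprD; ring.
Qed.

Lemma mono_inter p g x y x' y' s t : g \in unitmx ->
  x' *m g = s *: (g *m x) -> y' *m g = t *: (g *m y) ->
  mono p x' y' = s ^+ monox p * t ^+ monoy p * mono p x y.
Proof.
move=> gu xg yg; rewrite /mono (basis_inter _ gu xg yg) /monox /monoy !exprD.
rewrite (eq_bigr (fun l : 'I_12 => (s ^+ (basex l * p.2 l) * t ^+ (basey l * p.2 l)) *
   base x y l ^+ p.2 l)); last first.
  by move=> l _; rewrite /base (jw_inter _ gu xg yg) !exprMn -!exprM.
by rewrite !big_split /= -!expr_sum; ring.
Qed.

Lemma mono_scale p x y s t :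
  mono p (s *: x) (t *: y) = s ^+ monox p * t ^+ monoy p * mono p x y.
Proof.
by apply: (@mono_inter _ 1%:M); rewrite ?unitmx1 ?mulmx1 ?mul1mx.
Qed.

Lemma mono_conj p g x y : g \in unitmx ->
  mono p (g *m x *m invmx g) (g *m y *m invmx g) = mono p x y.
Proof.
move=> gu; rewrite (@mono_inter _ g x y _ _ 1 1) ?expr1n ?mul1r //.
  by rewrite mulmxKV // scale1r.
by rewrite mulmxKV // scale1r.
Qed.

(** The coordinate in each entry of x: 0 to 8 fill the block A row by row, and 9 to 14 are the
    entries above the diagonal of B and of C, alternately. In [sg] the codes 0, 1, 2 stand for the
    factors 0, 1, -1. *)
Definition ix (i k : nat) : nat := nth 0%N (nth [::]
  [:: [:: 0; 1; 2; 0; 9; 11]; [:: 3; 4; 5; 9; 0; 13]; [:: 6; 7; 8; 11; 13; 0];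
      [:: 0; 10; 12; 0; 3; 6]; [:: 10; 0; 14; 1; 4; 7]; [:: 12; 14; 0; 2; 5; 8]]%N i) k.
Definition sg (i k : nat) : nat := nth 0%N (nth [::]
  [:: [:: 1; 1; 1; 0; 1; 1]; [:: 1; 1; 1; 2; 0; 1]; [:: 1; 1; 1; 2; 2; 0];
      [:: 0; 1; 1; 1; 1; 1]; [:: 2; 0; 1; 1; 1; 1]; [:: 2; 2; 0; 1; 1; 1]]%N i) k.

(* The *-symmetric matrices [[A, B], [C, A^T]], with B and C antisymmetric. *)
Definition xmat (v : 'I_15 -> K) : M6 :=
  \matrix_(i, k) (nth 0 [:: 0; 1; -1] (sg i k) * v (inord (ix i k))).

(* A slice through the regular nilpotent element [ymat 0] of sp_6: the characteristic
   polynomial of [ymat c] is t^6 - c_0 t^4 + c_1 t^2 - c_2. *)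
Definition ymat (c : 'I_3 -> K) : M6 :=
  \matrix_(i, k) nth 0 (nth [::]
    [:: [:: 0; 0; 0; c (inord 2); 0; 0];
        [:: 1; 0; 0; 0; c (inord 1); 0];
        [:: 0; 1; 0; 0; 0; c (inord 0)];
        [:: 0; 0; 0; 0; -1; 0];
        [:: 0; 0; 0; 0; 0; -1];
        [:: 0; 0; 1; 0; 0; 0]] i) k.

(* The torus attached to [ymat 0]: conjugation by [gtor u] contracts the slice ([cact]) and
   acts on the coordinates of x by the weights [tor]. *)
Definition kap i := nth 0%N [:: 0; 1; 2; 5; 4; 3]%N i.
Definition tor k := nth 0%N [:: 4; 3; 2; 5; 4; 3; 6; 5; 4; 0; 8; 1; 7; 2; 6]%N k.
Definition tau (u : K) (v : 'I_15 -> K) (k : 'I_15) : K := u ^+ tor k * v k.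
Definition cact (u : K) (c : 'I_3 -> K) (k : 'I_3) : K := u ^+ (2 * k.+1) * c k.
Definition gtor (u : K) : M6 := diag_mx (\row_i u ^+ kap i).

Lemma gtor_unit u : u != 0 -> gtor u \in unitmx.
Proof.
move=> nzu; rewrite unitmxE det_diag unitfE; apply/prodf_neq0 => i _.
by rewrite mxE expf_neq0.
Qed.

(** Conjugation multiplies the entry (i, k) by u^(kap i - kap k), and this exponent is at least -4
    where x has an entry; the factor u^4 makes all weights [tor] non-negative. *)
Lemma xmat_tau u v : xmat (tau u v) *m gtor u = u ^+ 4 *: (gtor u *m xmat v).
Proof.
rewrite mul_diag_mx mul_mx_diag; apply/matrixP => i k; rewrite !mxE /tau.
have [->|E] : sg i k = 0%N \/ (tor (inord (ix i k) : 'I_15) + kap k = 4 + kap i)%N.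
- ord6 i; ord6 k; rewrite /= /ix /= inordK //; by [left | right].
- by rewrite /= !mul0r !mulr0.
- have := congr1 (fun n => u ^+ n) E; rewrite !exprD => E'.
  set a := nth _ _ _; set b := v _.
  have -> : u ^+ tor (inord (ix i k) : 'I_15) * b = b * u ^+ tor (inord (ix i k) : 'I_15) by rewrite mulrC.
  by rewrite -!mulrA E'; ring.
Qed.

End Invariants.

(** * The symplectic group and diagonalization of skew elements *)

Section Symplectic.
Variable K : numClosedFieldType.
Local Notation M6 := 'M[K]_(3 + 3).
Local Notation J := (J0 K 3).
Implicit Types (x y z a g : M6).

Ltac ord3 i := case: i => [[|[|[|//]]] ?].

Lemma J0_sqr : J *m J = - 1%:M.
Proof.
rewrite /J0 mulmx_block !mul0mx !mulmx0 !addr0 !add0r mul1mx mulmx1.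
by rewrite (scalar_mx_block 3 3 1) opp_block_mx !oppr0.
Qed.

Lemma invJ0 : invmx J = - J.
Proof.
have JJ : J *m (- J) = 1%:M by rewrite mulmxN J0_sqr opprK.
have Ju : J \in unitmx by case: (mulmx1_unit JJ).
by rewrite -[RHS]mul1mx -(mulVmx Ju) -mulmxA JJ mulmx1.
Qed.

Lemma J0_unit : J \in unitmx.
Proof.
have JJ : J *m (- J) = 1%:M by rewrite mulmxN J0_sqr opprK.
by case: (mulmx1_unit JJ).
Qed.

Lemma trJ0 : J^T = - J.
Proof.
by rewrite /J0 tr_block_mx opp_block_mx !trmx0 trmx1 linearN /= trmx1 !oppr0 opprK.
Qed.

Lemma sadj_block A B C D :
  sadj (block_mx A B C D) = block_mx D^T (- B^T) (- C^T) A^T :> M6.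
Proof.
rewrite /sadj invJ0 tr_block_mx /J0 opp_block_mx !oppr0 opprK !mulmx_block.
by rewrite !mul0mx !mulmx0 !mul1mx !mulmx1 !mulmxN !mulNmx !add0r !addr0 !mul1mx !mulmx1 opprK.
Qed.

Lemma sadjD x y : sadj (x + y) = sadj x + sadj y :> M6.
Proof. by rewrite /sadj linearD /= mulmxDr mulmxDl. Qed.

Lemma sadjN x : sadj (- x) = - sadj x :> M6.
Proof. by rewrite /sadj linearN /= mulmxN mulNmx. Qed.

Lemma sadjZ s x : sadj (s *: x) = s *: sadj x :> M6.
Proof. by rewrite /sadj linearZ /= -scalemxAr -scalemxAl. Qed.

Lemma sadjK x : sadj (sadj x) = x :> M6.
Proof. by rewrite -(submxK x) !sadj_block !linearN /= !trmxK !opprK. Qed.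

Lemma sadjM x y : sadj (x *m y) = sadj y *m sadj x :> M6.
Proof. by rewrite /sadj trmx_mul !mulmxA mulmxK // J0_unit. Qed.

Definition symm x := sadj x = x.
Definition skew x := sadj x = - x.

Lemma skew_diag (b : 'I_3 -> K) : skew (diag_mx (row_mx (\row_i b i) (\row_i - b i))).
Proof.
rewrite /skew diag_mx_row sadj_block opp_block_mx !trmx0 !oppr0 !tr_diag_mx.
congr block_mx; rewrite -linearN /=; congr diag_mx; apply/rowP => i; rewrite !mxE //.
by rewrite opprK.
Qed.

Lemma symm_xmat (v : 'I_15 -> K) : symm (xmat v).
Proof.
rewrite /symm -[X in sadj X](submxK (xmat v)) sadj_block -[RHS](submxK (xmat v)).
by congr block_mx; apply/matrixP => i k; ord3 i; ord3 k;
   rewrite !mxE /= /sg /ix /= ?mulN1r ?mul1r ?mul0r ?oppr0 ?opprK.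
Qed.

Lemma skew_ymat (c : 'I_3 -> K) : skew (ymat c).
Proof.
rewrite /skew -[X in sadj X](submxK (ymat c)) sadj_block.
rewrite -[X in _ = - X](submxK (ymat c)) opp_block_mx.
by congr block_mx; apply/matrixP => i k; ord3 i; ord3 k;
   rewrite !mxE /= ?oppr0 ?opprK.
Qed.

(** An entry in which [xmat] carries its k-th coordinate with sign +. *)
Definition xrow (k : nat) : 'I_(3 + 3) :=
  inord (nth 0%N [:: 0; 0; 0; 1; 1; 1; 2; 2; 2; 0; 3; 0; 3; 1; 4]%N k).
Definition xcol (k : nat) : 'I_(3 + 3) :=
  inord (nth 0%N [:: 0; 1; 2; 0; 1; 2; 0; 1; 2; 4; 1; 5; 2; 5; 2]%N k).

Ltac mirror_entry E1 E2 E3 d i k := first [exact: (E1 i k isT isT) | exact: (E2 i k isT isT)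
  | exact: (E3 i k isT isT) | exact: (d _ (E2 i k isT isT))
  | exact: (d _ (E3 i k isT isT))].

Lemma symm_xmatP x : symm x -> x = xmat (fun k => x (xrow k) (xcol k)).
Proof.
rewrite /symm => xs.
have ent (i k : 'I_3) :
    [/\ x (rshift 3 i) (rshift 3 k) = x (lshift 3 k) (lshift 3 i),
        x (lshift 3 i) (rshift 3 k) = - x (lshift 3 k) (rshift 3 i)
      & x (rshift 3 i) (lshift 3 k) = - x (rshift 3 k) (lshift 3 i)].
  by split; rewrite -[in LHS]xs -[x in sadj x]submxK sadj_block
    ?block_mxEdr ?block_mxEur ?block_mxEdl !mxE.
have diag0 (s : K) : s = - s -> s = 0.
  by move/eqP; rewrite -addr_eq0 -mulr2n mulrn_eq0 => /eqP.
have fromn (i k : 'I_6) : x i k = x (inord i) (inord k) by rewrite !inord_val.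
have E1 i k (ui : (i < 3)%N) (uk : (k < 3)%N) :
    x (inord (3 + i)) (inord (3 + k)) = x (inord k) (inord i).
  have [+ _ _] := ent (Ordinal ui) (Ordinal uk).
  by rewrite [in X in X -> _]fromn [in X in _ = X -> _]fromn; exact.
have E2 i k (ui : (i < 3)%N) (uk : (k < 3)%N) :
    x (inord i) (inord (3 + k)) = - x (inord k) (inord (3 + i)).
  have [_ + _] := ent (Ordinal ui) (Ordinal uk).
  by rewrite [in X in X -> _]fromn [in X in _ = - X -> _]fromn; exact.
have E3 i k (ui : (i < 3)%N) (uk : (k < 3)%N) :
    x (inord (3 + i)) (inord k) = - x (inord (3 + k)) (inord i).
  have [_ _ +] := ent (Ordinal ui) (Ordinal uk).
  by rewrite [in X in X -> _]fromn [in X in _ = - X -> _]fromn; exact.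
apply/matrixP => i k; rewrite mxE fromn.
ord6 i; ord6 k; rewrite /sg /ix /xrow /xcol /= inordK //= ?mul1r ?mulN1r ?mul0r //.
all: first [ mirror_entry E1 E2 E3 diag0 0%N 0%N | mirror_entry E1 E2 E3 diag0 0%N 1%N | mirror_entry E1 E2 E3 diag0 0%N 2%N
  | mirror_entry E1 E2 E3 diag0 1%N 0%N | mirror_entry E1 E2 E3 diag0 1%N 1%N | mirror_entry E1 E2 E3 diag0 1%N 2%N
  | mirror_entry E1 E2 E3 diag0 2%N 0%N | mirror_entry E1 E2 E3 diag0 2%N 1%N | mirror_entry E1 E2 E3 diag0 2%N 2%N ].
Qed.

Lemma xpartE x y : symm x -> skew y -> xpart (x + y) = x.
Proof.
move=> xs ys; rewrite /xpart sadjD xs ys addrACA subrr addr0 -mulr2n -scaler_nat.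
by rewrite scalerA mulVf ?scale1r // pnatr_eq0.
Qed.

Lemma ypartE x y : symm x -> skew y -> ypart (x + y) = y.
Proof.
move=> xs ys; rewrite /ypart sadjD xs ys opprD opprK addrACA subrr add0r -mulr2n -scaler_nat.
by rewrite scalerA mulVf ?scale1r // pnatr_eq0.
Qed.

Lemma symm_xpart z : symm (xpart z).
Proof. by rewrite /symm /xpart sadjZ sadjD sadjK addrC. Qed.

Lemma skew_ypart z : skew (ypart z).
Proof. by rewrite /skew /ypart sadjZ sadjD sadjN sadjK -scalerN opprB addrC. Qed.

Lemma xypart z : xpart z + ypart z = z.
Proof.
rewrite /xpart /ypart -scalerDr addrACA subrr addr0 -mulr2n -scaler_nat.
by rewrite scalerA mulVf ?scale1r // pnatr_eq0.
Qed.

Lemma Sp_inv a : Sp a -> invmx a = sadj a.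
Proof.
case=> au aJ; have E : sadj a *m a = 1%:M by rewrite /sadj -!mulmxA (mulmxA a^T) aJ mulVmx // J0_unit.
by rewrite -[RHS]mulmx1 -(mulmxV au) mulmxA E mul1mx.
Qed.

Lemma Sp_unit a : Sp a -> a \in unitmx. Proof. by case. Qed.

Lemma sadj_Sp a z : Sp a -> sadj (a *m z *m invmx a) = a *m sadj z *m invmx a.
Proof. move=> Sa; by rewrite !(Sp_inv Sa) (sadjM (a *m z)) (sadjM a z) sadjK mulmxA. Qed.

Lemma symm_Sp a x : Sp a -> symm x -> symm (a *m x *m invmx a).
Proof. by rewrite /symm => Sa xs; rewrite sadj_Sp // xs. Qed.

(** This transposed form of the condition says that the rows of U are a symplectic basis: U J0 U^T
    is their Gram matrix. It suits a matrix whose rows are eigenvectors. *)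
Lemma Sp_tr U : U *m J *m U^T = J -> Sp U.
Proof.
move=> E; have E1 : U *m (- (J *m U^T *m J)) = 1%:M.
  by rewrite mulmxN !mulmxA E J0_sqr opprK.
have [Uu _] := mulmx1_unit E1.
split => //.
have E2 : - (J *m U^T *m J) *m U = 1%:M.
  exact: mulmx1C E1.
have : J *m (- (J *m U^T *m J) *m U) = J by rewrite E2 mulmx1.
by rewrite mulNmx mulmxN !mulmxA J0_sqr !mulNmx mul1mx opprK.
Qed.

Lemma Sp_diag (d : 'rV[K]_(3 + 3)) :
  (forall i : 'I_3, d 0 (lshift 3 i) * d 0 (rshift 3 i) = 1) -> Sp (diag_mx d).
Proof.
rewrite -[d]hsubmxK; move: (lsubmx d) (rsubmx d) => u v uv1; apply: Sp_tr.
have uv : diag_mx u *m diag_mx v = 1%:M :> 'M_3.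
  rewrite mulmx_diag; apply/matrixP => i k; rewrite !mxE.
  by have := uv1 i; rewrite row_mxEl row_mxEr => ->.
have vu : diag_mx v *m diag_mx u = 1%:M by rewrite diag_mxC.
rewrite tr_diag_mx diag_mx_row /J0 !mulmx_block !mulmx0 !mul0mx !addr0 !add0r mulmxN !mulNmx !mulmx1.
by rewrite uv vu !mul0mx.
Qed.

Lemma SpV a : Sp a -> Sp (invmx a).
Proof.
move=> Sa; have au := Sp_unit Sa; split; first by rewrite unitmx_inv.
case: Sa => _ aJ; rewrite -{1}aJ !mulmxA -trmx_mul mulmxV // trmx1 mul1mx.
by rewrite -mulmxA mulmxV // mulmx1.
Qed.

Lemma SpM a g : Sp a -> Sp g -> Sp (a *m g).
Proof.
case=> au aJ [gu gJ]; split; first by rewrite unitmx_mul au gu.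
have E : g^T *m a^T *m J *m a = g^T *m J by rewrite -!mulmxA (mulmxA a^T) aJ.
by rewrite trmx_mul !mulmxA E.
Qed.

Definition ydiag (b : 'I_3 -> K) : M6 := diag_mx (row_mx (\row_i b i) (\row_i - b i)).

(* Eigenvectors for eigenvalues of nonzero sum are orthogonal for the form [J0]. *)
Lemma sp_diag y (b : 'I_3 -> K) (U : M6) : skew y ->
  (forall i, row i U != 0) ->
  injective (fun i => (row_mx (\row_i b i) (\row_i - b i) : 'rV_(3 + 3)) 0 i) ->
  U *m y = ydiag b *m U ->
  exists a, Sp a /\ a *m y *m invmx a = ydiag b.
Proof.
set l := row_mx _ _; rewrite /ydiag -/l => ys Un0 linj Uy.
(* Independence of eigenvectors for distinct eigenvalues: the powers of y applied to a relation give
   a Vandermonde system. *)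
have Uu : U \in unitmx.
  rewrite -row_free_unit; apply/inj_row_free => v vU0.
  have vk k : (\row_i (v 0 i * l 0 i ^+ k)) *m U = 0.
    elim: k => [|k IH].
      by rewrite -[RHS]vU0; congr (_ *m _); apply/rowP => i; rewrite mxE mulr1.
    rewrite -[RHS](mul0mx _ y) -IH -mulmxA Uy mulmxA mul_mx_diag; congr (_ *m _).
    by apply/rowP => i; rewrite !mxE exprSr mulrA.
  have : Vandermonde 6 l *m (diag_mx v *m U) = 0.
    rewrite mulmxA mul_mx_diag; apply/row_matrixP => k; rewrite row_mul row0.
    by rewrite -[RHS](vk k); congr (_ *m _); apply/rowP => i; rewrite !mxE mulrC.
  have Vu : Vandermonde 6 l \in unitmx.
    rewrite unitmxE unitfE det_Vandermonde; apply/prodf_neq0 => i _.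
    apply/prodf_neq0 => k lt_ik; rewrite subr_eq0; apply: contraTneq lt_ik => E.
    by rewrite (linj _ _ E) ltnn.
  move/(congr1 (mulmx (invmx (Vandermonde 6 l)))); rewrite mulKmx // mulmx0 => dv0.
  apply/rowP => i; rewrite [RHS]mxE; apply/eqP; have := Un0 i; apply: contraNT => nzv.
  apply/eqP/rowP => k; rewrite [RHS]mxE.
  have := congr1 (fun A : M6 => A i k) dv0; rewrite mul_diag_mx !mxE => /eqP.
  by rewrite mulf_eq0 (negPf nzv) => /eqP.
have JyT : J *m y^T = - y *m J.
  have : y^T *m J = - (J *m y).
    have := congr1 (mulmx J) ys; rewrite /sadj !mulmxA mulmxV ?J0_unit // mul1mx mulmxN.
    by [].
  move/(congr1 (fun A => J *m A *m J)); rewrite !mulmxA -[X in X = _]mulmxA J0_sqr mulmxN mulmx1.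
  by rewrite mulmxN !mulNmx mulmxA J0_sqr !mulNmx mul1mx opprK => /eqP; rewrite eqr_oppLR => /eqP.
have [Wm WmE] : exists W, W = U *m J *m U^T by eexists.
have lW i k : (l 0 i + l 0 k) * Wm i k = 0.
  have : diag_mx l *m Wm = - Wm *m diag_mx l.
    have yJ : y *m J = - (J *m y^T) by rewrite JyT mulNmx opprK.
    rewrite WmE !mulmxA -Uy -(mulmxA U y) yJ mulmxN mulNmx !mulmxA.
    by rewrite -(mulmxA _ y^T) -trmx_mul Uy trmx_mul tr_diag_mx !mulNmx !mulmxA.
  move/(congr1 (fun A : M6 => A i k)); rewrite mul_diag_mx mul_mx_diag !mxE.
  by rewrite mulNr => E; rewrite mulrDl E mulrC addrC subrr.
have WT : Wm^T = - Wm by rewrite WmE !trmx_mul trmxK trJ0 mulNmx mulmxN mulmxA.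
have Wu : Wm \in unitmx by rewrite WmE !unitmx_mul Uu J0_unit unitmx_tr.
have lr i : l 0 (rshift 3 i) = - l 0 (lshift 3 i) by rewrite /l row_mxEl row_mxEr !mxE.
have W0 i k : l 0 k != - l 0 i -> Wm i k = 0.
  move=> ne; have /eqP := lW i k; rewrite mulf_eq0 addrC addr_eq0 (negPf ne) => /eqP; exact.
have ll (i k : 'I_3) : l 0 (lshift 3 k) != - l 0 (lshift 3 i).
  by rewrite -lr; apply/eqP => /linj /eqP; rewrite eq_lrshift.
have rr (i k : 'I_3) : l 0 (rshift 3 k) != - l 0 (rshift 3 i).
  by rewrite lr [in X in _ != X]lr opprK eq_sym ll.
have lrne (i k : 'I_3) : i != k -> l 0 (rshift 3 k) != - l 0 (lshift 3 i).
  by rewrite -lr; apply: contraNneq => /linj /rshift_inj ->.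
pose dd i := Wm (lshift 3 i) (rshift 3 i).
have dn0 i : dd i != 0.
  apply/eqP => d0; have : row (lshift 3 i) Wm = 0.
    apply/rowP => k; rewrite !mxE; case: (split_ordP k) => k' ->; first by rewrite W0.
    by have [<-|/lrne/W0] := eqVneq i k'.
  rewrite rowE => /(congr1 (mulmx^~ (invmx Wm))); rewrite mulmxK // mul0mx.
  by move/rowP/(_ (lshift 3 i))/eqP; rewrite !mxE !eqxx oner_eq0.
(* The Gram matrix of the rows of U has the blocks 0, dd, -dd, 0; dividing the first three rows by
   -dd turns it into J0. *)
pose D : M6 := diag_mx (row_mx (\row_i - (dd i)^-1) (const_mx 1)).
have Du : D \in unitmx.
  rewrite unitmxE unitfE det_diag; apply/prodf_neq0 => i _.
  by case: (split_ordP i) => k ->; rewrite ?row_mxEl ?row_mxEr !mxE ?oner_eq0 // oppr_eq0 invr_eq0.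
have WE : Wm = block_mx 0 (diag_mx (\row_i dd i)) (- diag_mx (\row_i dd i)) 0.
  apply/matrixP => i k; case: (split_ordP i) => i' ->; case: (split_ordP k) => k' ->;
    rewrite ?block_mxEul ?block_mxEur ?block_mxEdl ?block_mxEdr !mxE.
  - by rewrite W0 ?ll ?rr.
  - by have [<-|/lrne/W0->] := eqVneq i' k'; rewrite ?mulr1n ?mulr0n.
  - have := congr1 (fun A : M6 => A (rshift 3 i') (lshift 3 k')) WT; rewrite !mxE => E.
    rewrite -[LHS]opprK -E; congr (- _).
    have [<-|ne] := eqVneq i' k'; first by rewrite mulr1n.
    by rewrite mulr0n W0 // lrne // eq_sym.
  - by rewrite W0 ?ll ?rr.
exists (D *m U); split.
  apply: Sp_tr; rewrite trmx_mul tr_diag_mx !mulmxA -(mulmxA D) -(mulmxA D _ U^T) -WmE WE.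
  rewrite /D diag_mx_row diag_const_mx !mulmx_block.
  rewrite !(mulmx0, mul0mx, addr0, add0r, mulmxN, mulNmx, mulmx1, mul1mx) mulmx_diag /J0.
  congr block_mx.
    apply/matrixP => i k; rewrite !mxE; case: eqP => _; rewrite ?mulr0n ?oppr0 // !mulr1n.
    by rewrite mulNr mulVf.
  rewrite mulmx_diag; apply/matrixP => i k; rewrite !mxE.
  by case: eqP => _; rewrite ?mulr0n ?oppr0 // !mulr1n mulrN opprK mulfV.
have DUu : D *m U \in unitmx by rewrite unitmx_mul Du.
rewrite -[RHS](mulmxK DUu); congr (_ *m _).
by rewrite -mulmxA Uy !mulmxA; congr (_ *m _); exact: diag_mxC.
Qed.

End Symplectic.

Section Diagonalization.
Variable K : numClosedFieldType.
Local Notation M6 := 'M[K]_(3 + 3).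
Implicit Types (x y z a g : M6).

Definition lam (b : 'I_3 -> K) : 'rV[K]_(3 + 3) := row_mx (\row_i b i) (\row_i - b i).
Definition generic b := injective (fun i => lam b 0 i).
Definition conjdiag y := exists b a, [/\ generic b, Sp a & a *m y *m invmx a = ydiag b].

(** The elementary symmetric functions of the b_i^2; with them [ymat (celem b)] and [ydiag b] have
    the same characteristic polynomial. *)
Definition celem (b : 'I_3 -> K) (k : 'I_3) : K :=
  let: (p, q, r) := (b (inord 0) ^+ 2, b (inord 1) ^+ 2, b (inord 2) ^+ 2) in
  nth 0 [:: p + q + r; p * q + p * r + q * r; p * q * r] k.

(** The left eigenvector of [ymat c] with first entry 1. Columns 0, 1, 2, 5, 4 of the eigenvector
    equation determine the other entries one after the other, and column 3 is the characteristic
    equation. *)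
Definition companion_row (c : 'I_3 -> K) (l : K) : 'rV[K]_(3 + 3) :=
  \row_k nth 0 [:: 1; l; l ^+ 2;
    c (inord 1) * l - c (inord 0) * l ^+ 3 + l ^+ 5;
    c (inord 0) * l ^+ 2 - l ^+ 4; l ^+ 3] k.

Lemma companion_rowP c l :
  l ^+ 6 = c (inord 0) * l ^+ 4 - c (inord 1) * l ^+ 2 + c (inord 2) ->
  companion_row c l *m ymat c = l *: companion_row c l.
Proof.
move=> E; apply/rowP => k; rewrite !mxE !big_ord_recl big_ord0 !mxE.
ord6 k; rewrite /= ?mulr0 ?mulr1 ?addr0 ?add0r; try ring.
by rewrite mulrDr -exprS E; ring.
Qed.

Lemma lam_root b i :
  lam b 0 i ^+ 6 = celem b (inord 0) * lam b 0 i ^+ 4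
    - celem b (inord 1) * lam b 0 i ^+ 2 + celem b (inord 2).
Proof.
have E (k : 'I_3) : b k ^+ 6 = celem b (inord 0) * b k ^+ 4
    - celem b (inord 1) * b k ^+ 2 + celem b (inord 2).
  rewrite /celem !inordK //=.
  have -> : k = inord k by rewrite inord_val.
  by case: k => [[|[|[|//]]] ?] /=; ring.
case: (split_ordP i) => k ->; rewrite /lam ?row_mxEl ?row_mxEr !mxE; first exact: E.
by rewrite -[(- b k) ^+ 6]/((- b k) ^+ (2 * 3)) -[(- b k) ^+ 4]/((- b k) ^+ (2 * 2)) !exprM !sqrrN -!exprM E.
Qed.

Lemma ymat_diag b : generic b ->
  exists a, Sp a /\ a *m ymat (celem b) *m invmx a = ydiag b.
Proof.
move=> gb; pose U : M6 := \matrix_i companion_row (celem b) (lam b 0 i).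
apply: (@sp_diag _ _ b U); first exact: skew_ymat.
- move=> i; rewrite rowK; apply/eqP => /rowP/(_ 0)/eqP.
  by rewrite !mxE /= oner_eq0.
- exact: gb.
apply/row_matrixP => i; rewrite row_mul rowK companion_rowP ?lam_root //.
by rewrite row_mul row_diag_mx -scalemxAl -rowE rowK.
Qed.

(** The identity (y - s)^T J0 = - J0 (y + s) makes the spectrum symmetric about 0. *)
Lemma skew_eigen y s : skew y -> eigenvalue y s -> eigenvalue y (- s).
Proof.
move=> ys; have detE t : eigenvalue y t = (\det (y - t%:M) == 0).
  by rewrite /eigenvalue /eigenspace kermx_eq0 row_free_unit unitmxE unitfE negbK.
rewrite !detE => /eqP E.
have yT : y^T *m J0 K 3 = - (J0 K 3 *m y).
  have := congr1 (mulmx (J0 K 3)) ys; rewrite /sadj !mulmxA mulmxV ?J0_unit // mul1mx mulmxN.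
  by [].
have EJ : (y - s%:M)^T *m J0 K 3 = - (J0 K 3 *m (y - (- s)%:M)).
  by rewrite linearB /= tr_scalar_mx mulmxBl yT raddfN /= opprK mulmxDr opprD scalar_mxC.
have := congr1 determinant EJ.
rewrite det_mulmx det_tr E mul0r -scaleN1r detZ det_mulmx => /esym/eqP.
rewrite !mulf_eq0 !oppr_eq0 !oner_eq0 /=.
by have := J0_unit K; rewrite unitmxE unitfE => /negPf ->.
Qed.

(** The six eigenvalues are distinct, non-zero and stable under negation, so b0, b1, b2 can be
    picked greedily, each outside the previous ones and their negatives; [sp_diag] does the rest. *)
Lemma separable_conjdiag y : skew y -> \det y != 0 ->
  separable_poly (char_poly y) -> conjdiag y.
Proof.
move=> ys dy sep.
have [r rE] := closed_field_poly_normal (char_poly y).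
rewrite (monicP (char_poly_monic y)) scale1r in rE.
have ur : uniq r by rewrite -separable_prod_XsubC -rE.
have sr : size r = 6.
  by apply: succn_inj; rewrite -(size_prod_XsubC _ id) -rE size_char_poly.
have rootr s : (s \in r) = eigenvalue y s.
  by rewrite eigenvalue_root_char rE root_prod_XsubC.
have rN s : s \in r -> - s \in r by rewrite !rootr; exact: skew_eigen.
have r0 s : s \in r -> s != 0.
  rewrite rootr; apply: contraTneq => ->.
  by rewrite /eigenvalue /eigenspace kermx_eq0 row_free_unit unitmxE unitfE raddf0 subr0 dy.
have pick (t : seq K) : (size t < 6)%N -> exists2 s, s \in r & s \notin t.
  move=> lt; have : ~~ all (mem t) r.
    apply/negP => /allP sub; have := uniq_leq_size ur sub.
    by rewrite sr leqNgt lt.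
  by case/allPn => s; exists s.
have [b0 b0r _] := pick [::] isT.
have [b1 b1r b1n] := pick [:: b0; - b0] isT.
have [b2 b2r b2n] := pick [:: b0; - b0; b1; - b1] isT.
pose b (k : 'I_3) := nth 0 [:: b0; b1; b2] k.
have br k : b k \in r by case: k => [[|[|[|//]]] ?].
have lamr i : lam b 0 i \in r.
  by case: (split_ordP i) => k ->; rewrite /lam ?row_mxEl ?row_mxEr !mxE ?rN.
have neN s : s \in r -> (s == - s) = false.
  by move/r0 => ns; rewrite -addr_eq0 -mulr2n mulrn_eq0 (negPf ns).
have gb : generic b.
  move: b1n b2n; rewrite !inE !negb_or => /andP[n10 n10'] /and4P[n20 n20' n21 n21'].
  have bb (i k : 'I_3) : i != k -> (b i != b k) && (b i != - b k).
    have sym s t : (s != t) && (s != - t) -> (t != s) && (t != - s).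
      by rewrite eq_sym [t == - s]eq_sym eqr_oppLR.
    have p10 : (b1 != b0) && (b1 != - b0) by rewrite n10.
    have p20 : (b2 != b0) && (b2 != - b0) by rewrite n20.
    have p21 : (b2 != b1) && (b2 != - b1) by rewrite n21.
    by case: i k => [[|[|[|//]]] ?] [[|[|[|//]]] ?] //= _; rewrite /b /= //; apply: sym.
  move=> i k; case: (split_ordP i) => i' ->; case: (split_ordP k) => k' ->;
    rewrite /lam ?row_mxEl ?row_mxEr !mxE => E.
  - by congr lshift; apply/eqP/negPn/negP => /bb; rewrite E eqxx.
  - by have [E'|/bb] := eqVneq i' k'; [have := neN _ (br i'); rewrite {2}E' -E eqxx | rewrite E eqxx andbF].
  - by have [E'|/bb] := eqVneq i' k'; [have := neN _ (br k'); rewrite -{2}E' E eqxx | rewrite -E opprK eqxx andbF].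
  - by congr rshift; apply/eqP/negPn/negP => /bb; rewrite (oppr_inj E) eqxx.
have ev i : exists v : 'rV[K]_(3 + 3), v *m y = lam b 0 i *: v /\ v != 0.
  have := lamr i; rewrite rootr => /eigenvalueP[v]; by exists v.
have [v vP] := choice ev.
have [|||a [Sa aE]] := @sp_diag _ y b (\matrix_i v i) ys.
- by move=> i; rewrite rowK; case: (vP i).
- exact: gb.
- apply/row_matrixP => i; rewrite row_mul rowK (proj1 (vP i)).
  by rewrite row_mul row_diag_mx -scalemxAl -rowE rowK.
by exists b, a.
Qed.

Definition polyfn (F : M6 -> K) := polynomial_function F.

Lemma upoly_polyfn F (A : K -> M6) : polyfn F ->
  (forall i k, upoly (fun t => A t i k)) -> upoly (fun t => F (A t)).
Proof.
case=> p Fp uA; apply: eq_upoly (@upoly_meval K _ p (fun k t => mxvec (A t) 0 k) _).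
  by move=> t; rewrite Fp.
move=> k; case/mxvec_indexP: k => i k.
by apply: eq_upoly (uA i k) => t; rewrite mxvecE.
Qed.

(* On the line through [y] and a diagonal matrix, almost all points are diagonalizable. *)
Lemma conjdiag_dense F : polyfn F ->
  (forall x y, symm x -> skew y -> conjdiag y -> F (x + y) = 0) ->
  forall z, F z = 0.
Proof.
move=> pF F0 z; rewrite -(xypart z).
move: (symm_xpart z) (skew_ypart z); move: (xpart z) (ypart z) => x y xs ys.
(* The base point has the distinct non-zero eigenvalues 1, 2, 3, -1, -2, -3. *)
have [y0 y0E] : exists y0, y0 = ydiag (fun i : 'I_3 => i.+1%:R : K) by eexists.
have y0s : skew y0 by rewrite y0E; exact: skew_diag.
pose yt t := y0 + t *: (y - y0).
have yts t : skew (yt t).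
  by rewrite /skew /yt sadjD sadjZ sadjD sadjN ys y0s opprD -scalerN; congr (_ + _ *: _); rewrite opprB opprK addrC.
have yt1 : yt 1 = y by rewrite /yt scale1r addrC subrK.
have uyt i k : upoly (fun t => yt t i k).
  apply: (@eq_upoly _ (fun t => y0 i k + t * (y - y0) i k)); first by move=> t; rewrite !mxE.
  by apply: upolyD; [exact: upoly_cst | apply: upolyM; [exact: upoly_id | exact: upoly_cst]].
pose Y : 'M[{poly K}]_(3 + 3) := map_mx polyC y0 + 'X *: map_mx polyC (y - y0).
have YE t : map_mx (horner_eval t) Y = yt t.
  by apply/matrixP => i k; rewrite !mxE /= /horner_eval !hornerE.
pose Q := char_poly Y.
have Qm : Q \is monic := char_poly_monic Y.
(* The degrees of the characteristic polynomial and of its derivative do not drop when t is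
   specialized, so the resultant commutes with evaluation at t. *)
have lQ : lead_coef Q^`() = 6%:R.
  have sQ : size Q = 7 by rewrite /Q size_char_poly.
  have c5 : Q^`()`_5 = 6%:R by rewrite coef_deriv; have := monicP Qm; rewrite lead_coefE sQ /= => ->.
  have s6 : size Q^`() = 6.
    apply/eqP; rewrite eqn_leq; apply/andP; split.
      by have := lt_size_deriv (monic_neq0 Qm); rewrite sQ.
    rewrite ltnNge; apply/negP => /leq_sizeP/(_ 5 (leqnn _))/eqP.
    by rewrite c5 -polyC_natr polyC_eq0 pnatr_eq0.
  by rewrite lead_coefE s6.
(* Discriminant, up to sign, times determinant: where it does not vanish the eigenvalues are
   distinct and non-zero. *)
pose G t := resultant (char_poly (yt t)) (char_poly (yt t))^`() * \det (yt t).
have uG : upoly G.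
  apply: upolyM; last exact: upoly_det.
  exists (resultant Q Q^`()) => t.
  rewrite -[RHS]/(horner_eval t _) map_resultant.
  - by rewrite -deriv_map /Q map_char_poly YE.
  - by rewrite (monicP Qm) rmorph1 oner_eq0.
  - by rewrite lQ rmorph_nat pnatr_eq0.
have G0 : G 0 != 0.
  have yt0 : yt 0 = y0 by rewrite /yt scale0r addr0.
  have lamE i : y0 i i != 0.
    by rewrite y0E /ydiag mxE eqxx mulr1n; case: (split_ordP i) => k ->;
      rewrite ?row_mxEl ?row_mxEr !mxE ?oppr_eq0 pnatr_eq0.
  rewrite /G yt0 mulf_neq0 //; last first.
    rewrite y0E det_diag; apply/prodf_neq0 => i _; have := lamE i.
    by rewrite y0E mxE eqxx.
  rewrite resultant_eq0 -leqNgt.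
  have -> : char_poly y0 = \prod_(s <- [seq y0 i i | i : 'I_(3 + 3)]) ('X - s%:P).
    by rewrite char_poly_trig ?y0E ?diag_mx_is_trig // big_map /= big_enum.
  have : separable_poly (\prod_(s <- [seq y0 i i | i : 'I_(3 + 3)]) ('X - s%:P)).
    rewrite separable_prod_XsubC map_inj_uniq ?enum_uniq // => i k.
    rewrite y0E !mxE !eqxx !mulr1n.
    case: (split_ordP i) => i' ->; case: (split_ordP k) => k' ->;
      rewrite ?row_mxEl ?row_mxEr !mxE => /eqP.
    + by rewrite eqr_nat eqSS => /eqP/val_inj ->.
    + by rewrite -addr_eq0 -natrD pnatr_eq0.
    + by rewrite eq_sym -addr_eq0 -natrD pnatr_eq0.
    + by rewrite eqr_opp eqr_nat eqSS => /eqP/val_inj ->.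
  by rewrite separable_poly.unlock /coprimep => /eqP ->.
have := @upoly_dense _ (fun t => F (x + yt t)) G 0 _ uG G0.
move=> H; have := H _ _ 1; rewrite yt1; apply.
  apply: upoly_polyfn => // i k.
  apply: (@eq_upoly _ (fun t => x i k + yt t i k)); first by move=> t; rewrite [RHS]mxE.
  by apply: upolyD; [exact: upoly_cst | exact: uyt].
move=> t; rewrite mulf_eq0 negb_or resultant_eq0 -leqNgt => /andP[sz dt].
apply: F0 => //; apply: separable_conjdiag => //.
rewrite separable_poly.unlock /coprimep eqn_leq sz /=.
rewrite lt0n size_poly_eq0 gcdp_eq0 negb_and.
by rewrite monic_neq0 // char_poly_monic.
Qed.

End Diagonalization.

(** * Independence at the nilpotent element: the general criterion *)

Section LowestOrder.
Variables (K : numClosedFieldType) (n m r : nat).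
Variables (B : 'I_m -> ('I_n -> K) -> K) (Jf : 'I_r -> ('I_n -> K) -> K).
Variables (Pts : ('I_n -> K) -> Prop) (b : 'I_m -> K).
Hypothesis Jline : forall i v h, upoly (fun t => Jf i (fun k => v k + t * h k)).
Hypothesis Bdir : forall v, Pts v -> forall a : 'I_m -> K, exists h : 'I_n -> K,
  forall l, exists R, upoly R /\
    forall t, B l (fun k => v k + t * h k) = b l + t * a l + t ^+ 2 * R t.
Hypothesis Jsep : forall c : 'I_r -> K,
  (forall v, Pts v -> \sum_i c i * Jf i v = 0) -> forall i, c i = 0.

(* Compare the terms of lowest order in the Taylor expansion at [b]. *)
Lemma lowest_order_indep (C : 'I_r -> {mpoly K[m]}) :
  (forall v, \sum_i (C i).@[fun l => B l v] * Jf i v = 0) -> forall i, C i = 0.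
Proof.
move=> C0.
pose S i := C i \mPo [tuple 'X_l + (b l)%:MP | l < m].
have SE i u : (S i).@[u] = (C i).@[fun l => u l + b l].
  rewrite comp_mpoly_meval; apply: meval_eq => l.
  by rewrite tnth_mktuple mevalD mevalXU mevalC.
suff S0 i : S i = 0.
  move=> i; apply: mpoly_fun0 => u.
  have := SE i (fun l => u l - b l); rewrite S0 meval0 => ->.
  by apply: meval_eq => l; rewrite subrK.
have [/existsP[i0 nz0]|E] := boolP [exists i, S i != 0]; last first.
  by apply/eqP; have := existsPn E i; rewrite negbK.
have exd : exists d, [exists i, has (fun mm => mdeg mm == d) (msupp (S i))].
  have : msupp (S i0) != [::] by rewrite msupp_eq0.
  case E : (msupp (S i0)) => [//|m0 s] _; exists (mdeg m0).
  by apply/existsP; exists i0; rewrite E /= eqxx.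
pose d := ex_minn exd.
have [dP dmin] : [exists i, has (fun mm => mdeg mm == d) (msupp (S i))] /\
    forall i mm, mm \in msupp (S i) -> (d <= mdeg mm)%N.
  rewrite /d; case: ex_minnP => d0 dP dmin; split=> // k mm mms; apply: dmin.
  by apply/existsP; exists k; apply/hasP; exists mm.
(* [T k t u] is [S k] at [t * u] divided by t^d, where d is the least degree that occurs in any
   [S i]; at t = 0 only the form of degree d remains. *)
pose T k (t : K) (u : 'I_m -> K) :=
  \sum_(mm <- msupp (S k)) (S k)@_mm * t ^+ (mdeg mm - d) * \prod_l u l ^+ mm l.
have TE k t u : (S k).@[fun l => t * u l] = t ^+ d * T k t u.
  rewrite mpoly_evalE mulr_sumr; apply: eq_big_seq => mm mms.
  under eq_bigr do rewrite exprMn.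
  rewrite big_split /= -expr_sum -mdegE.
  have -> : t ^+ mdeg mm = t ^+ d * t ^+ (mdeg mm - d) by rewrite -exprD subnKC // (dmin k).
  by rewrite !mulrA (mulrC _@_mm).
have T0 k a : T k 0 a = 0.
  apply: (Jsep (c := fun k => T k 0 a)) => v vP.
  have [h hP] := Bdir vP a; have [R RP] := choice hP.
  (* Along a direction that realizes a to first order, the relation divided by t^d is polynomial in
     t; it holds for t != 0, hence at t = 0, where it becomes a relation between the values of the
     [Jf] at v. *)
  pose F t := \sum_k T k t (fun l => a l + t * R l t) * Jf k (fun k => v k + t * h k).
  have uF : upoly F.
    apply: upoly_sum => i'; apply: upolyM; last exact: Jline.
    apply: upoly_sum => mm; apply: upolyM.
      by apply: upolyM; [exact: upoly_cst | apply: upolyX; exact: upoly_id].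
    apply: upoly_prod => l; apply: upolyX; apply: upolyD; first exact: upoly_cst.
    by apply: upolyM; [exact: upoly_id | have [] := RP l].
  have := @upoly_dense K F id 1 uF (upoly_id _) (oner_neq0 _) _ 0.
  rewrite /F => H; rewrite -[RHS]H.
    apply: eq_bigr => k' _; congr (T _ _ _ * Jf _ _).
      by apply: funext => l; rewrite mul0r addr0.
    by apply: funext => l; rewrite mul0r addr0.
  move=> t nzt; apply: (mulfI (expf_neq0 d nzt)); rewrite mulr0 mulr_sumr.
  rewrite -[RHS](C0 (fun k => v k + t * h k)); apply: eq_bigr => k' _.
  rewrite mulrA -TE SE; congr (_ * _); apply: meval_eq => l.
  by rewrite (proj2 (RP l)); ring.
have [k /hasP[m0 m0s /eqP dm0]] := existsP dP.
pose Hk : {mpoly K[m]} := \sum_(mm <- msupp (S k) | mdeg mm == d) (S k)@_mm *: 'X_[mm].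
have Hk0 : Hk = 0.
  apply: mpoly_fun0 => a; rewrite -[RHS](T0 k a) raddf_sum /= big_mkcond.
  rewrite /T; apply: eq_big_seq => mm mms.
  have := dmin _ _ mms; rewrite leq_eqVlt => /orP[/eqP<-|lt].
    by rewrite eqxx mevalZ mevalX subnn expr0 mulr1.
  by rewrite gtn_eqF // expr0n subn_eq0 leqNgt lt /= mulr0 mul0r.
have := congr1 (mcoeff m0) Hk0; rewrite mcoeff0 raddf_sum /= -big_filter.
have ms : m0 \in [seq mm <- msupp (S k) | mdeg mm == d] by rewrite mem_filter dm0 eqxx.
rewrite (bigD1_seq m0) //=; last by rewrite filter_uniq // msupp_uniq.
rewrite mcoeffZ mcoeffX eqxx mulr1 big1 ?addr0 => [E|mm ne]; last first.
  by rewrite mcoeffZ mcoeffX (negPf ne) mulr0.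
by move: m0s; rewrite mcoeff_msupp E eqxx.
Qed.

End LowestOrder.

(** * Derivatives and gradients of trace words *)

Section Derivative.
Variable K : numClosedFieldType.
Local Notation M6 := 'M[K]_(3 + 3).
Implicit Types (x y z a g : M6).

(** The derivative of the word with respect to x in the direction z, by the Leibniz rule. *)
Fixpoint dword (w : seq bool) x y z : M6 :=
  if w is b :: w' then
    (if b then z *m wordm w' x y + x *m dword w' x y z else y *m dword w' x y z)
  else 0.

Lemma dwordD w x y z z' : dword w x y (z + z') = dword w x y z + dword w x y z'.
Proof.
elim: w => [|[] w IH] /=; rewrite ?addr0 // IH mulmxDr //.
by rewrite mulmxDl addrACA.
Qed.

Lemma dwordZ w x y s z : dword w x y (s *: z) = s *: dword w x y z.
Proof.
elim: w => [|[] w IH] /=; rewrite ?scaler0 // IH -scalemxAr //.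
by rewrite -scalemxAl scalerDr.
Qed.

Lemma word_taylor w x y z : exists R : K -> M6,
  (forall i k, upoly (fun t => R t i k)) /\
  forall t, wordm w (x + t *: z) y = wordm w x y + t *: dword w x y z + t ^+ 2 *: R t.
Proof.
elim: w => [|b w [R [uR RE]]] /=.
  exists (fun=> 0); split=> [i k|t]; first exact: upoly_cst.
  by rewrite !scaler0 !addr0.
have uM (A : M6) (Q : K -> M6) : (forall i k, upoly (fun t => Q t i k)) ->
    forall i k, upoly (fun t => (A *m Q t) i k).
  move=> uQ i k; apply: (@eq_upoly _ (fun t => \sum_l A i l * Q t l k)).
    by move=> t; rewrite mxE.
  by apply: upoly_sum => l; apply: upolyM; [exact: upoly_cst | exact: uQ].
case: b; last first.
  exists (fun t => y *m R t); split; first exact: uM.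
  by move=> t; rewrite RE -!mulmxE !mulmxDr -!scalemxAr.
exists (fun t => x *m R t + z *m dword w x y z + t *: (z *m R t)); split.
  move=> i k; apply: (@eq_upoly _ (fun t => (x *m R t) i k + (z *m dword w x y z) i k
     + t * (z *m R t) i k)); first by move=> t; rewrite !mxE.
  apply: upolyD; last by apply: upolyM; [exact: upoly_id | exact: uM].
  by apply: upolyD; [exact: uM | exact: upoly_cst].
move=> t; rewrite RE -!mulmxE !mulmxDr !mulmxDl -!scalemxAr -!scalemxAl !scalerDr !scalerA.
by rewrite -!addrA expr2; do 3!congr (_ + _); rewrite addrCA.
Qed.

(** The gradient with respect to x of the trace of p times the word: each occurrence of x
    contributes the suffix after it, times p, times the prefix before it. Since z is moved out by
    cyclicity, one gradient serves all twelve directions. *)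
Fixpoint gword (p : M6) (w : seq bool) x y : M6 :=
  if w is b :: w' then
    (if b then wordm w' x y *m p else 0) + gword (p *m (if b then x else y)) w' x y
  else 0.

Lemma dwordE p w x y z : \tr (p *m dword w x y z) = \tr (z *m gword p w x y).
Proof.
elim: w p => [|[] w IH] p /=; first by rewrite !mulmx0.
  rewrite !mulmxDr !linearD /= (mulmxA p x) IH; congr (_ + _).
  by rewrite mxtrace_mulC -mulmxA.
by rewrite mulmxA IH add0r.
Qed.

End Derivative.

(** * Torus invariants as circulations *)

Section Counting.
Local Open Scope nat_scope.

Fixpoint sols (ks : seq nat) (d : nat) : seq (seq nat) :=
  if ks is k :: ks' then
    flatten [seq [seq i :: s | s <- sols ks' (d - i * k)] | i <- iota 0 d.+1 & i * k <= d]
  else if d == 0 then [:: [::]] else [::].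

Fixpoint dotn (ks s : seq nat) : nat :=
  if ks is k :: ks' then head 0 s * k + dotn ks' (behead s) else 0.

Lemma sols_cons k ks d : sols (k :: ks) d =
  flatten [seq [seq i :: s | s <- sols ks (d - i * k)] | i <- iota 0 d.+1 & i * k <= d].
Proof. by []. Qed.

Lemma mem_sols ks d s : all (leq 1) ks ->
  (s \in sols ks d) = (size s == size ks) && (dotn ks s == d).
Proof.
elim: ks d s => [|k ks IH] d s.
  by move=> _; case: d => [|d]; case: s => [|? ?].
rewrite sols_cons => /andP[k0 ks0]; apply/idP/idP.
  case/flatten_mapP => i; rewrite mem_filter => /andP[ikd _] /mapP[s' s'in ->] /=.
  by move: s'in; rewrite IH // => /andP[/eqP-> /eqP->]; rewrite eqxx /= subnKC.
case: s => [//|i s]; rewrite [X in X -> _]/= eqSS => /andP[sz /eqP sd].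
apply/flatten_mapP; exists i; first by rewrite mem_filter mem_iota; nia.
by apply/mapP; exists s => //; rewrite IH // sz /=; apply/eqP; lia.
Qed.

Lemma uniq_sols ks d : all (leq 1) ks -> uniq (sols ks d).
Proof.
elim: ks d => [|k ks IH] d; first by case: d.
rewrite sols_cons.
move=> /andP[k0 ks0].
have : uniq [seq i <- iota 0 d.+1 | i * k <= d] by rewrite filter_uniq ?iota_uniq.
elim: [seq i <- _ | _] => //= i r IHr /andP[nir ur].
rewrite cat_uniq IHr // map_inj_uniq; last by move=> ? ? [].
rewrite IH // andbT.
apply/hasPn => s /flatten_mapP[i' i'r /mapP[s' _ ->]].
by apply/mapP => -[s'' _ [ii' _]]; rewrite -ii' i'r in nir.
Qed.

(** [hs ks] is the coefficient sequence of the power series prod 1/(1 - t^k), k in [ks], and [sh k]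
    is multiplication by t^k. *)
Definition hs ks d := size (sols ks d).
Definition sh k (f : nat -> nat) d := if k <= d then f (d - k) else 0.

Lemma hsE k ks d : hs (k :: ks) d = \sum_(i <- iota 0 d.+1 | i * k <= d) hs ks (d - i * k).
Proof.
rewrite /hs sols_cons size_flatten /shape -map_comp sumnE big_map big_filter.
by apply: eq_bigr => i _ /=; rewrite size_map.
Qed.

(** Either the first entry of a solution is zero or it can be lowered by one: multiplying the series
    by 1 - t^k removes the factor of k. *)
Lemma hs_rec k ks d : 0 < k -> hs (k :: ks) d = hs ks d + sh k (hs (k :: ks)) d.
Proof.
move=> k0; rewrite hsE /= big_cons mul0n leq0n subn0; congr (_ + _).
rewrite -[iota 1 d](map_id) -[1]/(1 + 0) iotaDl map_id big_map /sh.
case: leqP => [le_kd|lt_dk]; last first.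
  by rewrite big_seq_cond big_pred0 // => i; apply/negP => /andP[_]; nia.
rewrite hsE (_ : d = (d - k).+1 + k.-1); last by lia.
rewrite iotaD big_cat /= [X in _ + X = _]big_seq_cond [X in _ + X = _]big_pred0 ?addn0; last first.
  by move=> i; apply/negP => /andP[]; rewrite mem_iota; nia.
rewrite -(_ : d = (d - k).+1 + k.-1); last by lia.
by apply: eq_big => i; [rewrite mulnDl mul1n; lia | rewrite mulnDl mul1n subnDA].
Qed.

(** Division of power series by 1 - t^k is unique; identities between series are proved by checking
    this recursion. *)
Lemma sh_uniq k (g f f' : nat -> nat) : 0 < k ->
  (forall d, f d = g d + sh k f d) -> (forall d, f' d = g d + sh k f' d) -> f =1 f'.
Proof.
move=> k0 fE f'E d; elim/ltn_ind: d => d IH; rewrite fE f'E /sh.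
by case: leqP => // le; rewrite IH //; lia.
Qed.

Lemma sh_sh a b f d : sh a (sh b f) d = sh (a + b) f d.
Proof.
rewrite /sh; case: (leqP a d) => h1; case: (leqP (a + b) d) => h3 //; try lia.
  by rewrite leq_subRL // h3 subnDA.
by rewrite leq_subRL // leqNgt h3.
Qed.

Lemma shD a (f g : nat -> nat) d : sh a (fun d => f d + g d) d = sh a f d + sh a g d.
Proof. by rewrite /sh; case: leqP. Qed.

Lemma hs2E ks d : hs (2 :: ks) d =
  hs (6 :: ks) d + sh 2 (hs (6 :: ks)) d + sh 4 (hs (6 :: ks)) d.
Proof.
apply: (@sh_uniq 2 (hs ks) (hs (2 :: ks)) (fun d => hs (6 :: ks) d +
  sh 2 (hs (6 :: ks)) d + sh 4 (hs (6 :: ks)) d)) => // {}d; first exact: hs_rec.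
rewrite {1}hs_rec // !shD !sh_sh -[2 + 2]/4 -[2 + 4]/6; lia.
Qed.

Lemma hs3E ks d : hs (3 :: ks) d = hs (6 :: ks) d + sh 3 (hs (6 :: ks)) d.
Proof.
apply: (@sh_uniq 3 (hs ks) (hs (3 :: ks)) (fun d => hs (6 :: ks) d +
  sh 3 (hs (6 :: ks)) d)) => // {}d; first exact: hs_rec.
rewrite {1}hs_rec // !shD !sh_sh -[3 + 3]/6; lia.
Qed.

Lemma hs2S ks d : hs (2 :: ks) d = \sum_(w <- [:: 0; 2; 4]) sh w (hs (6 :: ks)) d.
Proof. by rewrite hs2E !big_cons big_nil addn0 addnA [sh 0 _ _]/sh subn0. Qed.

Lemma hs3S ks d : hs (3 :: ks) d = \sum_(w <- [:: 0; 3]) sh w (hs (6 :: ks)) d.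
Proof. by rewrite hs3E !big_cons big_nil addn0 [sh 0 _ _]/sh subn0. Qed.

(** The twelve base invariants have the degrees [3 :: commonW] in x. The building blocks of
    circulations have the sizes [2 :: commonW]: three loops of size 1, six 2-cycles of size 2, and
    the gaps of the potential of sizes 3, 3 and 4. Only the heads 3 and 2 differ. *)
Definition commonW := [:: 1; 1; 1; 2; 2; 2; 2; 2; 3; 3; 4].

Definition perms4 : seq (seq nat) := permutations (iota 0 4).
(** As for P-partitions: if p sorts a potential with ties broken by index, the gap at a descent of p
    is at least 1. Raising a gap by 1 raises the total flow by the number 3, 4 or 3 of edges between
    the values below and above it, and [descw] is the flow forced by the descents. *)
Definition desc (p : seq nat) k : nat := nth 0 p k > nth 0 p k.+1.
Definition descw p := 3 * desc p 0 + 4 * desc p 1 + 3 * desc p 2.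

Definition monoL d : seq (nat * seq nat) :=
  flatten [seq [seq (i, s) | s <- sols (3 :: commonW) (d - basisx i)] |
    i <- iota 0 36 & basisx i <= d].
Definition circL d : seq (seq nat * seq nat) :=
  flatten [seq [seq (p, s) | s <- sols (2 :: commonW) (d - descw p)] |
    p <- perms4 & descw p <= d].

(** Product of generating functions: if f is g times the sum of the t^w, then f times the sum of the
    t^(wt p) is g times the sum of the t^(wt p + w). *)
Lemma sum_sh (T : Type) (P : seq T) (wt : T -> nat) (ws : seq nat) f g d :
  (forall d, f d = \sum_(w <- ws) sh w g d) ->
  \sum_(p <- P | wt p <= d) f (d - wt p) =
  \sum_(w <- flatten [seq [seq wt p + w | w <- ws] | p <- P]) sh w g d.
Proof.
move=> fE; elim: P => [|p P IH]; first by rewrite !big_nil.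
rewrite big_cons [RHS]/= big_cat -IH big_map.
have -> : \sum_(w <- ws) sh (wt p + w) g d = sh (wt p) f d.
  under eq_bigr do rewrite -sh_sh.
  by rewrite /sh; case: leqP => _; rewrite ?fE // big1.
by rewrite /sh; case: leqP.
Qed.

Lemma size_pairs ks (T : Type) (F : T -> nat) (P : seq T) d :
  size (flatten [seq [seq (p, s) | s <- sols ks (d - F p)] | p <- P & F p <= d]) =
  \sum_(p <- P | F p <= d) hs ks (d - F p).
Proof.
rewrite size_flatten /shape -map_comp sumnE big_map big_filter.
by apply: eq_bigr => p _; rewrite /comp size_map.
Qed.

(* Generating functions: 1/(1-t^2) = (1+t^2+t^4)/(1-t^6) and 1/(1-t^3) = (1+t^3)/(1-t^6)
   bring both counts to the same denominator, where the numerators agree. *)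
Lemma size_circL d : size (circL d) = size (monoL d).
Proof.
rewrite /circL /monoL !size_pairs.
rewrite (sum_sh _ descw d (hs2S commonW)) (sum_sh _ basisx d (hs3S commonW)).
by apply: perm_big; vm_compute.
Qed.

(* A torus-invariant monomial is a circulation on the complete graph with 4 vertices:
   a sum of 2-cycles plus a flow, which has a potential [h]; the entries of [s] are the
   multiplicities of the 2-cycles and loops, and the gaps of the sorted potential. *)
Definition pot (p : seq nat) g1 g2 g3 (i : nat) : nat :=
  let h1 := g1 + desc p 0 in
  let h2 := h1 + g2 + desc p 1 in
  nth 0 [:: 0; h1; h2; h2 + g3 + desc p 2] (index i p).

Definition circ (ps : seq nat * seq nat) : seq nat :=
  let q := nth 0 ps.2 in let h := pot ps.1 (q 9) (q 11) (q 10) in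
  [:: q 1; q 0 + (h 1 - h 0); q 5 + (h 0 - h 3);
      q 0 + (h 0 - h 1); q 2; q 4 + (h 2 - h 0);
      q 5 + (h 3 - h 0); q 4 + (h 0 - h 2); q 3;
      q 6 + (h 3 - h 2); q 6 + (h 2 - h 3); q 7 + (h 2 - h 1);
      q 7 + (h 1 - h 2); q 8 + (h 1 - h 3); q 8 + (h 3 - h 1)].

(** Sorting by value and then by index: at a descent of p the indices are in the wrong order, so the
    values cannot be equal and the gap absorbs the extra 1. *)
Lemma sorted_potential (h : nat -> nat) : exists2 p, p \in perms4 &
  exists g1 g2 g3, [/\ h (nth 0 p 1) = h (nth 0 p 0) + g1 + desc p 0,
    h (nth 0 p 2) = h (nth 0 p 1) + g2 + desc p 1 &
    h (nth 0 p 3) = h (nth 0 p 2) + g3 + desc p 2].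
Proof.
pose r i k := (h i < h k) || ((h i == h k) && (i <= k)).
have rtot : total r by move=> i k; rewrite /r; lia.
pose p := sort r (iota 0 4).
have pp : perm_eq p (iota 0 4) by rewrite perm_sort.
exists p; first by rewrite mem_permutations.
have sp : size p = 4 by rewrite (perm_size pp).
have srt : sorted r p := sort_sorted rtot _.
clearbody p; case: p sp srt {pp} => [//|a [//|b [//|c [//|d [|//]]]]] _ /= /and4P[ab bc cd _].
rewrite /desc /=; exists (h b - h a - (a > b)), (h c - h b - (b > c)), (h d - h c - (c > d)).
by move: ab bc cd; rewrite /r => ab bc cd; split; lia.
Qed.

(** The second claim computes the sum of |h i - h k| over all pairs, each absolute value being
    written as two truncated differences; this sum is symmetric, so it can be evaluated along the
    sorted order. *)
Lemma pot_sorted (h : nat -> nat) p g1 g2 g3 : p \in perms4 ->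
  h (nth 0 p 1) = h (nth 0 p 0) + g1 + desc p 0 ->
  h (nth 0 p 2) = h (nth 0 p 1) + g2 + desc p 1 ->
  h (nth 0 p 3) = h (nth 0 p 2) + g3 + desc p 2 ->
  [/\ forall i, i < 4 -> pot p g1 g2 g3 i + h (nth 0 p 0) = h i &
  (h 0 - h 1) + (h 1 - h 0) + ((h 0 - h 2) + (h 2 - h 0)) + ((h 0 - h 3) + (h 3 - h 0)) +
  ((h 1 - h 2) + (h 2 - h 1)) + ((h 1 - h 3) + (h 3 - h 1)) + ((h 2 - h 3) + (h 3 - h 2)) =
  3 * g1 + 4 * g2 + 3 * g3 + descw p].
Proof.
rewrite mem_permutations => pp.
have sp : size p = 4 by rewrite (perm_size pp).
have up : uniq p by rewrite (perm_uniq pp).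
move=> h1 h2 h3; split.
  move=> i i4; have ip : i \in p by rewrite (perm_mem pp) mem_iota.
  have kp : index i p < 4 by rewrite -sp index_mem.
  rewrite -{2}(nth_index 0 ip) /pot; move: (index i p) kp => k.
  by case: k => [|[|[|[|]]]] //= _; lia.
have -> : (h 0 - h 1) + (h 1 - h 0) + ((h 0 - h 2) + (h 2 - h 0)) + ((h 0 - h 3) + (h 3 - h 0)) +
  ((h 1 - h 2) + (h 2 - h 1)) + ((h 1 - h 3) + (h 3 - h 1)) + ((h 2 - h 3) + (h 3 - h 2)) =
  \sum_(i <- p) \sum_(k <- p) (h i - h k).
  rewrite (perm_big _ pp) /=; under eq_bigr do rewrite (perm_big _ pp) /=.
  by rewrite !big_cons !big_nil !subnn; ring.
move: sp h1 h2 h3; rewrite /descw; move: (desc p 0) (desc p 1) (desc p 2) => d0 d1 d2.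
case: p {pp up} => [|a [|b [|c [|d []]]]] //= _.
rewrite !big_cons !big_nil => -> -> ->; move: (h a) => x.
have sub0 n k : n - (n + k) = 0 by lia.
have subK n k : n + k - n = k by lia.
by rewrite -!addnA !subnn; lia.
Qed.

Lemma minn_split a b x y : a + x = b + y -> a = minn a b + (y - x) /\ b = minn a b + (x - y).
Proof. by move=> E; split; lia. Qed.

(** The three equations state balance for the three one-parameter subgroups of the torus. They let
    the net flows along the six edges be written as the six differences of four numbers: the
    complete graph on four vertices is planar, and a circulation on it is the difference of a
    potential on its four faces. The common part of two opposite arrows is a 2-cycle. *)
Lemma circ_cover (m : nat -> nat) d : \sum_(0 <= k < 15) m k = d ->
  m 1 + m 2 + m 9 + m 11 = m 3 + m 6 + m 10 + m 12 ->
  m 3 + m 5 + m 9 + m 13 = m 1 + m 7 + m 10 + m 14 ->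
  m 6 + m 7 + m 11 + m 13 = m 2 + m 5 + m 12 + m 14 ->
  exists2 ps, ps \in circL d & circ ps = mkseq m 15.
Proof.
rewrite unlock /= => dE e1 e2 e3.
have [h [H1 [H2 [H3 [H4 [H5 H6]]]]]] : exists h : nat -> nat,
    m 1 + h 0 = m 3 + h 1 /\ m 5 + h 0 = m 7 + h 2 /\ m 6 + h 0 = m 2 + h 3 /\
    m 9 + h 2 = m 10 + h 3 /\ m 11 + h 1 = m 12 + h 2 /\ m 13 + h 3 = m 14 + h 1.
  (* The offset m 3 + m 7 + m 2 makes the potential, which is determined up to a constant, a natural
     number everywhere. *)
  exists (nth 0 [:: m 3 + m 7 + m 2; m 1 + m 7 + m 2; m 5 + m 3 + m 2; m 6 + m 3 + m 7]).
  by rewrite /=; do !split; lia.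
have [p pin [g1 [g2 [g3 [h1 h2 h3]]]]] := sorted_potential h.
pose s := [:: minn (m 1) (m 3); m 0; m 4; m 8; minn (m 5) (m 7); minn (m 6) (m 2);
  minn (m 9) (m 10); minn (m 11) (m 12); minn (m 13) (m 14); g1; g3; g2].
have [pE hE] := pot_sorted pin h1 h2 h3.
have [M1 M3] := minn_split H1; have [M5 M7] := minn_split H2; have [M6 M2] := minn_split H3.
have [M9 M10] := minn_split H4; have [M11 M12] := minn_split H5; have [M13 M14] := minn_split H6.
have hB i k : i < 4 -> k < 4 -> h i - h k = pot p g1 g2 g3 i - pot p g1 g2 g3 k.
  by move=> li lk; rewrite -(pE i li) -(pE k lk) subnDr.
have sE : dotn (2 :: commonW) s + descw p = d.
  rewrite /= -dE; move: hE M1 M2 M3 M5 M6 M7 M9 M10 M11 M12 M13 M14; clear.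
  move: (descw p) (minn _ _) (minn _ _) (minn _ _) (minn _ _) (minn _ _) (minn _ _).
  move: (h 0 - h 1) (h 1 - h 0) (h 0 - h 2) (h 2 - h 0) (h 0 - h 3) (h 3 - h 0).
  move: (h 1 - h 2) (h 2 - h 1) (h 1 - h 3) (h 3 - h 1) (h 2 - h 3) (h 3 - h 2).
  lia.
exists (p, s); last first.
  rewrite /circ /mkseq /= -!hB //.
  by rewrite -M1 -M2 -M3 -M5 -M6 -M7 -M9 -M10 -M11 -M12 -M13 -M14.
apply/flatten_mapP; exists p; first by rewrite mem_filter pin andbT -sE leq_addl.
by apply/mapP; exists s => //; rewrite mem_sols // -sE addnK eqxx.
Qed.

End Counting.

Section TorusInvariants.
Variable K : numClosedFieldType.

(** The polynomial with coefficients p@_m (prod s^m - l) vanishes as a function, hence all its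
    coefficients are zero. *)
Lemma coef_weight n (p : {mpoly K[n]}) (s : 'I_n -> K) l :
  (forall v, p.@[fun k => s k * v k] = l * p.@[v]) ->
  forall m : 'X_{1..n}, m \in msupp p -> \prod_k s k ^+ m k = l.
Proof.
move=> sp m ms.
pose q : {mpoly K[n]} := \sum_(m <- msupp p) (p@_m * (\prod_k s k ^+ m k - l))%:MP * 'X_[m].
have q0 : q = 0.
  apply: mpoly_fun0 => v; apply/eqP; rewrite -(subrr (l * p.@[v])) -{1}sp.
  rewrite /q (raddf_sum (meval v)) !mpoly_evalE mulr_sumr -sumrB.
  apply/eqP/eq_bigr => m' _ /=.
  rewrite mevalM mevalC mevalX; under [in RHS]eq_bigr do rewrite exprMn.
  by rewrite big_split /=; ring.
have : q@_m = 0 by rewrite q0 mcoeff0.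
have sumE r : (\sum_(m' <- r) (p@_m' * (\prod_k s k ^+ m' k - l))%:MP * 'X_[m'])@_m =
    \sum_(m' <- r) p@_m' * (\prod_k s k ^+ m' k - l) * (m' == m)%:R.
  elim: r => [|m' r IH]; first by rewrite !big_nil mcoeff0.
  by rewrite !big_cons mcoeffD IH mcoeffCM mcoeffX.
rewrite sumE (bigD1_seq m) ?msupp_uniq //=.
rewrite eqxx mulr1 [X in _ + X]big1 ?addr0 => [/eqP|m' ne]; last first.
  by rewrite (negPf ne) mulr0.
by rewrite mulf_eq0 mcoeff_eq0 ms subr_eq0 => /eqP.
Qed.

Definition circmono (l : seq nat) (v : 'I_15 -> K) : K := \prod_k v k ^+ nth 0%N l k.

(* Weights of the coordinates under the one-parameter subgroups of the diagonal torus. *)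
Definition axp (a : nat) : seq nat := nth [::]
  [:: [:: 1; 2; 9; 11]; [:: 3; 5; 9; 13]; [:: 6; 7; 11; 13]]%N a.
Definition axn (a : nat) : seq nat := nth [::]
  [:: [:: 3; 6; 10; 12]; [:: 1; 7; 10; 14]; [:: 2; 5; 12; 14]]%N a.
Definition axis (a : nat) (v : 'I_15 -> K) (k : 'I_15) : K :=
  (2 ^+ ((k : nat) \in axp a) / 2 ^+ ((k : nat) \in axn a)) * v k.

(** Since the powers of 2 are distinct in characteristic 0, the single element 2 of each
    one-parameter group detects degree and weight. The monomials that occur are thus circulations of
    size d. *)
Lemma balanced_span d (g : ('I_15 -> K) -> K) : mfun g ->
  (forall v, g (fun k => 2 * v k) = 2 ^+ d * g v) ->
  (forall a, (a < 3)%N -> forall v, g (axis a v) = g v) ->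
  exists c : 'I_(size (circL d)) -> K, forall v,
    g v = \sum_l c l * circmono (circ (nth ([::], [::]) (circL d) l)) v.
Proof.
move=> [p gp] gd ga.
have inj2 a b : (2 : K) ^+ a = 2 ^+ b -> a = b.
  by rewrite -!natrX => /eqP; rewrite eqr_nat eqn_exp2l // => /eqP.
have deg (m : 'X_{1..15}) : m \in msupp p -> (\sum_(k < 15) m k)%N = d.
  move=> ms; apply: inj2; rewrite -(@coef_weight _ p (fun=> 2) (2 ^+ d) _ _ ms).
    by rewrite expr_sum.
  by move=> v; rewrite -!gp gd.
have bal a (m : 'X_{1..15}) : (a < 3)%N -> m \in msupp p ->
    (\sum_(k < 15) ((k : nat) \in axp a) * m k = \sum_(k < 15) ((k : nat) \in axn a) * m k)%N.
  move=> a3 ms; apply: inj2.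
  have := @coef_weight _ p (fun k => 2 ^+ ((k : nat) \in axp a) / 2 ^+ ((k : nat) \in axn a)) 1 _ _ ms.
  under eq_bigr do rewrite exprMn exprVn -!exprM.
  rewrite big_split /= prodfV -!expr_sum => E.
  by apply: divr1_eq; apply: E => v; rewrite -!gp ga // mul1r.
have E (m : 'X_{1..15}) : exists c : 'I_(size (circL d)) -> K, m \in msupp p ->
    forall v : 'I_15 -> K, p@_m * \prod_k v k ^+ m k =
      \sum_l c l * circmono (circ (nth ([::], [::]) (circL d) l)) v.
  have [ms|nms] := boolP (m \in msupp p); last by exists (fun=> 0).
  have [ps psin psE] : exists2 ps, ps \in circL d & circ ps = mkseq (nth 0%N m) 15.
    have nthE (k : 'I_15) : m k = nth 0%N m k by rewrite (mnm_nth 0%N).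
    have balN a : (a < 3)%N -> (\sum_(0 <= k < 15) ((k : nat) \in axp a) * nth 0 m k =
        \sum_(0 <= k < 15) ((k : nat) \in axn a) * nth 0 m k)%N.
      move=> a3; rewrite !big_mkord; have := bal a m a3 ms => E.
      rewrite (eq_bigr (fun k : 'I_15 => ((k : nat) \in axp a) * m k)%N); last by move=> k _; rewrite nthE.
      by rewrite E; apply: eq_bigr => k _; rewrite nthE.
    move: {balN}(balN 0%N isT) (balN 1%N isT) (balN 2%N isT).
    rewrite !unlock /= !mul0n !mul1n !add0n ?addn0 => e0 e1 e2.
    apply: circ_cover.
    - by rewrite big_mkord -(deg m ms); apply: eq_bigr => k _; rewrite nthE.
    - by rewrite -!addnA.
    - by rewrite -!addnA.
    - by rewrite -!addnA.
  have ls : (index ps (circL d) < size (circL d))%N by rewrite index_mem.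
  exists (fun l => if l == Ordinal ls then p@_m else 0) => _ v.
  rewrite (bigD1 (Ordinal ls)) //= eqxx nth_index // psE [X in _ + X]big1 ?addr0; last first.
    by move=> l /negPf->; rewrite mul0r.
  congr (_ * _); apply: eq_bigr => k _.
  by rewrite nth_mkseq // (mnm_nth 0%N).
have [c cE] := choice E.
exists (fun l => \sum_(m <- msupp p) c m l) => v.
rewrite gp mpoly_evalE (eq_bigr _ (fun l _ => mulr_suml _ _ _ _)) exchange_big /=.
by rewrite big_seq [RHS]big_seq; apply: eq_bigr => m ms; rewrite cE.
Qed.

End TorusInvariants.

(** * Exact arithmetic over a quartic field *)

Module Z := Stdlib.ZArith.BinInt.Z.
Notation Z := BinNums.Z.
Delimit Scope Z_scope with BZ.
Number Notation BinNums.Z Z.of_num_int Z.to_num_int : Z_scope.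

(* [MkQ4 a b c d] is a + b w + c w^2 + d w^3, where w^4 = 6 w^3 - 12 w^2 + 10 w - 5. *)
Record Q4 := MkQ4 { q0 : Z; q1 : Z; q2 : Z; q3 : Z }.

Definition q4D (a b : Q4) := MkQ4 (Z.add (q0 a) (q0 b)) (Z.add (q1 a) (q1 b))
  (Z.add (q2 a) (q2 b)) (Z.add (q3 a) (q3 b)).
Definition q4Z (s : Z) (a : Q4) :=
  MkQ4 (Z.mul s (q0 a)) (Z.mul s (q1 a)) (Z.mul s (q2 a)) (Z.mul s (q3 a)).
(** Multiplication by w, reduced by the quartic equation; [q4M] is Horner's scheme in w. *)
Definition q4w (a : Q4) := MkQ4 (Z.mul (-5)%BZ (q3 a)) (Z.add (q0 a) (Z.mul 10%BZ (q3 a)))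
  (Z.add (q1 a) (Z.mul (-12)%BZ (q3 a))) (Z.add (q2 a) (Z.mul 6%BZ (q3 a))).
Definition q4M (a b : Q4) := q4D (q4Z (q0 a) b) (q4w (q4D (q4Z (q1 a) b)
  (q4w (q4D (q4Z (q2 a) b) (q4w (q4Z (q3 a) b)))))).
Definition q4c (s : Z) := MkQ4 s 0%BZ 0%BZ 0%BZ.
Definition q4eq (a b : Q4) := [&& Z.eqb (q0 a) (q0 b), Z.eqb (q1 a) (q1 b),
  Z.eqb (q2 a) (q2 b) & Z.eqb (q3 a) (q3 b)].

Lemma q4eqP a b : q4eq a b -> a = b.
Proof.
case: a b => [a0 a1 a2 a3] [b0 b1 b2 b3] /and4P[/=].
by move=> /Z.eqb_eq -> /Z.eqb_eq -> /Z.eqb_eq -> /Z.eqb_eq ->.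
Qed.

Definition sum6 (f : nat -> Q4) := q4D (f 0%N) (q4D (f 1%N) (q4D (f 2%N)
  (q4D (f 3%N) (q4D (f 4%N) (f 5%N))))).
(** Matrices are tabulated as lists of exact numbers, so that the identities at the point can be
    decided by evaluation; [mxL] carries them to matrices over K. *)
Definition tab (f : nat -> nat -> Q4) :=
  [seq [seq f i k | k <- iota 0 6] | i <- iota 0 6].
Definition get (A : seq (seq Q4)) i k := nth (q4c 0%BZ) (nth [::] A i) k.
Definition mulL A B := tab (fun i k => sum6 (fun l => q4M (get A i l) (get B l k))).
Definition addL A B := tab (fun i k => q4D (get A i k) (get B i k)).
Definition oneL := tab (fun i k => q4c (if i == k then 1%BZ else 0%BZ)).
Definition zeroL := tab (fun i k => q4c 0%BZ).
Definition traceL A := sum6 (fun i => get A i i).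
Definition xL v := tab (fun i k =>
  if sg i k is 0%N then q4c 0%BZ else q4Z (if sg i k is 1%N then 1%BZ else (-1)%BZ) (nth (q4c 0%BZ) v (ix i k))).
Definition eL := tab (fun i k => q4c (nth 0%BZ (nth [::]
  [:: [:: 0; 0; 0; 0; 0; 0]; [:: 1; 0; 0; 0; 0; 0]; [:: 0; 1; 0; 0; 0; 0];
      [:: 0; 0; 0; 0; -1; 0]; [:: 0; 0; 0; 0; 0; -1]; [:: 0; 0; 1; 0; 0; 0]]%BZ i) k)).

Definition wordL w X E := foldr (fun (b : bool) a => mulL (if b then X else E) a) oneL w.
Fixpoint gwordL P w X E :=
  if w is b :: w' then
    addL (if b then mulL (wordL w' X E) P else zeroL) (gwordL (mulL P (if b then X else E)) w' X E)
  else zeroL.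

Section Evaluation.
Variables (K : numClosedFieldType) (w : K).
Hypothesis wE : w ^+ 4 = 6 * w ^+ 3 - 12 * w ^+ 2 + 10 * w - 5.
Local Notation M6 := 'M[K]_(3 + 3).

Definition zK (s : Z) : K := (int_of_Z s)%:~R.
Lemma zKD a b : zK (Z.add a b) = zK a + zK b.
Proof. by rewrite /zK -rmorphD -(rmorphD int_of_Z). Qed.
Lemma zKM a b : zK (Z.mul a b) = zK a * zK b.
Proof. by rewrite /zK -rmorphM -(rmorphM int_of_Z). Qed.

Definition ev (a : Q4) : K := zK (q0 a) + zK (q1 a) * w + zK (q2 a) * w ^+ 2 + zK (q3 a) * w ^+ 3.

Lemma evD a b : ev (q4D a b) = ev a + ev b.
Proof. by rewrite /ev /= !zKD; ring. Qed.
Lemma evZ s a : ev (q4Z s a) = zK s * ev a.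
Proof. by rewrite /ev /= !zKM; ring. Qed.
Lemma evw a : ev (q4w a) = w * ev a.
Proof.
rewrite /ev; cbn [q4w q0 q1 q2 q3]; rewrite !zKD !zKM.
have -> : zK (-5)%BZ = - 5 by []. have -> : zK 10%BZ = 10 by [].
have -> : zK (-12)%BZ = - 12 by []. have -> : zK 6%BZ = 6 by [].
rewrite !mulrDr (mulrCA w _ (w ^+ 3)) -exprS wE; ring.
Qed.
Lemma evM a b : ev (q4M a b) = ev a * ev b.
Proof. by rewrite /q4M !(evD, evw, evZ) [ev a in RHS]/ev; ring. Qed.
Lemma evc s : ev (q4c s) = zK s.
Proof. by rewrite /ev /= (_ : zK 0%BZ = 0) // !mul0r !addr0. Qed.

Lemma ev_sum6 f : ev (sum6 f) = \sum_(i < 6) ev (f i).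
Proof. by rewrite /sum6 !evD !big_ord_recl big_ord0 /= addr0. Qed.

Definition mxL (A : seq (seq Q4)) : M6 := \matrix_(i, k) ev (get A i k).

Lemma get_tab f (i k : nat) : (i < 6)%N -> (k < 6)%N -> get (tab f) i k = f i k.
Proof.
move=> li lk; rewrite /get /tab (nth_map 0%N) ?size_iota // (nth_map 0%N) ?size_iota //.
by rewrite !nth_iota.
Qed.

Lemma mx_tab f : mxL (tab f) = \matrix_(i, k) ev (f i k).
Proof. by apply/matrixP => i k; rewrite !mxE get_tab. Qed.

Lemma mx_mul A B : mxL (mulL A B) = mxL A *m mxL B.
Proof.
rewrite mx_tab; apply/matrixP => i k; rewrite !mxE ev_sum6.
by apply: eq_bigr => l _; rewrite evM !mxE.
Qed.

Lemma mx_add A B : mxL (addL A B) = mxL A + mxL B.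
Proof. by rewrite mx_tab; apply/matrixP => i k; rewrite !mxE evD. Qed.

Lemma mx_one : mxL oneL = 1%:M.
Proof. by rewrite mx_tab; apply/matrixP => i k; rewrite !mxE evc -val_eqE /=; case: eqP. Qed.

Lemma mx_zero : mxL zeroL = 0.
Proof. by rewrite mx_tab; apply/matrixP => i k; rewrite !mxE evc. Qed.

Lemma ev_tr A : ev (traceL A) = \tr (mxL A).
Proof. by rewrite ev_sum6; apply: eq_bigr => i _; rewrite mxE. Qed.

Definition vL (v : seq Q4) (k : 'I_15) : K := ev (nth (q4c 0%BZ) v k).

Lemma mx_x v : mxL (xL v) = xmat (vL v).
Proof.
rewrite mx_tab; apply/matrixP => i k; rewrite !mxE /vL.
by ord6 i; ord6 k; rewrite /sg /ix /= ?inordK // ?evZ ?evc ?mul0r.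
Qed.

Lemma mx_e : mxL eL = ymat (fun=> 0).
Proof.
by rewrite mx_tab; apply/matrixP => i k; rewrite !mxE evc; ord6 i; ord6 k.
Qed.

Lemma mx_word ws X E : mxL (wordL ws X E) = wordm ws (mxL X) (mxL E).
Proof. by elim: ws => [|b ws IH] /=; rewrite ?mx_one // mx_mul IH; case: b. Qed.

Lemma mx_gword P ws X E : mxL (gwordL P ws X E) = gword (mxL P) ws (mxL X) (mxL E).
Proof.
elim: ws P => [|b ws IH] P /=; first exact: mx_zero.
by rewrite mx_add IH; case: b; rewrite ?mx_zero !mx_mul ?mx_word.
Qed.

End Evaluation.

(* A point [xiL] where the base invariants but j_10 and j_12 vanish on x + [ymat 0], and
   directions [dirL] dual, up to the integers [dirN], to the differentials of the base
   invariants there. The rows of [sepL] separate the values of the basis elements of equal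
   degree modulo 9. All were found by solving linear systems over Q(w). *)
Definition xiL : seq Q4 := ([:: MkQ4 0 0 0 0; MkQ4 0 0 0 0; MkQ4 0 0 0 0; MkQ4 0 0 0 0;
    MkQ4 0 4 (-4) 4; MkQ4 (-4) 4 (-4) 0; MkQ4 32 (-64) 72 (-32); MkQ4 (-16) 36 (-40) 20;
    MkQ4 0 (-4) 4 (-4); MkQ4 1 0 0 0; MkQ4 64 (-128) 144 (-64); MkQ4 0 0 0 0;
    MkQ4 (-64) 128 (-144) 64; MkQ4 0 0 0 0; MkQ4 32 (-64) 72 (-32)])%BZ.
Definition dirL : seq (seq Q4) := ([:: [:: MkQ4 0 0 0 0; MkQ4 0 0 0 0; MkQ4 0 0 0 0;
    MkQ4 0 0 0 0; MkQ4 (-515) 1718 (-1059) 184; MkQ4 645 (-909) 402 (-57);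
    MkQ4 240 (-396) (-72) 72; MkQ4 (-20) 442 (-156) (-4); MkQ4 515 (-1718) 1059 (-184);
    MkQ4 0 0 0 0; MkQ4 (-1760) 2916 (-2088) 468; MkQ4 0 0 0 0; MkQ4 640 (-1062) 1116 (-306);
    MkQ4 0 0 0 0; MkQ4 240 (-396) (-72) 72];
  [:: MkQ4 45 0 0 0; MkQ4 0 0 0 0; MkQ4 0 0 0 0; MkQ4 0 0 0 0; MkQ4 5 (-42) 16 (-6);
    MkQ4 (-30) 51 (-18) 3; MkQ4 (-60) 144 (-132) 72; MkQ4 20 (-48) 24 (-24);
    MkQ4 (-5) 42 (-16) 6; MkQ4 0 0 0 0; MkQ4 (-520) 936 (-1048) 408; MkQ4 0 0 0 0;
    MkQ4 320 (-612) 656 (-276); MkQ4 0 0 0 0; MkQ4 (-60) 144 (-132) 72];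
  [:: MkQ4 0 0 0 0; MkQ4 0 0 0 0; MkQ4 3 0 0 0; MkQ4 0 0 0 0; MkQ4 24 (-38) 40 (-10);
    MkQ4 (-6) 15 (-12) 3; MkQ4 (-84) 120 (-132) 24; MkQ4 72 (-108) 120 (-28);
    MkQ4 (-24) 38 (-40) 10; MkQ4 0 0 0 0; MkQ4 (-216) 344 (-376) 104; MkQ4 0 0 0 0;
    MkQ4 144 (-208) 224 (-40); MkQ4 0 0 0 0; MkQ4 (-84) 132 (-144) 36];
  [:: MkQ4 0 0 0 0; MkQ4 0 0 0 0; MkQ4 0 0 0 0; MkQ4 0 0 0 0; MkQ4 0 4 (-4) 4; MkQ4 0 0 0 0;
    MkQ4 96 (-192) 216 (-96); MkQ4 (-32) 72 (-80) 40; MkQ4 0 (-4) 4 (-4); MkQ4 (-3) 0 0 0;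
    MkQ4 320 (-640) 720 (-320); MkQ4 0 0 0 0; MkQ4 (-256) 512 (-576) 256; MkQ4 0 0 0 0;
    MkQ4 96 (-192) 216 (-96)];
  [:: MkQ4 0 0 0 0; MkQ4 0 0 0 0; MkQ4 0 0 0 0; MkQ4 0 0 0 0; MkQ4 290 (-474) 362 (-82);
    MkQ4 (-120) 147 (-96) 21; MkQ4 (-660) 1008 (-1044) 264; MkQ4 420 (-756) 808 (-208);
    MkQ4 (-290) 474 (-362) 82; MkQ4 0 0 0 0; MkQ4 (-1160) 1392 (-1656) 416; MkQ4 0 0 0 0;
    MkQ4 1240 (-1704) 1872 (-472); MkQ4 0 0 0 0; MkQ4 (-660) 1008 (-1044) 264];
  [:: MkQ4 0 0 0 0; MkQ4 0 0 0 0; MkQ4 0 0 0 0; MkQ4 0 0 0 0; MkQ4 (-6) 4 28 (-12);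
    MkQ4 6 33 (-36) 9; MkQ4 (-192) 288 (-324) 96; MkQ4 92 (-154) 188 (-58);
    MkQ4 6 (-4) (-28) 12; MkQ4 0 0 0 0; MkQ4 (-464) 744 (-792) 232; MkQ4 0 0 0 0;
    MkQ4 424 (-660) 720 (-212); MkQ4 0 0 0 0; MkQ4 (-156) 288 (-324) 96];
  [:: MkQ4 0 0 0 0; MkQ4 0 0 0 0; MkQ4 0 0 0 0; MkQ4 0 0 0 0; MkQ4 240 (-364) 302 (-72);
    MkQ4 (-150) (-33) 54 (-9); MkQ4 (-600) 1008 (-1044) 264; MkQ4 460 (-866) 868 (-218);
    MkQ4 (-240) 364 (-302) 72; MkQ4 0 0 0 0; MkQ4 (-880) 1392 (-1656) 416; MkQ4 0 0 0 0;
    MkQ4 1040 (-1704) 1872 (-472); MkQ4 0 0 0 0; MkQ4 (-600) 1008 (-1044) 264];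
  [:: MkQ4 30 0 0 0; MkQ4 0 0 0 0; MkQ4 0 0 0 0; MkQ4 0 0 0 0; MkQ4 (-10) (-42) 16 (-6);
    MkQ4 (-30) 51 (-18) 3; MkQ4 (-60) 144 (-132) 72; MkQ4 20 (-48) 24 (-24);
    MkQ4 (-20) 42 (-16) 6; MkQ4 0 0 0 0; MkQ4 (-520) 936 (-1048) 408; MkQ4 0 0 0 0;
    MkQ4 320 (-612) 656 (-276); MkQ4 0 0 0 0; MkQ4 (-60) 144 (-132) 72];
  [:: MkQ4 0 0 0 0; MkQ4 0 0 0 0; MkQ4 15 0 0 0; MkQ4 0 0 0 0; MkQ4 20 (-42) 36 (-6);
    MkQ4 0 51 (-18) 3; MkQ4 60 (-156) 168 (-108); MkQ4 20 (-8) 24 16; MkQ4 (-20) 42 (-36) 6;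
    MkQ4 0 0 0 0; MkQ4 (-40) 56 (-48) 8; MkQ4 0 0 0 0; MkQ4 (-280) 548 (-624) 284;
    MkQ4 (-15) 0 0 0; MkQ4 60 (-96) 108 (-48)];
  [:: MkQ4 0 0 0 0; MkQ4 0 0 0 0; MkQ4 0 0 0 0; MkQ4 0 0 0 0; MkQ4 125 (-74) 42 (-12);
    MkQ4 75 (-243) 144 (-24); MkQ4 (-180) 168 (-264) 84; MkQ4 340 (-251) 188 (-53);
    MkQ4 (-125) 74 (-42) 12; MkQ4 0 0 0 0; MkQ4 (-600) 892 (-896) 236; MkQ4 0 0 0 0;
    MkQ4 480 (-614) 712 (-202); MkQ4 0 0 0 0; MkQ4 (-180) 168 (-264) 84];
  [:: MkQ4 0 0 0 0; MkQ4 0 0 0 0; MkQ4 0 0 0 0; MkQ4 0 0 0 0; MkQ4 40 (-52) 24 (-4);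
    MkQ4 (-21) 54 (-33) 6; MkQ4 (-24) 60 (-48) 12; MkQ4 60 (-90) 50 (-10);
    MkQ4 (-40) 52 (-24) 4; MkQ4 0 0 0 0; MkQ4 (-64) 160 (-128) 32; MkQ4 0 0 0 0;
    MkQ4 56 (-140) 112 (-28); MkQ4 0 0 0 0; MkQ4 (-24) 60 (-48) 12];
  [:: MkQ4 0 0 0 0; MkQ4 0 0 0 0; MkQ4 0 0 0 0; MkQ4 0 0 0 0; MkQ4 (-6180) 7686 (-3128) 418;
    MkQ4 540 2967 (-2586) 531; MkQ4 780 1848 (-2124) 504; MkQ4 (-3460) 2284 8 (-148);
    MkQ4 6180 (-7686) 3128 (-418); MkQ4 0 0 0 0; MkQ4 (-4040) 2792 (-1056) 216; MkQ4 0 0 0 0;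
    MkQ4 520 4316 (-2928) 468; MkQ4 0 0 0 0; MkQ4 780 1848 (-2124) 504]])%BZ.
Definition dirN : seq Z := ([:: 4320; 90; 6; 6; 1440; 72; 720; 60; 60; 720; 72; 11520])%BZ.
Definition sepL : seq (seq Z) := ([:: [:: (-928); (-911); (-140); 573];
  [:: (-21644); (-16104); 1579; 13947];
  [:: (-113577); (-71155); 20860; 74700];
  [:: 575; (-2250); (-2564); (-674)];
  [:: 67994; (-94957); (-142041); (-60309)];
  [:: 5121; 3968; (-225); (-3282)];
  [:: 10464; 2525; (-5718); (-7339)];
  [:: 1513; 3393; 2025; (-718)];
  [:: (-964); 1390; 2055; 860];
  [:: (-26772); (-16111); 5540; 17683];
  [:: 377; (-29); (-319); (-278)];
  [:: (-10034); (-5425); 2654; 6697];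
  [:: 67260; (-194338); (-235073); (-71037)];
  [:: 1728; 1943; 493; (-1039)];
  [:: 145; 650; 500; (-32)];
  [:: 44781; (-11373); (-45359); (-33921)];
  [:: 4996; 50292; 43501; 2059];
  [:: (-750); (-11255); (-10020); (-729)];
  [:: 3248; 1375; (-1218); (-2211)];
  [:: (-145); (-650); (-500); 32];
  [:: 1665; 82; (-1211); (-1204)];
  [:: (-63162); (-32625); 18142; 42329];
  [:: (-2095); 2818; 4275; 1846];
  [:: 749; 60; (-523); (-539)];
  [:: (-3463); 75; 2750; 2532];
  [:: 42798; (-214717); (-235340); (-55521)];
  [:: 1090; 2332; 1353; (-530)];
  [:: (-367); 4761; 4768; 807];
  [:: (-208); (-2511); (-2204); (-133)];
  [:: (-638); 389; 860; 509];
  [:: (-7008); 1361; 6704; 5261];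
  [:: 1027; 471; (-351); (-695)];
  [:: 6641; 3400; (-1936); (-4454)];
  [:: (-638); 389; 860; 509];
  [:: (-2818); (-4275); (-1846); 1569];
  [:: 4716; (-17669); (-20290); (-5439)]])%BZ.

Definition wL k := traceL (wordL (nth [::] words k) (xL xiL) eL).
Definition dL k := let G := gwordL oneL (nth [::] words k) (xL xiL) eL in
  [seq traceL (mulL (xL h) G) | h <- dirL].

(** The value of j_12 at the point, named after its torus weight 9. *)
Definition f9 := wL 11.
Definition baseval l := if l is 3%N then q4c (-2)%BZ else if l is 10%N then f9 else q4c 0%BZ.

Lemma base_check : all (fun l => q4eq (wL (nth 0%N baseL l)) (baseval l)) (iota 0 12).
Proof. by vm_compute. Qed.

Lemma dir_check : all (fun l => all (fun k => q4eq (nth (q4c 0%BZ) (dL (nth 0%N baseL l)) k)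
  (if k == l then q4c (nth 0%BZ dirN k) else q4c 0%BZ)) (iota 0 12)) (iota 0 12).
Proof. by vm_compute. Qed.

(** * Independence at the nilpotent element: the explicit points *)

Section FunctionClosure.
Variables (K : numClosedFieldType) (T : Type) (P : (T -> K) -> Prop).
Hypothesis (P_cst : forall c, P (fun=> c)).
Hypothesis (PD : forall f g, P f -> P g -> P (fun t => f t + g t)).
Hypothesis (PM : forall f g, P f -> P g -> P (fun t => f t * g t)).
Local Notation M6 := 'M[K]_(3 + 3).

(** P stands for any class of functions that contains the constants and is closed under sums and
    products: polynomials in one or several parameters, polynomial functions on matrices, or the
    members of a subalgebra such as [Csharp]. *)
Lemma closed_sum I (r : seq I) (F : I -> T -> K) :
  (forall i, P (F i)) -> P (fun t => \sum_(i <- r) F i t).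
Proof.
move=> PF; elim: r => [|i r IH].
  by rewrite (_ : (fun _ => _) = fun=> 0) //; apply: funext => t; rewrite big_nil.
rewrite (_ : (fun _ => _) = fun t => F i t + \sum_(i <- r) F i t); first exact: PD.
by apply: funext => t; rewrite big_cons.
Qed.

Lemma closed_prod I (r : seq I) (F : I -> T -> K) :
  (forall i, P (F i)) -> P (fun t => \prod_(i <- r) F i t).
Proof.
move=> PF; elim: r => [|i r IH].
  by rewrite (_ : (fun _ => _) = fun=> 1) //; apply: funext => t; rewrite big_nil.
rewrite (_ : (fun _ => _) = fun t => F i t * \prod_(i <- r) F i t); first exact: PM.
by apply: funext => t; rewrite big_cons.
Qed.

Lemma closed_exp F n : P F -> P (fun t => F t ^+ n).
Proof.
move=> PF; elim: n => [|n IH]; first exact: (P_cst 1).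
rewrite (_ : (fun _ => _) = fun t => F t * F t ^+ n); first exact: PM.
by apply: funext => t; rewrite exprS.
Qed.

Lemma closed_mpoly n (p : {mpoly K[n]}) (F : 'I_n -> T -> K) :
  (forall i, P (F i)) -> P (fun t => p.@[fun i => F i t]).
Proof.
move=> PF; rewrite (_ : (fun _ => _) =
    fun t => \sum_(m <- msupp p) p@_m * \prod_i F i t ^+ m i).
  apply: closed_sum => m; apply: PM; first exact: P_cst.
  by apply: closed_prod => i; apply: closed_exp.
by apply: funext => t; rewrite mpoly_evalE.
Qed.

Variables x y : T -> M6.
Hypothesis Px : forall i k, P (fun t => x t i k).
Hypothesis Py : forall i k, P (fun t => y t i k).

Lemma closed_jw k : P (fun t => jw k (x t) (y t)).
Proof.
have Pw w i l : P (fun t => wordm w (x t) (y t) i l).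
  elim: w i l => [|b w IH] i l.
    rewrite (_ : (fun _ => _) = fun=> (i == l)%:R); first exact: P_cst.
    by apply: funext => t; rewrite /= mxE.
  rewrite (_ : (fun _ => _) = fun t =>
      \sum_m (if b then x t else y t) i m * wordm w (x t) (y t) m l).
    by apply: closed_sum => m; apply: PM; first by case: b.
  by apply: funext => t; rewrite /= -mulmxE mxE.
by apply: closed_sum => i; apply: Pw.
Qed.

Lemma closed_base l : P (fun t => base (x t) (y t) l).
Proof. exact: closed_jw. Qed.

Lemma closed_basis i : P (fun t => basis i (x t) (y t)).
Proof. by apply: closed_prod => k; apply: closed_jw. Qed.

Lemma closed_mono p : P (fun t => mono p (x t) (y t)).
Proof.
apply: PM; last exact: closed_basis.
by apply: closed_prod => l; apply: closed_exp; apply: closed_base.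
Qed.

End FunctionClosure.

Section NilpotentIndependence.
Variable K : numClosedFieldType.
Local Notation M6 := 'M[K]_(3 + 3).
Local Notation e := (ymat (fun=> 0 : K)).

Lemma ymat_cact u (c : 'I_3 -> K) : gtor u *m ymat (cact u c) = u *: (ymat c *m gtor u).
Proof.
rewrite mul_diag_mx mul_mx_diag; apply/matrixP => i k; rewrite !mxE /cact.
case: i => [[|[|[|[|[|[|//]]]]]] ?]; case: k => [[|[|[|[|[|[|//]]]]]] ?];
  by rewrite /kap /= ?inordK //; ring.
Qed.

Lemma ymat_inter u (c : 'I_3 -> K) : u != 0 ->
  ymat c *m gtor u = u^-1 *: (gtor u *m ymat (cact u c)).
Proof. by move=> nzu; rewrite ymat_cact scalerA mulVf // scale1r. Qed.

Lemma cact0 (u : K) : cact u (fun=> 0) = fun=> 0.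
Proof. by apply: funext => k; rewrite /cact mulr0. Qed.

Lemma xmatD v v' : xmat (fun k => v k + v' k) = xmat v + xmat v' :> M6.
Proof. by apply/matrixP => i k; rewrite !mxE mulrDr. Qed.

Lemma xmatZ s v : xmat (fun k => s * v k) = s *: xmat v :> M6.
Proof. by apply/matrixP => i k; rewrite !mxE mulrCA. Qed.

Lemma xmat_sum n (a : 'I_n -> K) (v : 'I_n -> 'I_15 -> K) :
  xmat (fun k => \sum_l a l * v l k) = \sum_l a l *: xmat (v l) :> M6.
Proof.
apply/matrixP => i k; rewrite summxE !mxE mulr_sumr; apply: eq_bigr => l _.
by rewrite !mxE mulrCA.
Qed.

(** The torus multiplies e by a scalar only, so on the fibre over e each invariant becomes
    homogeneous for [tau]; x contributes weight 4 and y weight -1. *)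
Lemma jw_tau k u v : u != 0 -> (wdy k <= 4 * wdx k)%N ->
  jw k (xmat (tau u v)) e = u ^+ (4 * wdx k - wdy k) * jw k (xmat v) e.
Proof.
move=> nzu le; rewrite (jw_inter k (gtor_unit nzu) (xmat_tau u v) (ymat_inter _ nzu)) cact0.
by rewrite -exprM exprVn -{1}(subnK le) exprD mulfK // expf_neq0.
Qed.

Definition dbase l := (4 * basex l - basey l)%N.
Definition dbasis i := (4 * basisx i - basisy i)%N.

Lemma base_tau (l : 'I_12) u v : u != 0 ->
  base (xmat (tau u v)) e l = u ^+ dbase l * base (xmat v) e l.
Proof.
move=> nzu; apply: jw_tau => //.
by case: l => [[|[|[|[|[|[|[|[|[|[|[|[|//]]]]]]]]]]]] ?].
Qed.

Lemma basis_tau i u v : (i < 36)%N -> u != 0 ->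
  basis i (xmat (tau u v)) e = u ^+ dbasis i * basis i (xmat v) e.
Proof.
move=> li nzu.
rewrite (basis_inter i (gtor_unit nzu) (xmat_tau u v) (ymat_inter _ nzu)) cact0.
have le : (basisy i <= 4 * basisx i)%N.
  have : all (fun i => basisy i <= 4 * basisx i)%N (iota 0 36) by vm_compute.
  by move/allP; apply; rewrite mem_iota.
by rewrite -exprM exprVn -{1}(subnK le) exprD mulfK // expf_neq0.
Qed.

(** A polynomial with simple roots has as many roots as its degree, too many for q. This serves both
    the equation for u and the quartic for w. *)
Lemma roots_eq0 (p q : {poly K}) : (forall x, root p x -> p^`().[x] != 0) ->
  (forall x, root p x -> q.[x] = 0) -> (size q < size p)%N -> q = 0.
Proof.
move=> sp pq lt; apply/eqP/negPn/negP => nzq.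
have [rs pE] := closed_field_poly_normal p.
have nzp : lead_coef p != 0 by rewrite lead_coef_eq0 -size_poly_gt0; case: (size p) lt.
have rP x : (x \in rs) = root p x by rewrite pE rootZ // root_prod_XsubC.
have : (size rs < size q)%N.
  apply: max_poly_roots => //; first by apply/allP => x; rewrite rP /root => /pq ->.
  rewrite -separable_prod_XsubC.
  have -> : separable_poly (\prod_(x <- rs) ('X - x%:P)) = separable_poly p.
    by rewrite [in RHS]pE; apply: eqp_separable; rewrite eqp_sym; apply: eqp_scale.
  by rewrite separable_poly.unlock; apply/Pdiv.ClosedField.coprimepP.
by rewrite ltnNge; move: lt; rewrite {1}pE size_scale // (size_prod_XsubC _ id) ltnS => ->.
Qed.

Definition indep_at (y : M6) := forall C : 'I_36 -> {mpoly K[12]},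
  (forall v, \sum_i (C i).@[fun l => base (xmat v) y l] * basis i (xmat v) y = 0) ->
  forall i, C i = 0.

End NilpotentIndependence.

Definition vals := Eval vm_compute in map wL (iota 0 28).
Lemma vals_check : all (fun k => q4eq (nth (q4c 0%BZ) vals k) (wL k)) (iota 0 28).
Proof. by vm_compute. Qed.

Definition bval i := foldr (fun k a => q4M (nth (q4c 0%BZ) vals k) a) (q4c 1%BZ) (nth [::] basisL i).
Definition f9v := nth (q4c 0%BZ) vals 11.
(* [basis i] at the point, homogenized to degree 18 + (dbasis i %% 9) by powers of [f9]. *)
Definition sval i := iter (2 - dbasis i %/ 9)%N (q4M f9v) (bval i).
Definition sdot (L : seq Z) (a : Q4) : Z :=
  Z.add (Z.mul (nth 0%BZ L 0) (q0 a)) (Z.add (Z.mul (nth 0%BZ L 1) (q1 a))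
    (Z.add (Z.mul (nth 0%BZ L 2) (q2 a)) (Z.mul (nth 0%BZ L 3) (q3 a)))).

Lemma sep_check : all (fun i => all (fun k => (dbasis i %% 9 == dbasis k %% 9)%N ==>
  (Z.eqb (sdot (nth [::] sepL i) (sval k)) 0%BZ == (i != k))) (iota 0 36)) (iota 0 36).
Proof. by vm_compute. Qed.

Section NilpotentPoint.
Variable K : numClosedFieldType.
Local Notation M6 := 'M[K]_(3 + 3).
Local Notation e := (ymat (fun=> 0 : K)).
Local Notation h w := (w ^+ 4 = 6 * w ^+ 3 - 12 * w ^+ 2 + 10 * w - 5).

Lemma jw_point (w : K) k : h w -> (k < 28)%N ->
  jw k (xmat (vL w xiL)) e = ev w (wL k).
Proof.
by move=> hw lk; rewrite /wL ev_tr mx_word // mx_x mx_e /jw.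
Qed.

Lemma vals_ev (w : K) k : h w -> (k < 28)%N ->
  jw k (xmat (vL w xiL)) e = ev w (nth (q4c 0%BZ) vals k).
Proof.
move=> hw lk; rewrite jw_point //; congr (ev w _); apply/esym/q4eqP.
by have /allP := vals_check; apply; rewrite mem_iota.
Qed.

Lemma basis_ev (w : K) i : h w -> (i < 36)%N ->
  basis i (xmat (vL w xiL)) e = ev w (bval i).
Proof.
move=> hw li; rewrite /basis /bval.
have : all (fun k => k < 28)%N (nth [::] basisL i).
  by do 36?[case: i li => [//|i] li].
elim: (nth _ _ _) => [_|k r IH /= /andP[lk /IH Er]]; first by rewrite big_nil evc.
by rewrite big_cons Er evM // vals_ev.
Qed.

Lemma base_ev (w : K) (l : 'I_12) : h w ->
  base (xmat (vL w xiL)) e l = ev w (baseval l).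
Proof.
move=> hw; rewrite /base jw_point //; last first.
  by case: l => [[|[|[|[|[|[|[|[|[|[|[|[|//]]]]]]]]]]]] ?].
congr (ev w _); apply: q4eqP.
by have /allP := base_check; apply; rewrite mem_iota ltn_ord.
Qed.

Lemma dir_ev (w : K) (l k : 'I_12) : h w ->
  \tr (dword (nth [::] words (nth 0%N baseL l)) (xmat (vL w xiL)) e
        (xmat (vL w (nth [::] dirL k)))) = (zK K (nth 0%BZ dirN k)) *+ (k == l).
Proof.
move=> hw; rewrite -[dword _ _ _ _]mul1mx dwordE -(mx_one w) -!(mx_x w) -(mx_e w).
rewrite -mx_gword // -mx_mul // -ev_tr.
have mi (m : 'I_12) : (m : nat) \in iota 0 12 by rewrite mem_iota /= ltn_ord.
have /allP/(_ _ (mi l))/allP/(_ _ (mi k))/q4eqP E := dir_check.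
have -> : traceL (mulL (xL (nth [::] dirL k)) (gwordL oneL (nth [::] words (nth 0%N baseL l)) (xL xiL) eL))
   = nth (q4c 0%BZ) (dL (nth 0%N baseL l)) k.
  by rewrite /dL (nth_map [::]).
rewrite E -val_eqE /=; case: eqP => _; rewrite evc ?mulr1n ?mulr0n //.
Qed.

(** The four roots w and, for each, the nine values of u that normalize j_12 to 1. The weight of
    j_10 is zero, so its value -2 in [nilbase] is unaffected by u. *)
Definition nilpoint (v : 'I_15 -> K) := exists w u,
  [/\ h w, u ^+ 9 * ev w f9v = 1 & v = tau u (vL w xiL)].
Definition nilbase (l : 'I_12) : K := nth 0 [:: 0; 0; 0; - 2; 0; 0; 0; 0; 0; 0; 1; 0] l.

Lemma nilpoint_unit u (z : K) : u ^+ 9 * z = 1 -> u != 0.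
Proof.
by move=> E; apply/eqP => u0; move/eqP: E; rewrite u0 expr0n /= mul0r eq_sym oner_eq0.
Qed.

Lemma f9E : f9 = f9v.
Proof.
have /allP/(_ 11%N isT)/q4eqP := vals_check.
by rewrite /f9v /f9 => ->.
Qed.

Lemma dirN_neq0 (l : 'I_12) : zK K (nth 0%BZ dirN l) != 0.
Proof.
by case: l => [[|[|[|[|[|[|[|[|[|[|[|[|//]]]]]]]]]]]] ?]; rewrite /zK intr_eq0.
Qed.

Lemma nilbaseE w u (l : 'I_12) : u ^+ 9 * ev w f9v = 1 ->
  u ^+ dbase l * ev w (baseval l) = nilbase l.
Proof.
move=> uw; case: l => [[|[|[|[|[|[|[|[|[|[|[|[|//]]]]]]]]]]]] ?];
  rewrite /baseval /nilbase ?f9E ?evc ?mulr0 //=.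
by rewrite expr0 mul1r.
Qed.

(** The duality of [dirL] makes the differentials independent at the original point. The
    coefficients are divided by [dirN] and by the torus weights, which compensates for moving the
    direction by [tau u]. *)
Lemma nil_dir v : nilpoint v -> forall a : 'I_12 -> K, exists d : 'I_15 -> K,
  forall l : 'I_12, exists R, upoly R /\
    forall t, base (xmat (fun k => v k + t * d k)) e l = nilbase l + t * a l + t ^+ 2 * R t.
Proof.
move=> [w [u [hw uw vE]]] a; have nzu := nilpoint_unit uw.
pose g k := \sum_(l < 12) (a l / u ^+ dbase l / zK K (nth 0%BZ dirN l)) *
  vL w (nth [::] dirL l) k.
exists (tau u g) => l.
have [R [uR RE]] := word_taylor (nth [::] words (nth 0%N baseL l)) (xmat (vL w xiL)) e (xmat g).
exists (fun t => u ^+ dbase l * \tr (R t)); split.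
  apply: upolyM; first exact: upoly_cst.
  by apply: upoly_sum => i; apply: uR.
move=> t.
have -> : (fun k => v k + t * tau u g k) = tau u (fun k => vL w xiL k + t * g k).
  by apply: funext => k; rewrite vE /tau [RHS]mulrDr [X in _ = _ + X]mulrCA.
rewrite base_tau // {1}/base /jw xmatD xmatZ RE !linearD /= !linearZ /=.
have -> : \tr (wordm (nth [::] words (nth 0%N baseL l)) (xmat (vL w xiL)) e) = ev w (baseval l).
  by rewrite -base_ev //.
have -> : \tr (dword (nth [::] words (nth 0%N baseL l)) (xmat (vL w xiL)) e (xmat g))
    = a l / u ^+ dbase l.
  rewrite xmat_sum.
  have dsum (s : seq 'I_12) F : dword (nth [::] words (nth 0%N baseL l)) (xmat (vL w xiL)) e
      (\sum_(k <- s) F k) = \sum_(k <- s) dword (nth [::] words (nth 0%N baseL l)) (xmat (vL w xiL)) e (F k).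
    elim: s => [|k s IH]; rewrite ?big_nil; last by rewrite !big_cons dwordD IH.
    by have := dwordZ (nth [::] words (nth 0%N baseL l)) (xmat (vL w xiL)) e 0 0; rewrite !scale0r.
  rewrite dsum linear_sum (bigD1 l) //= big1 ?addr0 => [|k ne].
    rewrite dwordZ linearZ /= dir_ev // eqxx mulr1n divfK //.
    exact: dirN_neq0.
  by rewrite dwordZ linearZ /= dir_ev // (negPf ne) mulr0n mulr0.
rewrite 2!mulrDr; congr (_ + _ + _); last by rewrite mulrCA.
- exact: (nilbaseE _ uw).
- by rewrite mulrCA; congr (_ * _); rewrite mulrCA mulfV ?mulr1 // expf_neq0.
Qed.

Definition cubic (a b c d : K) : {poly K} := a%:P + b *: 'X + c *: 'X^2 + d *: 'X^3.

Lemma cubicE a b c d w : (cubic a b c d).[w] = a + b * w + c * w ^+ 2 + d * w ^+ 3.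
Proof. by rewrite /cubic !hornerE. Qed.

Lemma size_cubic a b c d : (size (cubic a b c d) <= 4)%N.
Proof.
rewrite /cubic; do 3?[apply: (leq_trans (size_polyD _ _)); rewrite geq_max; apply/andP; split];
  try by apply: (leq_trans (size_scale_leq _ _)); rewrite ?size_polyXn ?size_polyX.
exact: (leq_trans (size_polyC_leq1 _)).
Qed.

Lemma coef_cubic a b c d i : (cubic a b c d)`_i = nth 0 [:: a; b; c; d] i.
Proof.
rewrite /cubic !coefD !coefZ coefC coefX !coefXn.
by case: i => [|[|[|[|i]]]]; rewrite /= ?mulr0 ?mulr1 ?addr0 ?add0r ?nth_nil.
Qed.

Definition hpoly : {poly K} := 'X^4 + cubic 5 (- 10) 12 (- 6).

Lemma hpolyE w : hpoly.[w] = w ^+ 4 - 6 * w ^+ 3 + 12 * w ^+ 2 - 10 * w + 5.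
Proof. by rewrite /hpoly hornerD cubicE hornerXn; ring. Qed.

Lemma size_hpoly : size hpoly = 5.
Proof. by rewrite /hpoly size_polyDl size_polyXn // ltnS size_cubic. Qed.

Lemma hpoly_root w : root hpoly w -> h w.
Proof.
rewrite /root hpolyE => /eqP E; apply/eqP; rewrite -subr_eq0 -E; apply/eqP; ring.
Qed.

Lemma hpoly_deriv w : root hpoly w -> hpoly^`().[w] != 0.
Proof.
rewrite /root hpolyE => /eqP E; apply/eqP => D0.
have D : hpoly^`().[w] = 4 * w ^+ 3 - 18 * w ^+ 2 + 24 * w - 10.
  by rewrite /hpoly /cubic !(derivD, derivZ, derivXn, derivX, derivC) /= !(hornerD, hornerZ, hornerMn, hornerXn, hornerX, hornerC); ring.
(* A Bezout relation between the quartic and its derivative: they have no common root. *)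
have : (20 : K) = (34 - 48 * w + 24 * w ^+ 2) *
    (w ^+ 4 - 6 * w ^+ 3 + 12 * w ^+ 2 - 10 * w + 5) +
    (15 - 22 * w + 21 * w ^+ 2 - 6 * w ^+ 3) * (4 * w ^+ 3 - 18 * w ^+ 2 + 24 * w - 10).
  by ring.
by rewrite E -D D0 !mulr0 addr0 => /eqP; rewrite pnatr_eq0.
Qed.

Lemma f9_neq0 (w : K) : h w -> ev w f9v != 0.
Proof.
move=> hw; apply/eqP => z0.
(* The second factor is 32 times the inverse of j_12 in Q(w). *)
have := evM hw f9v (MkQ4 42%BZ (-91)%BZ 52%BZ (-9)%BZ); rewrite z0 mul0r.
have -> : q4M f9v (MkQ4 42%BZ (-91)%BZ 52%BZ (-9)%BZ) = q4c 32%BZ by vm_compute.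
by rewrite evc => /eqP; rewrite /zK intr_eq0.
Qed.

Lemma ev_sval (w : K) i : h w -> ev w (sval i) = ev w f9v ^+ (2 - dbasis i %/ 9)%N * ev w (bval i).
Proof.
move=> hw; rewrite /sval; elim: (2 - _)%N => [|n IH] /=; first by rewrite expr0 mul1r.
by rewrite evM // IH exprS mulrA.
Qed.

(** The values are separated in three stages. For fixed w, a polynomial of degree less than 9 in u
    vanishes at nine points, which splits the relation by [dbasis] modulo 9. Each part is a
    polynomial of degree less than 4 in w that vanishes at four points, so its four coordinates are
    zero. Within a class, the rows of [sepL] then isolate each coefficient. *)
Lemma nil_sep (c : 'I_36 -> K) :
  (forall v, nilpoint v -> \sum_i c i * basis i (xmat v) e = 0) -> forall i, c i = 0.
Proof.
move=> c0.
have sep1 (w : K) rho : h w -> (rho < 9)%N ->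
    \sum_(i < 36 | (dbasis i %% 9 == rho)%N) c i * ev w (sval i) = 0.
  move=> hw lt; set z := ev w f9v.
  have nzz : z != 0 := f9_neq0 hw.
  pose q : {poly K} := \sum_(i < 36) (c i * ev w (sval i)) *: 'X^(dbasis i %% 9)%N.
  pose p : {poly K} := 'X^9 - (z^-1)%:P.
  have pE u : root p u -> u ^+ 9 * z = 1.
    by rewrite /root !hornerE subr_eq0 => /eqP ->; rewrite mulVf.
  have sp : size p = 10 by rewrite size_XnsubC.
  have q0 : q = 0.
    apply: (@roots_eq0 _ p).
    - move=> u /pE uz; rewrite /p derivB derivXn derivC subr0 hornerMn hornerXn /=.
      by rewrite mulrn_eq0 /= expf_neq0 // (nilpoint_unit uz).
    - move=> u /pE uz; have nzu := nilpoint_unit uz.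
      (* Since u^9 z = 1, multiplication by z^2 reduces the exponents of u modulo 9; the power 2
         suffices because no weight [dbasis i] reaches 27. *)
      rewrite -[RHS](mulr0 (z ^+ 2)) -(c0 (tau u (vL w xiL))); last by exists w, u.
      rewrite mulr_sumr horner_sum; apply: eq_bigr => i _.
      rewrite hornerZ hornerXn basis_tau // basis_ev // ev_sval // -/z.
      have le2 : (dbasis i %/ 9 <= 2)%N.
        have : all (fun i => dbasis i %/ 9 <= 2)%N (iota 0 36) by vm_compute.
        by move/allP; apply; rewrite mem_iota ltn_ord.
      have E9 : u ^+ dbasis i * z ^+ (dbasis i %/ 9)%N = u ^+ (dbasis i %% 9)%N.
        by rewrite {1}(divn_eq (dbasis i) 9) exprD mulnC exprM mulrAC -exprMn uz expr1n mul1r.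
      have Z2 : z ^+ 2 = z ^+ (2 - dbasis i %/ 9)%N * z ^+ (dbasis i %/ 9)%N by rewrite -exprD subnK.
      by rewrite -E9 Z2; ring.
    - rewrite sp ltnS; apply: (leq_trans (size_sum _ _ _)); apply/bigmax_leqP => i _.
      apply: (leq_trans (size_scale_leq _ _)); rewrite size_polyXn.
      by rewrite (leq_ltn_trans _ (ltn_pmod (dbasis i) (isT : 0 < 9)%N)).
  have := congr1 (fun q : {poly K} => q`_rho) q0; rewrite coef0 coef_sum => E.
  rewrite -[RHS]E [LHS]big_mkcond; apply: eq_bigr => i _.
  by rewrite coefZ coefXn eq_sym; case: eqP => _; rewrite ?mulr1 ?mulr0.
have sep2 rho (g : Q4 -> Z) : (rho < 9)%N -> g = q0 \/ g = q1 \/ g = q2 \/ g = q3 ->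
    \sum_(i < 36 | (dbasis i %% 9 == rho)%N) c i * zK K (g (sval i)) = 0.
  move=> lt.
  pose a g := \sum_(i < 36 | (dbasis i %% 9 == rho)%N) c i * zK K (g (sval i)).
  have Q0 : cubic (a q0) (a q1) (a q2) (a q3) = 0.
    apply: (roots_eq0 hpoly_deriv); last first.
      by rewrite size_hpoly ltnS size_cubic.
    move=> w /hpoly_root hw; rewrite cubicE -[RHS](sep1 w rho hw lt).
    rewrite (eq_bigr (fun i : 'I_36 => c i * zK K (q0 (sval i)) + c i * zK K (q1 (sval i)) * w
      + c i * zK K (q2 (sval i)) * w ^+ 2 + c i * zK K (q3 (sval i)) * w ^+ 3)).
      rewrite !big_split /= -!mulr_suml -/(a q0) -/(a q1) -/(a q2) -/(a q3); ring.
    by move=> i _; rewrite /ev; ring.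
  have co n : nth 0 [:: a q0; a q1; a q2; a q3] n = 0 by rewrite -coef_cubic Q0 coef0.
  by move=> [->|[->|[->|->]]]; [exact: (co 0%N) | exact: (co 1%N) | exact: (co 2%N) | exact: (co 3%N)].
move=> k; set rho := (dbasis k %% 9)%N.
have lt : (rho < 9)%N by rewrite ltn_pmod.
have mi (m : 'I_36) : (m : nat) \in iota 0 36 by rewrite mem_iota /= ltn_ord.
have chk := allP (allP sep_check _ (mi k)) _ (mi _).
have : \sum_(i < 36 | (dbasis i %% 9 == rho)%N) c i * zK K (sdot (nth [::] sepL k) (sval i)) = 0.
  rewrite (eq_bigr (fun i : 'I_36 => zK K (nth 0%BZ (nth [::] sepL k) 0) * (c i * zK K (q0 (sval i))) +
    (zK K (nth 0%BZ (nth [::] sepL k) 1) * (c i * zK K (q1 (sval i)))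
    + (zK K (nth 0%BZ (nth [::] sepL k) 2) * (c i * zK K (q2 (sval i)))
     + zK K (nth 0%BZ (nth [::] sepL k) 3) * (c i * zK K (q3 (sval i))))))).
    by rewrite !big_split /= -!mulr_sumr !sep2 ?mulr0 ?addr0 //; tauto.
  by move=> i _; rewrite /sdot !zKD !zKM; ring.
rewrite (bigD1 k) //= big1 ?addr0 => [/eqP|i /andP[ri ne]]; last first.
  have kni : (k != i :> nat) by rewrite val_eqE eq_sym.
  have := chk i; rewrite [(_ == dbasis i %% 9)%N]eq_sym ri kni /= => /eqP/Z.eqb_eq ->.
  by rewrite (_ : zK K 0%BZ = 0) ?mulr0.
rewrite mulf_eq0 => /orP[/eqP//|zk].
have := chk k; rewrite !eqxx /= => /eqP; rewrite (_ : sdot _ _ = 0%BZ) //.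
move: zk; rewrite /zK intr_eq0 => /eqP E.
by rewrite -[LHS]int_of_ZK E.
Qed.

Lemma nilpotent_indep : indep_at (e : M6).
Proof.
apply: (@lowest_order_indep K 15 12 36 (fun l v => base (xmat v) e l)
  (fun i v => basis i (xmat v) e) nilpoint nilbase).
- move=> i v d; apply: (closed_basis (@upoly_cst K) (@upolyD K) (@upolyM K)).
    move=> a k; apply: (@eq_upoly _ (fun t => xmat v a k + t * xmat d a k)).
      by move=> t; rewrite !mxE; ring.
    apply: upolyD; first exact: upoly_cst.
    by apply: upolyM; [exact: upoly_id | exact: upoly_cst].
  by move=> a k; exact: upoly_cst.
- exact: nil_dir.
- exact: nil_sep.
Qed.

End NilpotentPoint.

(** * Independence along the slice and spanning *)

Section Transport.
Variable K : numClosedFieldType.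
Local Notation M6 := 'M[K]_(3 + 3).
Local Notation mexp := ('I_36 * 'X_{1..12})%type.
Implicit Types (x y z a g : M6).

(** The same independence as [indep_at], for finite families of monomials with constant
    coefficients: this form can be expressed by determinants of values and so be deformed along the
    slice. *)
Definition indep_monos y := forall N (idx : 'I_N -> mexp), injective idx ->
  indep_funs (fun k (v : 'I_15 -> K) => mono (idx k) (xmat v) y).

Lemma mcoeff_sumX n I (r : seq I) (P : pred I) (c : I -> K) (f : I -> 'X_{1..n}) m :
  (\sum_(k <- r | P k) (c k)%:MP * 'X_[f k])@_m = \sum_(k <- r | P k) c k * (f k == m)%:R.
Proof.
elim: r => [|k r IH]; first by rewrite !big_nil mcoeff0.
by rewrite !big_cons; case: ifP; rewrite ?mcoeffD IH // mcoeffCM mcoeffX.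
Qed.

Lemma meval_sumX n I (r : seq I) (P : pred I) (c : I -> K) (f : I -> 'X_{1..n}) (v : 'I_n -> K) :
  (\sum_(k <- r | P k) (c k)%:MP * 'X_[f k]).@[v] =
  \sum_(k <- r | P k) c k * \prod_i v i ^+ f k i.
Proof.
elim: r => [|k r IH]; first by rewrite !big_nil meval0.
by rewrite !big_cons; case: ifP; rewrite ?mevalD IH // mevalM mevalC mevalX.
Qed.

Lemma indep_monos_at y : indep_at y -> indep_monos y.
Proof.
move=> ind N idx inj c c0 k.
pose C i : {mpoly K[12]} := \sum_(k | (idx k).1 == i) (c k)%:MP * 'X_[(idx k).2].
have : (C (idx k).1)@_((idx k).2) = 0.
  rewrite (ind C) ?mcoeff0 // => v; rewrite -[RHS](c0 v).
  rewrite [RHS](partition_big (fun k => (idx k).1) xpredT) //=; apply: eq_bigr => i _.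
  rewrite /C meval_sumX mulr_suml; apply: eq_bigr => l /eqP <-.
  by rewrite /mono mulrA.
rewrite /C mcoeff_sumX (bigD1 k) //= eqxx mulr1 [X in _ + X]big1 ?addr0 // => l /andP[/eqP e1 ne].
case: eqP => [e2|]; last by rewrite mulr0.
by case/eqP: ne; apply: inj; move: e1 e2; case: (idx l) (idx k) => ? ? [? ?] /= -> ->.
Qed.

Lemma indep_at_monos y : indep_monos y -> indep_at y.
Proof.
move=> ind C C0 i.
pose L : seq mexp := [seq (i, m) | i <- enum 'I_36, m <- (msupp (C i) : seq 'X_{1..12})].
have memL p : (p \in L) = (p.2 \in msupp (C p.1)).
  apply/allpairsPdep/idP => [[k [m [_ ms ->]]] //|ms].
  by exists p.1, p.2; split => //; [rewrite mem_enum | case: p ms].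
have uL : uniq L.
  apply: allpairs_uniq_dep => [|k _|]; [exact: enum_uniq | exact: msupp_uniq |].
  by apply: in2W => -[x1 y1] [x2 y2] /= [-> ->].
pose p0 : mexp := (i, 0%MM).
pose idx (k : 'I_(size L)) := nth p0 L k.
have inj : injective idx by move=> k l /eqP; rewrite nth_uniq // => /eqP/val_inj.
have cE := ind _ idx inj (fun k => (C (idx k).1)@_((idx k).2)).
apply/mpolyP => m; rewrite mcoeff0.
have [ms|] := boolP (m \in msupp (C i)); last exact: memN_msupp_eq0.
have mL : (i, m) \in L by rewrite memL.
have ls : (index (i, m) L < size L)%N by rewrite index_mem.
have := cE _ (Ordinal ls); rewrite /idx nth_index //=; apply => v.
rewrite -[RHS](C0 v) -(big_mkord xpredT (fun k => (C (nth p0 L k).1)@_((nth p0 L k).2) *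
  mono (nth p0 L k) (xmat v) y)) -(big_nth p0 xpredT (fun p => (C p.1)@_(p.2) * mono p (xmat v) y)).
rewrite /L big_allpairs_dep /= big_enum; apply: eq_bigr => k _.
rewrite mpoly_evalE mulr_suml; apply: eq_bigr => m' _.
by rewrite /mono /= mulrA.
Qed.

Lemma cact_zero (c : 'I_3 -> K) : cact 0 c = fun=> 0.
Proof. by apply/funext => k; rewrite /cact expr0n muln_eq0 /= mul0r. Qed.

Lemma mono_torus p u v (c : 'I_3 -> K) : u != 0 ->
  mono p (xmat (tau u v)) (ymat c) =
  (u ^+ 4) ^+ monox p * u^-1 ^+ monoy p * mono p (xmat v) (ymat (cact u c)).
Proof.
by move=> u0; apply: mono_inter (gtor_unit u0) (xmat_tau u v) (ymat_inter c u0).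
Qed.

Lemma mfun_ymat i k : mfun (fun c : 'I_3 -> K => ymat c i k).
Proof.
have v := mfun_var K; have w := @mfun_cst K 3.
case: i => [[|[|[|[|[|[|//]]]]]] ?]; case: k => [[|[|[|[|[|[|//]]]]]] ?];
  (apply: eq_mfun; [by move=> c; rewrite mxE /= | try exact: w; exact: mfun_var]).
Qed.

Lemma mfun_mono_ymat p x : mfun (fun c : 'I_3 -> K => mono p x (ymat c)).
Proof.
apply: (closed_mono (@mfun_cst K 3) (@mfunD K 3) (@mfunM K 3) (x := fun=> x) (y := @ymat K)).
- by move=> i k; exact: mfun_cst.
- exact: mfun_ymat.
Qed.

Lemma upoly_cact (f : ('I_3 -> K) -> K) (c : 'I_3 -> K) :
  mfun f -> upoly (fun u => f (cact u c)).
Proof.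
move=> mf; apply: (upoly_mfun mf) => i; apply: upolyM; last exact: upoly_cst.
by apply: upolyX; exact: upoly_id.
Qed.

(** A determinant of values at fixed points is polynomial in c and non-zero at [cact 0 c] = 0, hence
    at [cact u c] for some u != 0. The torus relates the monomials at [cact u c] to those at c by
    non-zero factors, so a relation at c would annihilate an invertible matrix. *)
Lemma indep_monos_ymat c : indep_monos (ymat c : M6).
Proof.
move=> N idx inj.
have [v det0] := indep_points (@indep_monos_at _ (@nilpotent_indep K) N idx inj).
pose M c : 'M[K]_N := \matrix_(l, k) mono (idx k) (xmat (v l)) (ymat c).
have [u u0 detu] : exists2 u, u != 0 & \det (M (cact u c)) != 0.
  apply: contrapT => nou; move/eqP: det0; apply.
  rewrite -[RHS](_ : \det (M (cact 0 c)) = 0); first by rewrite cact_zero.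
  have uF : upoly (fun u => \det (M (cact u c))).
    apply: (@upoly_cact (fun c => \det (M c)) c); apply: mfun_det => i k.
    by apply: eq_mfun (mfun_mono_ymat (idx k) (xmat (v i))) => c'; rewrite mxE.
  apply: (upoly_dense uF (@upoly_id K) (oner_neq0 K)) => u nzu.
  by apply/eqP/negPn/negP => nz; apply: nou; exists u.
move=> a a0 k.
pose b k := a k * ((u ^+ 4) ^+ monox (idx k) * u^-1 ^+ monoy (idx k)).
have b0 : M (cact u c) *m (\col_k b k) = 0.
  apply/colP => l; rewrite !mxE -[RHS](a0 (tau u (v l))); apply: eq_bigr => k' _.
  by rewrite mono_torus // mxE [X in _ * X]mxE /b [LHS]mulrC -[LHS]mulrA.
have : (\col_k b k) = 0.
  by rewrite -[LHS](mulKmx (_ : M (cact u c) \in unitmx)) ?b0 ?mulmx0 // unitmxE unitfE.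
move=> /colP/(_ k); rewrite !mxE => /eqP; rewrite mulf_eq0 => /orP[/eqP //|].
by rewrite mulf_eq0 !expf_eq0 invr_eq0 (negPf u0) !andbF.
Qed.

Lemma indep_monos_conj g y : Sp g -> indep_monos y -> indep_monos (g *m y *m invmx g).
Proof.
move=> Sg ind N idx inj a a0; apply: (ind N idx inj) => v.
have sx : symm (g *m xmat v *m invmx g) by apply: symm_Sp => //; exact: symm_xmat.
rewrite -[RHS](a0 (fun k => (g *m xmat v *m invmx g) (xrow k) (xcol k))).
by apply: eq_bigr => k _; rewrite -symm_xmatP // mono_conj //; apply: Sp_unit.
Qed.

Lemma indep_monos_ydiag (b : 'I_3 -> K) : generic b -> indep_monos (ydiag b).
Proof.
move=> /ymat_diag[a [Sa <-]]; apply: indep_monos_conj => //; exact: indep_monos_ymat.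
Qed.

End Transport.

Section Span.
Variable K : numClosedFieldType.
Local Notation M6 := 'M[K]_(3 + 3).
Local Notation mexp := ('I_36 * 'X_{1..12})%type.
Implicit Types (x y z g : M6).

Definition axisrow (a : nat) : 'rV[K]_(3 + 3) :=
  \row_i (2 ^+ ((i : nat) == a) / 2 ^+ ((i : nat) == a + 3)%N).
Definition axisg (a : nat) : M6 := diag_mx (axisrow a).

Lemma axisg_Sp a : (a < 3)%N -> Sp (axisg a).
Proof.
move=> a3; apply: Sp_diag => i; rewrite !mxE /=.
have -> : (i == a + 3 :> nat)%N = false by apply/negbTE; rewrite neq_ltn ltn_addl.
have -> : (3 + i == a :> nat)%N = false by apply/negbTE; rewrite neq_ltn orbC ltn_addr.
rewrite (addnC a) eqn_add2l !expr0 divr1 mul1r mulfV // expf_neq0 // pnatr_eq0 //.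
Qed.

Lemma axis_check : all (fun a => all (fun i => all (fun k => (sg i k == 0)%N ||
  ((ix i k \in axp a) + (k == a) + (i == a + 3) ==
   (ix i k \in axn a) + (k == a + 3) + (i == a))%N)
  (iota 0 6)) (iota 0 6)) (iota 0 3).
Proof. by vm_compute. Qed.

Lemma xmat_axis a v : (a < 3)%N -> xmat (axis a v) *m axisg a = axisg a *m xmat v.
Proof.
move=> a3; rewrite mul_diag_mx mul_mx_diag; apply/matrixP => i k; rewrite !mxE /axis.
have := allP axis_check a; rewrite mem_iota a3 => /(_ isT)/allP/(_ (i : nat)).
rewrite mem_iota (ltn_ord i) => /(_ isT)/allP/(_ (k : nat)); rewrite mem_iota (ltn_ord k).
move=> /(_ isT)/orP[/eqP->|]; first by rewrite !mul0r mulr0.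
rewrite inordK; last first.
  have : all (fun i => all (fun k => ix i k < 15)%N (iota 0 6)) (iota 0 6) by vm_compute.
  move=> /allP/(_ (i : nat)); rewrite mem_iota => /(_ (ltn_ord i))/allP/(_ (k : nat)).
  by rewrite mem_iota => /(_ (ltn_ord k)).
move: (nth _ _ _) (v _) (_ \in _ : bool) (_ \in _ : bool) => s w.
move: ((i : nat) == a) ((k : nat) == a) ((i : nat) == (a + 3)%N) ((k : nat) == (a + 3)%N).
have two n : (2 : K) ^+ n != 0 by rewrite expf_neq0 // pnatr_eq0.
move=> b1 b2 b3 b4 b5 b6 /eqP E.
have {}E : (2 : K) ^+ b6 * 2 ^+ b2 * 2 ^+ b3 = 2 ^+ b5 * 2 ^+ b4 * 2 ^+ b1 by rewrite -!exprD E.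
apply: (mulIf (two b3)); apply: (mulIf (two b4)); apply: (mulIf (two b5)).
transitivity (s * w * (2 ^+ b6 * 2 ^+ b2 * 2 ^+ b3)); first by field; rewrite ?two.
by rewrite E; field; rewrite ?two.
Qed.

Lemma axisg_ydiag a b : (a < 3)%N -> axisg a *m ydiag b *m invmx (axisg a) = ydiag b.
Proof.
by move=> a3; rewrite diag_mxC mulmxK //; apply: Sp_unit; exact: axisg_Sp.
Qed.

Lemma xmat_axisE a v : (a < 3)%N -> xmat (axis a v) = axisg a *m xmat v *m invmx (axisg a).
Proof. by move=> a3; rewrite -xmat_axis // mulmxK //; apply: Sp_unit; exact: axisg_Sp. Qed.

Lemma mfun_xmat i k : mfun (fun v : 'I_15 -> K => xmat v i k).
Proof.
apply: (@eq_mfun _ _ (fun v => nth 0 [:: 0; 1; -1] (sg i k) * v (inord (ix i k)))).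
  by move=> v; rewrite mxE.
by apply: mfunM; [exact: mfun_cst | exact: mfun_var].
Qed.

Lemma mfun_polyfn n F (A : ('I_n -> K) -> M6) : polyfn F ->
  (forall i k, mfun (fun t => A t i k)) -> mfun (fun t => F (A t)).
Proof.
case=> p Fp uA; apply: eq_mfun (@mfun_meval K _ n p (fun k t => mxvec (A t) 0 k) _).
  by move=> t; rewrite Fp.
move=> k; case/mxvec_indexP: k => i k.
by apply: eq_mfun (uA i k) => t; rewrite mxvecE.
Qed.

Lemma mfun_mono_xmat p y : mfun (fun v : 'I_15 -> K => mono p (xmat v) y).
Proof.
apply: (closed_mono (@mfun_cst K 15) (@mfunD K 15) (@mfunM K 15) (x := @xmat K) (y := fun=> y)).
- exact: mfun_xmat.
- by move=> i k; exact: mfun_cst.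
Qed.

Definition midx d (k : 'I_(size (monoL d))) : mexp :=
  let p := nth (0%N, [::]) (monoL d) k in (inord p.1, [multinom nth 0%N p.2 l | l < 12]).

Lemma mem_monoL d p : p \in monoL d ->
  [/\ (p.1 < 36)%N, size p.2 = 12 & (dotn (3 :: commonW) p.2 + basisx p.1 = d)%N].
Proof.
have: all (leq 1) (3 :: commonW) && (size (3 :: commonW) == 12) by [].
rewrite /monoL; move: (3 :: commonW) => ks /andP[ks1 /eqP sks]; case/flatten_mapP => i.
rewrite mem_filter mem_iota => /andP[le_id i36] /mapP[s sin ->].
by move: sin; rewrite mem_sols // sks => /andP[/eqP-> /eqP sd]; split; rewrite ?sd ?subnK.
Qed.

Lemma uniq_monoL d : uniq (monoL d).
Proof.
rewrite /monoL; have : uniq [seq i <- iota 0 36 | (basisx i <= d)%N] by rewrite filter_uniq ?iota_uniq.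
have us i : uniq (sols (3 :: commonW) (d - basisx i)) by apply: uniq_sols.
move: (3 :: commonW) us => ks us.
elim: [seq i <- _ | _] => //= i r IHr /andP[nir ur].
rewrite cat_uniq IHr // map_inj_uniq ?us ?andbT; last by move=> ? ? [].
apply/hasPn => s /flatten_mapP[i' i'r /mapP[s' _ ->]].
by apply/mapP => -[s'' _ [ii' _]]; rewrite -ii' i'r in nir.
Qed.

Lemma midx_inj d : injective (@midx d).
Proof.
move=> k l E; apply/val_inj/eqP.
rewrite -(nth_uniq (0%N, [::]) (ltn_ord k) (ltn_ord l) (uniq_monoL d)); apply/eqP.
move: E (mem_monoL (mem_nth (0%N, [::]) (ltn_ord k))) (mem_monoL (mem_nth (0%N, [::]) (ltn_ord l))).
rewrite /midx; move: (nth _ _ k) (nth _ _ l) => [i s] [i' s'] /= E [k36 sk _] [l36 sl _].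
move: (congr1 snd E) (congr1 (fun q : mexp => val q.1) E); rewrite /= !inordK // => e2 ->.
congr (_, _); apply: (@eq_from_nth _ 0%N) => [|t]; first by rewrite sk sl.
rewrite sk => t12; have := congr1 (fun m : 'X_{1..12} => m (Ordinal t12)) e2.
by rewrite !mnmE.
Qed.

Lemma dotnE ks s : dotn ks s = (\sum_(l < size ks) nth 0%N ks l * nth 0%N s l)%N.
Proof.
elim: ks s => [|k ks IH] s /=; first by rewrite big_ord0.
rewrite big_ord_recl IH -[head _ _]nth0 [in LHS](mulnC _ k); congr (_ + _)%N.
by apply: eq_bigr => l _; rewrite /= nth_behead.
Qed.

Lemma basex_check : all (fun l => basex l == nth 0 (3 :: commonW) l)%N (iota 0 12).
Proof. by vm_compute. Qed.

Lemma midx_x d k : monox (@midx d k) = d.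
Proof.
move: (mem_monoL (mem_nth (0%N, [::]) (ltn_ord k))); rewrite /monox /midx.
move: (nth _ _ k) => [i s] [i36 sz <-]; rewrite inordK //; congr (_ + _)%N.
rewrite dotnE; apply: eq_bigr => l _; rewrite mnmE; congr (_ * _)%N.
by apply/eqP; apply: (allP basex_check (l : nat)); rewrite mem_iota (ltn_ord l).
Qed.

(** The torus elements [axisg a] fix [ydiag b], so that f, as well as each monomial, becomes a
    torus-invariant polynomial in x alone, and [indep_span] applies. *)
Lemma span_ydiag d (f : M6 -> K) b : Cbar f ->
  (forall s x y, symm x -> skew y -> f (s *: x + y) = s ^+ d * f (x + y)) -> generic b ->
  exists c : 'I_(size (monoL d)) -> K, forall v,
    f (xmat v + ydiag b) = \sum_k c k * mono (midx k) (xmat v) (ydiag b).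
Proof.
move=> [pf invf] fd gb.
have sk : skew (ydiag b) by apply: skew_diag.
have [a aE] : exists a : 'I_(size (circL d)) -> K, forall v, f (xmat v + ydiag b) =
    \sum_l a l * circmono (circ (nth ([::], [::]) (circL d) l)) v.
  apply: balanced_span.
  - apply: (mfun_polyfn pf) => i k; apply: (@eq_mfun _ _ (fun v => xmat v i k + ydiag b i k)).
      by move=> v; rewrite [RHS]mxE.
    by apply: mfunD; [exact: mfun_xmat | exact: mfun_cst].
  - by move=> v; rewrite xmatZ fd //; exact: symm_xmat.
  - move=> a a3 v; rewrite xmat_axisE // -{1}(axisg_ydiag b a3) -mulmxDl -mulmxDr invf //.
    exact: axisg_Sp.
have /choice[M ME] : forall k : 'I_(size (monoL d)), exists a : 'I_(size (circL d)) -> K,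
    forall v, mono (midx k) (xmat v) (ydiag b) =
    \sum_l a l * circmono (circ (nth ([::], [::]) (circL d) l)) v.
  move=> k; apply: balanced_span; first exact: mfun_mono_xmat.
  - move=> v; rewrite xmatZ -[X in mono _ _ X](scale1r (ydiag b)) mono_scale midx_x expr1n mulr1 ?scale1r.
    congr (_ * _).
  - move=> a' a3 v; rewrite xmat_axisE // -{1}(axisg_ydiag b a3) mono_conj //.
    by apply: Sp_unit; exact: axisg_Sp.
apply: (@indep_span _ _ _ _ _ _ _ (\matrix_(k, l) M k l) a _ (indep_monos_ydiag gb (@midx_inj d)) _ aE).
- by rewrite size_circL.
- by move=> k v; rewrite ME; apply: eq_bigr => l _; rewrite mxE.
Qed.

(* Both [y] and its normal form [ymat] are conjugate to the same diagonal matrix. *)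
Lemma conjdiag_ymat y : conjdiag y ->
  exists b g, [/\ generic b, Sp g & y = g *m ymat (celem b) *m invmx g].
Proof.
move=> [b [a [gb Sa ay]]]; have [a' [Sa' a'y]] := ymat_diag gb.
exists b, (invmx a *m a'); split => //; first by apply: SpM => //; exact: SpV.
have ua := Sp_unit Sa; have ua' := Sp_unit Sa'.
have -> : y = invmx a *m (ydiag b) *m a by rewrite -ay !mulmxA mulVmx // mul1mx mulmxKV.
rewrite -a'y.
have -> : invmx (invmx a *m a') = invmx a' *m a.
  have ug : invmx a *m a' \in unitmx by rewrite unitmx_mul unitmx_inv ua.
  by rewrite -[RHS](mulmxK ug) !mulmxA mulmxK // mulVmx // mul1mx.
by rewrite !mulmxA.
Qed.

Lemma Cbar_conj (f : M6 -> K) g x y : Cbar f -> Sp g ->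
  f (g *m x *m invmx g + g *m y *m invmx g) = f (x + y).
Proof. by move=> [_ fi] Sg; rewrite -mulmxDl -mulmxDr fi. Qed.

Lemma span_ymat d (f : M6 -> K) b : Cbar f ->
  (forall s x y, symm x -> skew y -> f (s *: x + y) = s ^+ d * f (x + y)) -> generic b ->
  exists c : 'I_(size (monoL d)) -> K, forall v,
    f (xmat v + ymat (celem b)) = \sum_k c k * mono (midx k) (xmat v) (ymat (celem b)).
Proof.
move=> Cf fd gb; have [c cE] := span_ydiag Cf fd gb.
have [g [Sg gE]] := ymat_diag gb.
exists c => v; rewrite -(Cbar_conj _ _ Cf Sg) gE.
have sx : symm (g *m xmat v *m invmx g) by apply: symm_Sp => //; exact: symm_xmat.
rewrite (symm_xmatP sx) cE -(symm_xmatP sx) -gE.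
by apply: eq_bigr => k _; rewrite mono_conj //; apply: Sp_unit.
Qed.

End Span.

(** * Polynomiality of the coefficients along the slice *)

Section PolynomialCoefficients.
Variable K : numClosedFieldType.
Local Notation M6 := 'M[K]_(3 + 3).
Local Notation mexp := ('I_36 * 'X_{1..12})%type.
Implicit Types (x y z g : M6).

(** The weight of a monomial in the slice coordinates under [cact]. Only the constant monomial has
    weight 0, which isolates the value of a polynomial at e. *)
Definition cwt (m : 'X_{1..3}) := (\sum_(k < 3) 2 * k.+1 * m k)%N.

Lemma mpoly_cact (p : {mpoly K[3]}) u c : p.@[cact u c] =
  \sum_(m <- msupp p) (p@_m * \prod_k c k ^+ m k) * u ^+ cwt m.
Proof.
rewrite mpoly_evalE; apply: eq_bigr => m _; rewrite -mulrA; congr (_ * _).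
rewrite /cact; under eq_bigr do rewrite exprMn -exprM.
by rewrite big_split /= -expr_sum mulrC.
Qed.

Definition wpart (q : {mpoly K[3]}) (e' e : nat) : {mpoly K[3]} :=
  \sum_(m <- msupp q | (cwt m + e' == e)%N) (q@_m)%:MP * 'X_[m].

Lemma cwt_eq0 m : (cwt m == 0)%N = (m == 0%MM).
Proof.
rewrite /cwt sum_nat_eq0; apply/forallP/eqP => [m0|-> k]; last by rewrite mnmE muln0.
by apply/mnmP => k; rewrite mnmE; apply/eqP; have := m0 k; rewrite muln_eq0 /=.
Qed.

(* Compare the coefficients of [u ^+ e]. *)
Lemma cramer_weight (p q : {mpoly K[3]}) c (r : K) e e' :
  (forall u, u != 0 -> u ^+ e * p.@[cact u c] * r = u ^+ e' * q.@[cact u c]) ->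
  p@_0%MM * r = (wpart q e' e).@[c].
Proof.
move=> E.
pose P : {poly K} := \sum_(m <- msupp p) (p@_m * \prod_k c k ^+ m k * r) *: 'X^(e + cwt m).
pose Q : {poly K} := \sum_(m <- msupp q) (q@_m * \prod_k c k ^+ m k) *: 'X^(e' + cwt m).
have Pu u : P.[u] = u ^+ e * p.@[cact u c] * r.
  rewrite mpoly_cact horner_sum mulr_sumr mulr_suml; apply: eq_bigr => m _.
  by rewrite hornerZ hornerXn exprD; ring.
have Qu u : Q.[u] = u ^+ e' * q.@[cact u c].
  rewrite mpoly_cact horner_sum mulr_sumr; apply: eq_bigr => m _.
  by rewrite hornerZ hornerXn exprD; ring.
have uPQ : upoly (fun u => P.[u] - Q.[u]) by exists (P - Q) => u; rewrite hornerD hornerN.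
have PQ : P - Q = 0.
  apply: poly_fun0 => u; rewrite hornerD hornerN.
  apply: (upoly_dense uPQ (@upoly_id K) (oner_neq0 K)) => t t0.
  by rewrite Pu Qu E // subrr.
have := congr1 (fun P : {poly K} => P`_e) (subr0_eq PQ); rewrite !coef_sum.
have -> : \sum_(m <- msupp p) ((p@_m * \prod_k c k ^+ m k * r) *: 'X^(e + cwt m))`_e = p@_0%MM * r.
  rewrite (eq_bigr (fun m => if m == 0%MM then p@_0%MM * r else 0)); last first.
    move=> m _; rewrite coefZ coefXn -[X in X == _]addn0 eqn_add2l eq_sym cwt_eq0.
    case: eqP => [->|_]; last by rewrite mulr0.
    by rewrite mulr1 big1 ?mulr1 // => k _; rewrite mnmE expr0.
  have [s0|ns0] := boolP (0%MM \in msupp p); last first.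
    rewrite (memN_msupp_eq0 ns0) mul0r big1 // => m _; by case: ifP.
  rewrite (bigD1_seq 0%MM) ?msupp_uniq //= eqxx [X in _ + X]big1 ?addr0 // => m /negPf->.
  by [].
move=> ->; rewrite /wpart meval_sumX [RHS]big_mkcond; apply: eq_bigr => m _.
by rewrite coefZ coefXn addnC eq_sym; case: eqP; rewrite ?mulr1 ?mulr0.
Qed.

(** [gtor] is not symplectic, but kap i + kap (i + 3) = 5 for i < 3, so [gtor (s ^+ 2)] divided by
    s^5 is. Invariance of f under the torus element of parameter u therefore needs a square root of
    u. *)
Definition sgtor (s : K) : M6 := diag_mx (\row_i (s ^- 5 * (s ^+ 2) ^+ kap i)).

Lemma meval_zero n (p : {mpoly K[n]}) : p.@[fun=> 0] = p@_0%MM.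
Proof.
rewrite mpoly_evalE (eq_bigr (fun m => if m == 0%MM then p@_0%MM else 0)); last first.
  move=> m _; case: eqP => [->|/eqP].
    by rewrite [X in _ * X]big1 ?mulr1 // => k _; rewrite mnmE expr0.
  rewrite -mdeg_eq0 mdegE sum_nat_eq0 negb_forall => /existsP[k /= mk].
  by rewrite (bigD1 k) //= expr0n (negPf mk) mul0r mulr0.
have [s0|ns0] := boolP (0%MM \in msupp p); last first.
  rewrite (memN_msupp_eq0 ns0) big1 // => m _; by case: ifP.
by rewrite (bigD1_seq 0%MM) ?msupp_uniq //= eqxx [X in _ + X]big1 ?addr0 // => m /negPf->.
Qed.

Lemma sgtorE s : sgtor s = s ^- 5 *: gtor (s ^+ 2).
Proof. by rewrite /sgtor /gtor -linearZ /=; congr diag_mx; apply/rowP => i; rewrite !mxE. Qed.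

Lemma sgtor_Sp s : s != 0 -> Sp (sgtor s).
Proof.
move=> s0; apply: Sp_diag => i; rewrite !mxE.
have kE : (kap (lshift 3 i) + kap (rshift 3 i) = 5)%N by case: i => [[|[|[|//]]] ?].
transitivity (s ^- 5 * s ^- 5 * (s ^+ 2) ^+ (kap (lshift 3 i) + kap (rshift 3 i))).
  by rewrite exprD; ring.
by rewrite kE; field.
Qed.

Lemma inter_conj (g x x' : M6) : g \in unitmx -> x' *m g = g *m x -> x' = g *m x *m invmx g.
Proof. by move=> gu <-; rewrite mulmxK. Qed.

Lemma Cbar_torus (f : M6 -> K) d e u v c : Cbar f ->
  (forall s x y, symm x -> skew y -> f (s *: x + y) = s ^+ d * f (x + y)) ->
  (forall s x y, symm x -> skew y -> f (x + s *: y) = s ^+ e * f (x + y)) -> u != 0 ->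
  f (xmat (tau u v) + ymat c) = (u ^+ 4) ^+ d * u^-1 ^+ e * f (xmat v + ymat (cact u c)).
Proof.
move=> Cf fd fe u0; pose s := sqrtC u.
have su : s ^+ 2 = u by exact: sqrtCK.
have s0 : s != 0 by apply: contraNneq u0 => s0; rewrite -su s0 expr0n.
have Ss := sgtor_Sp s0.
have -> : xmat (tau u v) = sgtor s *m (u ^+ 4 *: xmat v) *m invmx (sgtor s).
  apply: inter_conj; first exact: Sp_unit.
  by rewrite sgtorE su -scalemxAr xmat_tau -!scalemxAl -!scalemxAr !scalerA mulrC.
have -> : ymat c = sgtor s *m (u^-1 *: ymat (cact u c)) *m invmx (sgtor s).
  apply: inter_conj; first exact: Sp_unit.
  by rewrite sgtorE su -scalemxAr ymat_inter // -!scalemxAl -!scalemxAr !scalerA mulrC.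
rewrite Cbar_conj // fd ?fe ?mulrA //; try exact: symm_xmat; first exact: skew_ymat.
by rewrite /skew sadjZ skew_ymat scalerN.
Qed.

Lemma cross_mul (U V D r X : K) : U != 0 -> V != 0 ->
  D * (r * V^-1) = U^-1 * X -> U * D * r = V * X.
Proof.
move=> nzU nzV E; have -> : X = U * (D * (r * V^-1)) by rewrite E mulVKf.
by field.
Qed.

(** Cramer's rule at [cact u c] reads determinant times coefficient equals numerator, up to powers
    of u: a polynomial identity in u. Its coefficient at u^e retains only the value of the
    determinant at e, a non-zero constant, and so shows each coefficient to be a weight component of
    its numerator. *)
Lemma poly_coeffs (f : M6 -> K) d e : Cbar f ->
  (forall s x y, symm x -> skew y -> f (s *: x + y) = s ^+ d * f (x + y)) ->
  (forall s x y, symm x -> skew y -> f (x + s *: y) = s ^+ e * f (x + y)) ->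
  exists G : 'I_(size (monoL d)) -> {mpoly K[3]}, forall b, generic b -> forall v,
    f (xmat v + ymat (celem b)) =
    \sum_k (G k).@[celem b] * mono (midx k) (xmat v) (ymat (celem b)).
Proof.
move=> Cf fd fe.
have [v det0] := indep_points (@indep_monos_ymat K (fun=> 0) _ _ (@midx_inj d)).
pose M c : 'M[K]_(size (monoL d)) := \matrix_(l, k) mono (midx k) (xmat (v l)) (ymat c : M6).
pose F c l := f (xmat (v l) + ymat c).
pose Dk k c := \sum_l cofactor (M c) l k * F c l.
have mM i k : mfun (fun c => M c i k).
  by apply: eq_mfun (mfun_mono_ymat (midx k) (xmat (v i))) => c'; rewrite mxE.
have [p pE] : mfun (fun c => \det (M c)) by apply: mfun_det.
have /choice[q qE] : forall k, mfun (Dk k).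
  move=> k; apply: mfun_sum => l; apply: mfunM; last first.
    apply: (mfun_polyfn (A := fun c => xmat (v l) + ymat c)); first by case: Cf.
    move=> i i'; apply: (@eq_mfun _ _ (fun c => xmat (v l) i i' + ymat c i i')).
      by move=> c; rewrite [RHS]mxE.
    by apply: mfunD; [exact: mfun_cst | exact: mfun_ymat].
  apply: mfunM; first exact: mfun_cst.
  by apply: mfun_det => i i'; apply: eq_mfun (mM (lift l i) (lift k i')) => c; rewrite !mxE.
have p0 : p@_0%MM != 0.
  by rewrite -meval_zero -pE.
exists (fun k => (p@_0%MM)^-1 *: wpart (q k) (monoy (midx k)) e) => b gb w.
have [r rE] := span_ymat Cf fd gb.
rewrite rE; apply: eq_bigr => k _; congr (_ * _); rewrite mevalZ.
apply: (mulfI p0); rewrite mulVKf //.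
apply: cramer_weight => u u0.
rewrite -pE -qE.
pose a k := r k * u^-1 ^+ monoy (midx k).
have Ma : M (cact u (celem b)) *m (\col_k a k) = \col_l (u^-1 ^+ e * F (cact u (celem b)) l).
  apply/colP => l; rewrite !mxE; apply: (mulfI (_ : (u ^+ 4) ^+ d != 0)); first by rewrite !expf_neq0.
  rewrite mulrA -(Cbar_torus _ _ Cf fd fe) // rE mulr_sumr; apply: eq_bigr => k' _.
  have -> : (\col_k a k) k' 0 = a k' by rewrite mxE.
  have -> : M (cact u (celem b)) l k' = mono (midx k') (xmat (v l)) (ymat (cact u (celem b))) by rewrite mxE.
  by rewrite mono_torus // midx_x /a;
    move: (mono _ _ _) ((u ^+ 4) ^+ d) (u^-1 ^+ monoy _) (r k') => A B C D; ring.
have : \det (M (cact u (celem b))) * a k = u^-1 ^+ e * Dk k (cact u (celem b)).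
  have := congr1 (fun A => (\adj (M (cact u (celem b))) *m A) k 0) Ma.
  rewrite mulmxA mul_adj_mx mul_scalar_mx !mxE => ->.
  rewrite /Dk mulr_sumr; apply: eq_bigr => l _; rewrite mxE [X in _ * X]mxE mulrCA.
  by congr (_ * _).
rewrite /a !exprVn; apply: cross_mul; exact: expf_neq0.
Qed.

End PolynomialCoefficients.

(** * From the slice to all invariants, and the splitting into bihomogeneous parts *)

Section Spanning.
Variable K : numClosedFieldType.
Local Notation M6 := 'M[K]_(3 + 3).
Local Notation mexp := ('I_36 * 'X_{1..12})%type.
Implicit Types (x y z g : M6) (f : M6 -> K).

Lemma polyfn_cst c : polyfn (fun=> c : K).
Proof. by exists c%:MP => z; rewrite mevalC. Qed.

Lemma polyfnD f f' : polyfn f -> polyfn f' -> polyfn (fun z => f z + f' z).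
Proof. by case=> p fp [q fq]; exists (p + q) => z; rewrite mevalD fp fq. Qed.

Lemma polyfnM f f' : polyfn f -> polyfn f' -> polyfn (fun z => f z * f' z).
Proof. by case=> p fp [q fq]; exists (p * q) => z; rewrite mevalM fp fq. Qed.

Lemma polyfn_entry i k : polyfn (fun z => z i k).
Proof. by exists 'X_(mxvec_index i k) => z; rewrite mevalXU mxvecE. Qed.

Lemma sadjE z : sadj z = - (J0 K 3 *m z^T *m J0 K 3).
Proof. by rewrite /sadj invJ0 !mulNmx. Qed.

Lemma polyfn_sadj i k : polyfn (fun z => sadj z i k).
Proof.
have -> : (fun z : M6 => sadj z i k) =
    fun z => \sum_l \sum_l' (- J0 K 3 i l' * J0 K 3 l k) * z l l'.
  apply/funext => z; rewrite sadjE !mxE -sumrN; apply: eq_bigr => l _.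
  rewrite !mxE mulr_suml -sumrN; apply: eq_bigr => l' _; rewrite !mxE; ring.
apply: (closed_sum polyfn_cst polyfnD) => l; apply: (closed_sum polyfn_cst polyfnD) => l'.
by apply: polyfnM; [exact: polyfn_cst | exact: polyfn_entry].
Qed.

Lemma polyfn_xpart i k : polyfn (fun z => xpart z i k).
Proof.
have -> : (fun z : M6 => xpart z i k) = fun z => 2^-1 * (z i k + sadj z i k).
  by apply/funext => z; rewrite /xpart !mxE.
apply: polyfnM; first exact: polyfn_cst.
by apply: polyfnD; [exact: polyfn_entry | exact: polyfn_sadj].
Qed.

Lemma polyfn_ypart i k : polyfn (fun z => ypart z i k).
Proof.
have -> : (fun z : M6 => ypart z i k) = fun z => 2^-1 * (z i k + -1 * sadj z i k).
  by apply/funext => z; rewrite /ypart !mxE mulN1r.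
apply: polyfnM; first exact: polyfn_cst.
apply: polyfnD; [exact: polyfn_entry | apply: polyfnM; [exact: polyfn_cst|exact: polyfn_sadj]].
Qed.

Definition jz k z := jw k (xpart z) (ypart z).

Lemma polyfn_jz k : polyfn (jz k).
Proof. exact: (closed_jw polyfn_cst polyfnD polyfnM polyfn_xpart polyfn_ypart). Qed.

Lemma polyfn_mono p : polyfn (fun z => mono p (xpart z) (ypart z)).
Proof. exact: (closed_mono polyfn_cst polyfnD polyfnM polyfn_xpart polyfn_ypart). Qed.

(* Newton's identities, for the power sums [t / 2] of the squared eigenvalues. *)
Definition ctr (t : 'I_3 -> K) (k : 'I_3) : K :=
  let p := t (inord 0) / 2 in let q := t (inord 1) / 2 in let r := t (inord 2) / 2 in
  nth 0 [:: p; (p ^+ 2 + -1 * q) / 2; (p ^+ 3 + (- 3) * (p * q) + 2 * r) / 6] k.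

Lemma closed_ctr (T : Type) (P : (T -> K) -> Prop) (t : 'I_3 -> T -> K) k :
  (forall c, P (fun=> c)) -> (forall a b, P a -> P b -> P (fun s => a s + b s)) ->
  (forall a b, P a -> P b -> P (fun s => a s * b s)) -> (forall l, P (t l)) ->
  P (fun s => ctr (fun l => t l s) k).
Proof.
move=> P_cst PD PM Pt; have PX := closed_exp P_cst PM.
have Ph l : P (fun s => t l s / 2) by apply: (PM).
rewrite /ctr; case: k => [[|[|[|//]]] ?] /=; first exact: Ph.
- apply: (PM _ (fun=> 2^-1)) => //; apply: (PD); first exact: PX.
  by apply: (PM (fun=> -1)).
- apply: (PM _ (fun=> 6^-1)) => //; apply: (PD).
    apply: (PD); first exact: PX.
    by apply: (PM (fun=> - 3)) => //; apply: (PM).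
  by apply: (PM (fun=> 2)).
Qed.

Definition trL : seq nat := [:: 2; 7; 14].

Lemma jw_ydiag n k x (b : 'I_3 -> K) : nth [::] words k = nseq (2 * n) false ->
  jw k x (ydiag b) = 2 * \sum_i b i ^+ (2 * n).
Proof.
rewrite /jw => ->.
have -> : wordm (nseq (2 * n) false) x (ydiag b) =
    diag_mx (row_mx (\row_i b i ^+ (2 * n)) (\row_i (- b i) ^+ (2 * n))).
  elim: (2 * n)%N => [|m IH] /=.
    rewrite (_ : row_mx _ _ = const_mx 1) ?diag_const_mx //.
    by apply/rowP => i; rewrite mxE; case: splitP => k0 _; rewrite !mxE expr0.
  rewrite IH -mulmxE mulmx_diag; congr diag_mx; apply/rowP => i; rewrite !mxE.
  by case: splitP => k0 _; rewrite !mxE exprS.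
rewrite mxtrace_diag big_split_ord /= mulrDl mul1r; congr (_ + _); apply: eq_bigr => i _.
  by rewrite row_mxEl mxE.
by rewrite row_mxEr mxE exprM sqrrN -exprM.
Qed.

Lemma ctr_celem x b : ctr (fun l => jw (nth 0%N trL l) x (ydiag b)) = celem b.
Proof.
have E n k : nth [::] words k = nseq (2 * n) false -> jw k x (ydiag b) =
   2 * ((b (inord 0) ^+ 2) ^+ n + (b (inord 1) ^+ 2) ^+ n + (b (inord 2) ^+ 2) ^+ n).
  move=> wE; rewrite (jw_ydiag _ _ wE) !big_ord_recl big_ord0 addr0 addrA -!exprM.
  by congr (_ * (b _ ^+ _ + b _ ^+ _ + b _ ^+ _)); apply: val_inj; rewrite /= inordK.
apply/funext => k; rewrite /ctr /celem /trL !inordK //.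
rewrite (E 1%N 2%N) // (E 2%N 7%N) // (E 3%N 14%N) //.
move: (b (inord 0) ^+ 2) (b (inord 1) ^+ 2) (b (inord 2) ^+ 2) => p q r.
by case: k => [[|[|[|//]]] ?] /=; field.
Qed.

Lemma jw_conj k g x y : g \in unitmx ->
  jw k (g *m x *m invmx g) (g *m y *m invmx g) = jw k x y.
Proof.
by move=> gu; rewrite (@jw_inter _ k g x y _ _ 1 1) ?expr1n ?mul1r // mulmxKV // scale1r.
Qed.

(** Both sides are polynomial functions of z, so by density it suffices to compare them at
    conjugates of [xmat v + ymat (celem b)]; there [ctr] recovers [celem b] from the traces of y^2,
    y^4 and y^6. *)
Lemma hom_span f d e : Cbar f ->
  (forall s x y, symm x -> skew y -> f (s *: x + y) = s ^+ d * f (x + y)) ->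
  (forall s x y, symm x -> skew y -> f (x + s *: y) = s ^+ e * f (x + y)) ->
  exists G : 'I_(size (monoL d)) -> {mpoly K[3]}, forall z,
    f z = \sum_k (G k).@[ctr (fun l => jz (nth 0%N trL l) z)] * mono (midx k) (xpart z) (ypart z).
Proof.
move=> Cf fd fe; have [G GE] := poly_coeffs Cf fd fe; exists G => z; apply/eqP.
rewrite -subr_eq0; apply/eqP; move: z.
apply: conjdiag_dense.
  rewrite (_ : (fun z => _) = fun z => f z + -1 *
    \sum_k (G k).@[ctr (fun l => jz (nth 0%N trL l) z)] * mono (midx k) (xpart z) (ypart z));
    last by apply/funext => z; rewrite mulN1r.
  apply: polyfnD; first by case: Cf.
  apply: polyfnM; first exact: polyfn_cst.
  apply: (closed_sum polyfn_cst polyfnD) => k; apply: polyfnM; last exact: polyfn_mono.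
  apply: (closed_mpoly polyfn_cst polyfnD polyfnM) => i.
  by apply: (closed_ctr (t := fun l => jz (nth 0%N trL l)) _ polyfn_cst polyfnD polyfnM) => l;
    exact: polyfn_jz.
move=> x y sx sy cy.
rewrite /jz xpartE // ypartE //.
have [b [g [gb Sg yE]]] := conjdiag_ymat cy.
have ug := Sp_unit Sg.
have xE : x = g *m (invmx g *m x *m invmx (invmx g)) *m invmx g.
  by rewrite invmxK !mulmxA mulmxV // mul1mx mulmxK.
have sx0 : symm (invmx g *m x *m invmx (invmx g)) by apply: symm_Sp => //; exact: SpV.
rewrite xE yE (Cbar_conj _ _ Cf Sg) (symm_xmatP sx0) GE // -(symm_xmatP sx0).
rewrite (_ : ctr _ = celem b); last first.
  have [a [Sa aE]] := ymat_diag gb.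
  rewrite -?(symm_xmatP sx0).
  rewrite -[RHS](ctr_celem (a *m (invmx g *m x *m invmx (invmx g)) *m invmx a) b) -aE.
  congr ctr; apply/funext => l; rewrite !jw_conj // ?(Sp_unit Sa) //.
by apply/eqP; rewrite subr_eq0; apply/eqP/eq_bigr => k _; rewrite mono_conj.
Qed.

Lemma generated_subalgebra_subalg (X : Type) (S : set (X -> K)) :
  subalgebra (generated_subalgebra S).
Proof.
split.
- by move=> a A [[Ac _ _] _].
- by move=> f g Sf Sg A CA; have [[Ac AD AM] AS] := CA; apply: AD; [exact: Sf | exact: Sg].
- by move=> f g Sf Sg A CA; have [[Ac AD AM] AS] := CA; apply: AM; [exact: Sf | exact: Sg].
Qed.

Lemma sub_generated (X : Type) (S : set (X -> K)) (f : X -> K) : S f -> generated_subalgebra S f.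
Proof. by move=> Sf A [_ AS]; exact: AS. Qed.

Lemma generated_subalgebra_min (X : Type) (S A : set (X -> K)) :
  subalgebra A -> (forall f : X -> K, S f -> A f) -> forall f : X -> K, generated_subalgebra S f -> A f.
Proof. by move=> sA SA f Sf; apply: Sf. Qed.

Lemma subalgebra_cst (X : Type) (A : set (X -> K)) c : subalgebra A -> A (fun=> c).
Proof. by case=> Ac _ _; exact: Ac. Qed.

Lemma subalgebraD (X : Type) (A : set (X -> K)) (f g : X -> K) : subalgebra A -> A f -> A g ->
  A (fun t => f t + g t).
Proof. by case=> _ AD _; exact: AD. Qed.

Lemma subalgebraM (X : Type) (A : set (X -> K)) (f g : X -> K) : subalgebra A -> A f -> A g ->
  A (fun t => f t * g t).
Proof. by case=> _ _ AM; exact: AM. Qed.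

Lemma j_jz k : (k < 28)%N -> j k.+1 = jz k :> (M6 -> K).
Proof. by move=> k28; apply/funext => z; rewrite jE. Qed.

Definition sharpL : seq nat := baseL ++ trL.

Lemma Csharp_subalg : subalgebra (@Csharp K).
Proof. exact: generated_subalgebra_subalg. Qed.

Lemma Csharp_jz k : k \in sharpL -> Csharp (jz k).
Proof.
move=> ks; rewrite -j_jz; last by apply: (allP (_ : all (fun k => k < 28)%N sharpL)).
apply: sub_generated; exists k.+1 => //=.
have /allP/(_ k ks)/or3P[h|/eqP->|/eqP->] :
  all (fun k => [|| k < 13, k == 14 | k == 18])%N sharpL by [].
- by left.
- by right; left.
- by right; right.
Qed.

Definition Jspan f := exists c : 'I_36 -> M6 -> K, (forall i, Csharp (c i)) /\
  forall z, f z = \sum_i c i z * basis i (xpart z) (ypart z).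

Lemma Jspan0 : Jspan (fun=> 0).
Proof.
exists (fun _ _ => 0); split => [i|z]; first exact: (subalgebra_cst _ Csharp_subalg).
by rewrite big1 // => i _; rewrite mul0r.
Qed.

Lemma JspanD f f' : Jspan f -> Jspan f' -> Jspan (fun z => f z + f' z).
Proof.
move=> [c [cC cE]] [c' [cC' cE']]; exists (fun i z => c i z + c' i z); split.
  by move=> i; apply: (subalgebraD Csharp_subalg).
by move=> z; rewrite cE cE' -big_split; apply: eq_bigr => i _; rewrite mulrDl.
Qed.

Lemma Jspan_sum I (r : seq I) (F : I -> M6 -> K) :
  (forall i, Jspan (F i)) -> Jspan (fun z => \sum_(i <- r) F i z).
Proof.
move=> PF; elim: r => [|i r IH].
  by rewrite (_ : (fun _ => _) = fun=> 0); [exact: Jspan0 | apply/funext => z; rewrite big_nil].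
rewrite (_ : (fun _ => _) = fun z => F i z + \sum_(i <- r) F i z); first exact: JspanD.
by apply/funext => z; rewrite big_cons.
Qed.

Lemma Jspan_term c (i : 'I_36) : Csharp c -> Jspan (fun z => c z * basis i (xpart z) (ypart z)).
Proof.
move=> Cc; exists (fun k z => if k == i then c z else 0); split.
  by move=> k; case: eqP => _ //; exact: (subalgebra_cst _ Csharp_subalg).
move=> z; rewrite (bigD1 i) //= eqxx [X in _ + X]big1 ?addr0 // => k /negPf->.
by rewrite mul0r.
Qed.

Lemma hom_Jspan f d e : Cbar f ->
  (forall s x y, symm x -> skew y -> f (s *: x + y) = s ^+ d * f (x + y)) ->
  (forall s x y, symm x -> skew y -> f (x + s *: y) = s ^+ e * f (x + y)) ->
  Jspan f.
Proof.
move=> Cf fd fe; have [G GE] := hom_span Cf fd fe; rewrite (funext GE).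
apply: Jspan_sum => k; rewrite /mono.
have S := Csharp_subalg; have Sc := fun c => subalgebra_cst c S.
have SD := fun a b => @subalgebraD _ _ a b S; have SM := fun a b => @subalgebraM _ _ a b S.
under eq_fun do rewrite mulrA.
apply: Jspan_term; apply: (SM).
  apply: (closed_mpoly Sc SD SM) => i.
  apply: (closed_ctr (t := fun l => jz (nth 0%N trL l)) _ Sc SD SM) => l.
  by apply: Csharp_jz; rewrite mem_cat orbC mem_nth.
apply: (closed_prod Sc SM) => l; apply: (closed_exp Sc SM).
by apply: Csharp_jz; rewrite mem_cat mem_nth.
Qed.

(* [scal b s] multiplies by [s] the degree in [x] (if [b]) or in [y]. *)
Definition scal (b : bool) (s : K) z : M6 :=
  (if b then s else 1) *: xpart z + (if b then 1 else s) *: ypart z.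

(** Polynomials in the scaling parameter whose coefficients are polynomial functions of z. The
    uniform bound on their size makes the number of homogeneous components finite. *)
Definition polyfam (P : M6 -> {poly K}) :=
  (exists N, forall z, (size (P z) <= N)%N) /\ forall d, polyfn (fun z => (P z)`_d).

Lemma polyfam_cst (p : {poly K}) : polyfam (fun=> p).
Proof. by split; [exists (size p) | move=> d; exact: polyfn_cst]. Qed.

Lemma polyfamD P Q : polyfam P -> polyfam Q -> polyfam (fun z => P z + Q z).
Proof.
move=> [[N sP] pP] [[N' sQ] pQ]; split.
  exists (maxn N N') => z; apply: leq_trans (size_polyD _ _) _.
  by rewrite geq_max !leq_max sP sQ orbT.
move=> d; rewrite (_ : (fun z => _) = fun z => (P z)`_d + (Q z)`_d).
  exact: polyfnD.
by apply/funext => z; rewrite coefD.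
Qed.

Lemma polyfamM P Q : polyfam P -> polyfam Q -> polyfam (fun z => P z * Q z).
Proof.
move=> [[N sP] pP] [[N' sQ] pQ]; split.
  exists (N + N')%N => z; apply: leq_trans (size_polyMleq _ _) _.
  by apply: leq_trans (leq_pred _) _; exact: leq_add.
move=> d; rewrite (_ : (fun z => _) = fun z => \sum_(k < d.+1) (P z)`_k * (Q z)`_(d - k)).
  by apply: (closed_sum polyfn_cst polyfnD) => k; exact: polyfnM.
by apply/funext => z; rewrite coefM.
Qed.

Lemma polyfam_sum I (r : seq I) (F : I -> M6 -> {poly K}) :
  (forall i, polyfam (F i)) -> polyfam (fun z => \sum_(i <- r) F i z).
Proof.
move=> PF; elim: r => [|i r IH].
  rewrite (_ : (fun _ => _) = fun=> 0); first exact: polyfam_cst.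
  by apply/funext => z; rewrite big_nil.
rewrite (_ : (fun _ => _) = fun z => F i z + \sum_(i <- r) F i z); first exact: polyfamD.
by apply/funext => z; rewrite big_cons.
Qed.

Lemma polyfam_prod I (r : seq I) (F : I -> M6 -> {poly K}) :
  (forall i, polyfam (F i)) -> polyfam (fun z => \prod_(i <- r) F i z).
Proof.
move=> PF; elim: r => [|i r IH].
  rewrite (_ : (fun _ => _) = fun=> 1); first exact: polyfam_cst.
  by apply/funext => z; rewrite big_nil.
rewrite (_ : (fun _ => _) = fun z => F i z * \prod_(i <- r) F i z); first exact: polyfamM.
by apply/funext => z; rewrite big_cons.
Qed.

Lemma polyfam_polyC f : polyfn f -> polyfam (fun z => (f z)%:P).
Proof.
move=> pf; split; first by exists 1%N => z; exact: size_polyC_leq1.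
case=> [|d]; first by rewrite (_ : (fun z => _) = f) //; apply/funext => z; rewrite coefC.
rewrite (_ : (fun z => _) = fun=> 0); first exact: polyfn_cst.
by apply/funext => z; rewrite coefC.
Qed.

Lemma scal_polyfam b f : polyfn f -> exists P, polyfam P /\ forall z t, f (scal b t z) = (P z).[t].
Proof.
move=> [p fp].
have /choice[E EP] (u : 'I_((3 + 3) * (3 + 3))) :
    exists P, polyfam P /\ forall z t, mxvec (scal b t z) 0 u = (P z).[t].
  case/mxvec_indexP: u => i k.
  exists (fun z => (if b then 'X else 1) * (xpart z i k)%:P + (if b then 1 else 'X) * (ypart z i k)%:P).
  split; first by apply: polyfamD; apply: polyfamM;
    do ?[exact: polyfam_cst | apply: polyfam_polyC]; [exact: polyfn_xpart | exact: polyfn_ypart].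
  move=> z t; rewrite mxvecE /scal !mxE hornerD !hornerM !hornerC.
  by case: b; rewrite ?hornerX ?hornerC.
exists (fun z => \sum_(m <- msupp p) (p@_m)%:P * \prod_u E u z ^+ m u); split.
  apply: polyfam_sum => m; apply: polyfamM; first exact: polyfam_cst.
  apply: polyfam_prod => u; elim: (m u) => [|n IH]; first exact: polyfam_cst.
  rewrite (_ : (fun z => _) = fun z => E u z * E u z ^+ n).
    by apply: polyfamM => //; case: (EP u).
  by apply/funext => z; rewrite exprS.
move=> z t; rewrite fp mpoly_evalE horner_sum; apply: eq_bigr => m _.
rewrite hornerM hornerC horner_prod; congr (_ * _); apply: eq_bigr => u _.
by rewrite horner_exp (proj2 (EP u)).
Qed.

Lemma xpart_scal b s z : xpart (scal b s z) = (if b then s else 1) *: xpart z.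
Proof.
apply: xpartE; first by rewrite /symm sadjZ symm_xpart.
by rewrite /skew sadjZ skew_ypart scalerN.
Qed.

Lemma ypart_scal b s z : ypart (scal b s z) = (if b then 1 else s) *: ypart z.
Proof.
apply: ypartE; first by rewrite /symm sadjZ symm_xpart.
by rewrite /skew sadjZ skew_ypart scalerN.
Qed.

Lemma scal_scal b s t z : scal b s (scal b t z) = scal b (s * t) z.
Proof.
rewrite -[LHS]/(_ *: xpart (scal b t z) + _ *: ypart (scal b t z)) xpart_scal ypart_scal [X in X + _]scalerA [X in _ + X]scalerA /scal.
by case: b; rewrite /= mul1r.
Qed.

Lemma scalC b s t z : scal b s (scal (~~ b) t z) = scal (~~ b) t (scal b s z).
Proof.
rewrite -[LHS]/(_ *: xpart (scal _ t z) + _ *: ypart (scal _ t z)).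
rewrite -[RHS]/(_ *: xpart (scal _ s z) + _ *: ypart (scal _ s z)).
rewrite !xpart_scal !ypart_scal [X in X + _ = _]scalerA [X in _ + X = _]scalerA.
rewrite [X in _ = X + _]scalerA [X in _ = _ + X]scalerA.
by case: b; rewrite /= !mul1r !mulr1.
Qed.

Lemma scal1 b z : scal b 1 z = z.
Proof. by rewrite /scal; case: b; rewrite !scale1r xypart. Qed.

Lemma xpart_Sp g z : Sp g -> xpart (g *m z *m invmx g) = g *m xpart z *m invmx g.
Proof. by move=> Sg; rewrite /xpart sadj_Sp // -mulmxDl -mulmxDr scalemxAl scalemxAr. Qed.

Lemma ypart_Sp g z : Sp g -> ypart (g *m z *m invmx g) = g *m ypart z *m invmx g.
Proof. by move=> Sg; rewrite /ypart sadj_Sp // -mulmxBl -mulmxBr scalemxAl scalemxAr. Qed.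

Lemma scal_Sp b s g z : Sp g -> scal b s (g *m z *m invmx g) = g *m scal b s z *m invmx g.
Proof.
by move=> Sg; rewrite /scal xpart_Sp // ypart_Sp // mulmxDr mulmxDl -!scalemxAr -!scalemxAl.
Qed.

Lemma eq_horner (p q : {poly K}) : (forall t, p.[t] = q.[t]) -> p = q.
Proof.
by move=> pq; apply: subr0_eq; apply: poly_fun0 => t; rewrite hornerD hornerN pq subrr.
Qed.

(** F d is the coefficient of t^d in f (scal b t z). Polynomials that agree for all t are equal, so
    invariance passes to the coefficients, and so does homogeneity in the other variable, which
    permits splitting by x first and by y afterwards. *)
Lemma hom_split b f : Cbar f -> exists N (F : 'I_N -> M6 -> K),
  [/\ forall d, Cbar (F d), forall z, f z = \sum_d F d z,
    forall d s z, F d (scal b s z) = s ^+ d * F d z &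
    forall e, (forall s z, f (scal (~~ b) s z) = s ^+ e * f z) ->
      forall d s z, F d (scal (~~ b) s z) = s ^+ e * F d z].
Proof.
move=> [pf fi]; have [P [[[N sP] pP] fP]] := scal_polyfam b pf.
exists N, (fun d z => (P z)`_d); split.
- move=> d; split; first exact: pP.
  move=> g Sg z; rewrite (_ : P (g *m z *m invmx g) = P z) //; apply: eq_horner => t.
  by rewrite -!fP scal_Sp // fi.
- by move=> z; rewrite -{1}(scal1 b z) fP (horner_coef_wide _ (sP z)); apply: eq_bigr => d _;
    rewrite expr1n mulr1.
- move=> d s z; rewrite (_ : P (scal b s z) = \poly_(i < N) (s ^+ i * (P z)`_i)).
    by rewrite coef_poly ltn_ord.
  apply: eq_horner => t; rewrite -fP scal_scal fP horner_poly (horner_coef_wide _ (sP z)).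
  by apply: eq_bigr => i _; rewrite exprMn; ring.
- move=> e fe d s z; rewrite (_ : P (scal (~~ b) s z) = s ^+ e *: P z); first by rewrite coefZ.
  by apply: eq_horner => t; rewrite -fP scalC fe hornerZ -fP.
Qed.

Lemma Cbar_Jspan f : Cbar f -> Jspan f.
Proof.
move=> Cf; have [N [F [CF fF Fh _]]] := hom_split true Cf.
rewrite (funext fF); apply: Jspan_sum => d.
have [N' [F' [CF' fF' Fh' Fh'']]] := hom_split false (CF d).
rewrite (funext fF'); apply: Jspan_sum => e.
apply: (@hom_Jspan _ d e) => // s x y sx sy.
- rewrite -(Fh'' d (Fh d)) /scal /= xpartE // ypartE // scale1r //.
- by rewrite -Fh' /scal /= xpartE // ypartE // scale1r.
Qed.

End Spanning.

(** * Freeness, generation and minimality *)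

Section Freeness.
Variable K : numClosedFieldType.
Local Notation M6 := 'M[K]_(3 + 3).
Implicit Types (x y z g : M6) (f : M6 -> K).

Lemma Jset_map : Jset K = [seq \prod_(k <- l) j k.+1 | l <- basisL].
Proof.
rewrite /Jset; move: (@j K) => J.
have c1 k : \prod_(l <- [:: k]) J l.+1 = J k.+1 by rewrite big_cons big_nil mulr1.
have c2 k k' : \prod_(l <- [:: k; k']) J l.+1 = J k.+1 * J k'.+1.
  by rewrite big_cons c1.
have c3 k k' k'' : \prod_(l <- [:: k; k'; k'']) J l.+1 = J k.+1 * J k'.+1 * J k''.+1.
  by rewrite big_cons c2 mulrA.
rewrite [RHS]/= big_nil; rewrite !c1 !c2 c3 expr2.
reflexivity.
Qed.

Lemma JsetE (i : 'I_36) : (Jset K)`_i = fun z => basis i (xpart z) (ypart z).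
Proof.
rewrite Jset_map (nth_map [::]) //; apply/funext => z; rewrite /basis.
have : all (fun k => k < 28)%N (nth [::] basisL i).
  have /allP : all (all (fun k => k < 28)%N) basisL by [].
  by apply; exact: mem_nth.
elim: (nth _ _ _) => [_|k r IH /= /andP[k28 r28]]; first by rewrite !big_nil.
rewrite !big_cons -IH // -[jw k _ _]/(jz k z) -j_jz //.
Qed.

Lemma Cbar_subalg : subalgebra (@Cbar K 3).
Proof.
split.
- by move=> a; split=> [|g _ z]; [exact: polyfn_cst | ].
- move=> f f' [pf fi] [pf' fi']; split; first exact: polyfnD.
  by move=> g Sg z; exact: (f_equal2 +%R (fi g Sg z) (fi' g Sg z)).
- move=> f f' [pf fi] [pf' fi']; split; first exact: polyfnM.
  by move=> g Sg z; exact: (f_equal2 *%R (fi g Sg z) (fi' g Sg z)).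
Qed.

Lemma Cbar_jz k : Cbar (jz k : M6 -> K).
Proof.
split; first exact: polyfn_jz.
move=> g Sg z; have gu := Sp_unit Sg.
have := jw_conj k (xpart z) (ypart z) gu; rewrite -(xpart_Sp z Sg) -(ypart_Sp z Sg).
exact.
Qed.

Lemma Csharp_Cbar f : Csharp f -> Cbar f.
Proof.
apply: generated_subalgebra_min; first exact: Cbar_subalg.
move=> _ [k /= kP <-]; case: k kP => [[//|[//|//]]|k kP].
rewrite j_jz; first exact: Cbar_jz.
case: kP => [/andP[_ k13]|[[->]|[->]]] //; exact: (leq_trans k13).
Qed.

Lemma Csharp_mpoly f : Csharp f -> exists p : {mpoly K[15]},
  forall z, f z = p.@[fun l => jz (nth 0%N sharpL l) z].
Proof.
apply: (generated_subalgebra_min (A := fun f => exists p : {mpoly K[15]},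
  forall z, f z = p.@[fun l => jz (nth 0%N sharpL l) z])).
  split.
  - by move=> a; exists a%:MP => z; rewrite mevalC.
  - by move=> g h [p pE] [q qE]; exists (p + q) => z; rewrite mevalD -pE -qE.
  - by move=> g h [p pE] [q qE]; exists (p * q) => z; rewrite mevalM -pE -qE.
move=> _ [k /= kP <-].
have : (k.-1 \in sharpL) && (0 < k <= 28)%N.
  case: kP => [|[->|->]] //; case: k => // k /andP[_ k13].
  have /allP/(_ k) : all (fun k => (k.+1.-1 \in sharpL) && (0 < k.+1 <= 28)%N) (iota 0 13) by [].
  by rewrite mem_iota; apply.
case: k {kP} => // k /andP[ks /andP[_ k28]]; rewrite j_jz //.
have il : (index k.+1.-1 sharpL < 15)%N by rewrite -[15%N]/(size sharpL) index_mem.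
by exists 'X_(Ordinal il) => z; rewrite mevalXU /= nth_index.
Qed.

Lemma jw_ywordE k n x x' y : nth [::] words k = nseq n false -> jw k x y = jw k x' y.
Proof.
rewrite /jw => ->; congr (\tr _); elim: n => //= n IH.
by rewrite IH.
Qed.

Lemma jw_trL l x x' y : l \in trL -> jw l x y = jw l x' y.
Proof.
rewrite !inE => /or3P[] /eqP->.
- exact: (@jw_ywordE 2 2).
- exact: (@jw_ywordE 7 4).
- exact: (@jw_ywordE 14 6).
Qed.

(** For y fixed in the slice the traces of y^2, y^4 and y^6 are constants, so each coefficient c i
    becomes a polynomial C i in the twelve base invariants. Independence at [ymat (celem b)] kills
    it, and density extends this to all z. *)
Lemma Jset_free (c : 'I_36 -> M6 -> K) : (forall i, Csharp (c i)) ->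
  (forall z, \sum_i c i z * basis i (xpart z) (ypart z) = 0) -> forall i z, c i z = 0.
Proof.
move=> Cc c0 i; apply: conjdiag_dense; first by case: (Csharp_Cbar (Cc i)).
move=> x y sx sy cy; have [b [g [gb Sg yE]]] := conjdiag_ymat cy.
have ug := Sp_unit Sg.
have xE : x = g *m (invmx g *m x *m invmx (invmx g)) *m invmx g.
  by rewrite invmxK !mulmxA mulmxV // mul1mx mulmxK.
have sx0 : symm (invmx g *m x *m invmx (invmx g)) by apply: symm_Sp => //; exact: SpV.
rewrite xE yE (Cbar_conj _ _ (Csharp_Cbar (Cc i)) Sg) (symm_xmatP sx0).
move: (fun k => _) => {x y sx sy cy yE xE sx0} v.
pose y := ymat (celem b); have sy : skew y by exact: skew_ymat.
have /choice[p pE] k := Csharp_mpoly (Cc k).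
have /choice[C CE] k : mfun (fun t : 'I_12 -> K => (p k).@[fun l : 'I_15 =>
    if (l < 12)%N then t (inord l) else jw (nth 0%N sharpL l) 0 y]).
  apply: (mfun_meval (p k) (F := fun l t => if (l < 12)%N then t (inord l) else _)) => l.
  by case: (l < 12)%N; [exact: mfun_var | exact: mfun_cst].
have CcE k w : c k (xmat w + y) = (C k).@[base (xmat w) y].
  rewrite pE -CE; congr (meval _ _); apply/funext => l.
  rewrite /jz xpartE ?ypartE //; try exact: symm_xmat.
  case: ifP => [l12|/negbT]; first by rewrite /base /sharpL nth_cat l12 inordK.
  rewrite -leqNgt => l12; rewrite /sharpL nth_cat ltnNge l12 /=.
  by apply: jw_trL; apply: mem_nth; rewrite ltn_subLR //; exact: (ltn_ord l).
rewrite CcE (_ : C i = 0) ?meval0 //.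
apply: (indep_at_monos (@indep_monos_ymat K (celem b))) => w.
rewrite -[RHS](c0 (xmat w + y)); apply: eq_bigr => k _.
by rewrite CcE xpartE ?ypartE //; exact: symm_xmat.
Qed.

End Freeness.

Section Generators.
Variable K : numClosedFieldType.
Local Notation M6 := 'M[K]_(3 + 3).
Implicit Types (x y z g : M6) (f : M6 -> K).
Local Notation n36 := ((3 + 3) * (3 + 3))%N.

Definition bidegree (d e : nat) (p : {mpoly K[n36 + n36]}) := forall m, m \in msupp p ->
  (\sum_k m (lshift _ k) = d)%N /\ (\sum_k m (rshift _ k) = e)%N.

Definition bipoint z : 'I_(n36 + n36) -> K := row_mx (mxvec (xpart z)) (mxvec (ypart z)) 0.

Lemma bidegree0 d e : bidegree d e 0.
Proof. by move=> m; rewrite msupp0. Qed.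

Lemma bidegree1 : bidegree 0 0 1.
Proof.
by move=> m; rewrite msupp1 inE => /eqP->; split; apply: big1 => k _; rewrite mnmE.
Qed.

Lemma bidegreeD d e p q : bidegree d e p -> bidegree d e q -> bidegree d e (p + q).
Proof. by move=> bp bq m /msuppD_le; rewrite mem_cat => /orP[/bp|/bq]. Qed.

Lemma bidegreeM d e d' e' p q : bidegree d e p -> bidegree d' e' q ->
  bidegree (d + d') (e + e') (p * q).
Proof.
move=> bp bq m /msuppM_le /allpairsP[[m1 m2] /= [/bp[d1 e1] /bq[d2 e2] ->]].
by rewrite -d1 -d2 -e1 -e2 -!big_split; split; apply: eq_bigr => k _; rewrite mnmE.
Qed.

Lemma bidegree_sum d e I (r : seq I) (F : I -> {mpoly K[n36 + n36]}) :
  (forall i, bidegree d e (F i)) -> bidegree d e (\sum_(i <- r) F i).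
Proof.
move=> bF; elim: r => [|i r IH]; first by rewrite big_nil; exact: bidegree0.
by rewrite big_cons; exact: bidegreeD.
Qed.

Lemma bidegree_x k : bidegree 1 0 'X_(lshift n36 k).
Proof.
move=> m; rewrite msuppX inE => /eqP->; split.
  rewrite (bigD1 k) //= big1 ?mnm1E ?eqxx // => l lk.
  by rewrite mnm1E (inj_eq (@lshift_inj _ _)) eq_sym (negPf lk).
by apply: big1 => l _; rewrite mnm1E eq_lrshift.
Qed.

Lemma bidegree_y k : bidegree 0 1 'X_(rshift n36 k).
Proof.
move=> m; rewrite msuppX inE => /eqP->; split.
  by apply: big1 => l _; rewrite mnm1E eq_rlshift.
rewrite (bigD1 k) //= big1 ?mnm1E ?eqxx // => l lk.
by rewrite mnm1E (inj_eq (@rshift_inj _ _)) eq_sym (negPf lk).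
Qed.

Lemma wordm_bidegree w : exists p : 'I_(3 + 3) -> 'I_(3 + 3) -> {mpoly K[n36 + n36]},
  forall i k, bidegree (degx w) (degy w) (p i k) /\
    forall z, wordm w (xpart z) (ypart z) i k = (p i k).@[bipoint z].
Proof.
elim: w => [|b w [p pP]].
  exists (fun i k => (i == k)%:R) => i k; split; last first.
    by move=> z; rewrite mxE; case: eqP => _; rewrite ?meval1 ?meval0.
  by case: eqP => _; [exact: bidegree1 | exact: bidegree0].
pose v i l : {mpoly K[n36 + n36]} :=
  'X_((if b then @lshift n36 n36 else @rshift n36 n36) (mxvec_index i l)).
exists (fun i k => \sum_l v i l * p l k) => i k; split.
  apply: bidegree_sum => l; rewrite /degx /degy /=.
  apply: bidegreeM; last by case: (pP l k).
  by rewrite /v; case: b {v}; [exact: bidegree_x | exact: bidegree_y].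
move=> z; rewrite -[LHS]/(((if b then xpart z else ypart z) *m wordm w (xpart z) (ypart z)) i k).
rewrite mxE (raddf_sum (meval _)); apply: eq_bigr => l _.
rewrite (proj2 (pP l k)) -[RHS]/((v i l * p l k).@[_]) mevalM /v mevalXU /bipoint; congr (_ * _).
by case: b {v}; rewrite ?row_mxEl ?row_mxEr mxvecE.
Qed.

Lemma jz_bihomogeneous k : bihomogeneous (jz k : M6 -> K).
Proof.
have [p pP] := wordm_bidegree (nth [::] words k).
exists (wdx k), (wdy k), (\sum_i p i i).
  by apply: bidegree_sum => i; case: (pP i i).
move=> z; rewrite (raddf_sum (meval _)); apply: eq_bigr => i _.
exact: (proj2 (pP i i)).
Qed.

Lemma trW2P f : trW2 f -> exists2 k, (k < 28)%N & f = jz k.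
Proof.
by case=> -[//|k] /= k28 <-; exists k => //; rewrite j_jz.
Qed.

Lemma trW2_jz k : (k < 28)%N -> trW2 (jz k : M6 -> K).
Proof. by move=> k28; exists k.+1 => //; rewrite j_jz. Qed.

Lemma Csharp_trW2 f : Csharp f -> generated_subalgebra (@trW2 K) f.
Proof.
apply: generated_subalgebra_min; first exact: generated_subalgebra_subalg.
move=> _ [k /= kP <-]; apply: sub_generated; exists k => //=.
case: kP => [/andP[-> k13]|[->|->]] //; exact: (leq_trans k13).
Qed.

Lemma basis_words (i : 'I_36) k : k \in nth [::] basisL i -> (k < 28)%N.
Proof.
have /allP H : all (all (fun k => k < 28)%N) basisL by [].
by move: k; apply/allP; apply: H; exact: mem_nth.
Qed.

Lemma generated_trW2 : generated_subalgebra (@trW2 K) = @Cbar K 3.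
Proof.
apply/seteqP; split=> f.
  apply: generated_subalgebra_min; first exact: Cbar_subalg.
  by move=> _ /trW2P[k _ ->]; exact: Cbar_jz.
move=> /Cbar_Jspan[c [cC /funext ->]].
have S : subalgebra (generated_subalgebra (@trW2 K)) by exact: generated_subalgebra_subalg.
have Sc := fun c => subalgebra_cst c S.
have SD := fun a b => @subalgebraD _ _ _ a b S; have SM := fun a b => @subalgebraM _ _ _ a b S.
apply: (closed_sum Sc SD) => i; apply: (SM); first by apply: Csharp_trW2; exact: cC.
rewrite /basis; have := @basis_words i; elim: (nth _ _ _) => [|k r IH] r28.
  by under eq_fun do rewrite big_nil; exact: Sc.
under eq_fun do rewrite big_cons; apply: (SM).
  by apply: sub_generated; apply: trW2_jz; apply: r28; rewrite mem_head.
by apply: IH => l lr; apply: r28; rewrite inE lr orbT.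
Qed.

Lemma sum_funE (c : 'I_(size (Jset K)) -> M6 -> K) :
  \sum_i c i * (Jset K)`_i = fun z => \sum_(i < 36) c i z * basis i (xpart z) (ypart z).
Proof.
apply/funext => z; rewrite -[size _]/36%N in c *.
have -> : (\sum_(i < 36) c i * (Jset K)`_i) z = \sum_(i < 36) (c i * (Jset K)`_i) z.
  by elim/big_rec2: _ => // i a b _ <-.
by apply: eq_bigr => i _; rewrite -[LHS]/(c i z * (Jset K)`_i z) JsetE.
Qed.

Lemma Jset_free_basis : free_basis (@Csharp K) (@Cbar K 3) (Jset K).
Proof.
split.
  apply/seteqP; split => f.
    move=> /Cbar_Jspan[c [cC cE]]; exists c; first exact: cC.
    by rewrite sum_funE; apply/funext.
  move=> [c cC ->]; rewrite sum_funE.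
  have S := Cbar_subalg K.
  have Sc := fun c => subalgebra_cst c S.
  have SD := fun a b => @subalgebraD _ _ _ a b S; have SM := fun a b => @subalgebraM _ _ _ a b S.
  apply: (closed_sum Sc SD) => i; apply: (SM); first by apply: Csharp_Cbar; exact: cC.
  by apply: (closed_prod Sc SM) => k; exact: Cbar_jz.
move=> c cC c0 i; apply/funext; apply: (Jset_free cC) => z.
by have := congr1 (fun f => f z) c0; rewrite sum_funE.
Qed.

End Generators.

Section Minimality.
Variable K : numClosedFieldType.
Local Notation M6 := 'M[K]_(3 + 3).
Local Notation mexp := ('I_36 * 'X_{1..12})%type.
Implicit Types (x y z g : M6) (f : M6 -> K).

(* Compare the coefficients of [s ^+ W]. *)
Lemma weight_part n (p : {mpoly K[n]}) (w : 'I_n -> nat) (a : 'I_n -> K) r W :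
  (forall s, p.@[fun l => s ^+ w l * a l] = s ^+ W * r) ->
  r = \sum_(m <- msupp p | (\sum_l w l * m l == W)%N) p@_m * \prod_l a l ^+ m l.
Proof.
move=> E.
pose P : {poly K} := \sum_(m <- msupp p) (p@_m * \prod_l a l ^+ m l) *: 'X^(\sum_l w l * m l).
have PE : P = r *: 'X^W.
  apply: eq_horner => s; rewrite hornerZ hornerXn mulrC -E mpoly_evalE horner_sum.
  apply: eq_bigr => m _; rewrite hornerZ hornerXn -mulrA; congr (_ * _).
  by under [RHS]eq_bigr do rewrite exprMn -exprM; rewrite big_split /= -expr_sum mulrC.
have := congr1 (fun P : {poly K} => P`_W) PE; rewrite coefZ coefXn eqxx mulr1 => <-.
rewrite coef_sum [RHS]big_mkcond; apply: eq_bigr => m _.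
by rewrite coefZ coefXn eq_sym; case: eqP; rewrite ?mulr1 ?mulr0.
Qed.

(** The list may repeat an exponent, as happens when distinct products of generators restrict to the
    same monomial; only the sum of their coefficients is then controlled. *)
Lemma indep_list y (L : seq (K * mexp)) : indep_at y ->
  (forall v, \sum_(t <- L) t.1 * mono t.2 (xmat v) y = 0) ->
  forall q, \sum_(t <- L) t.1 * (t.2 == q)%:R = 0.
Proof.
move=> ind L0 q.
pose C i : {mpoly K[12]} := \sum_(t <- L | t.2.1 == i) (t.1)%:MP * 'X_[t.2.2].
have : (C q.1)@_(q.2) = 0.
  rewrite (ind C) ?mcoeff0 // => v; rewrite -[RHS](L0 v).
  rewrite [RHS](partition_big (fun t => t.2.1) xpredT) //=; apply: eq_bigr => i _.
  rewrite /C meval_sumX mulr_suml; apply: eq_bigr => l /eqP <-.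
  by rewrite /mono mulrA.
rewrite /C mcoeff_sumX big_mkcond => E; rewrite -[RHS]E; apply: eq_bigr => -[c [i m]] _ /=.
by case: q {E} => i' m'; rewrite xpair_eqE /=; case: eqP => //= _; rewrite mulr0.
Qed.

Definition secL : seq nat := [:: 13; 15; 16; 17; 19; 20; 21; 22; 23; 24; 25; 26; 27]%N.
Definition wd k := (wdx k + wdy k)%N.

Lemma secL_check : all (fun d => all (fun s =>
  has (fun i => [seq count_mem l (nth [::] basisL i) | l <- secL] == s) (iota 0 36))
  (sols (map wd secL) d)) (iota 0 14).
Proof. by vm_compute. Qed.

Lemma dotn_map (F m : nat -> nat) r : dotn (map F r) (map m r) = (\sum_(l <- r) F l * m l)%N.
Proof. by elim: r => [|l r IH] /=; rewrite ?big_nil // big_cons IH mulnC. Qed.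

Lemma prod_count (F : nat -> K) (r S : seq nat) : uniq S -> {subset r <= S} ->
  \prod_(k <- r) F k = \prod_(l <- S) F l ^+ count_mem l r.
Proof.
move=> uS; elim: r => [_|k r IH rS].
  by rewrite big_nil big1 // => l _; rewrite expr0.
rewrite big_cons IH; last by move=> l lr; apply: rS; rewrite inE lr orbT.
under [RHS]eq_bigr do rewrite /= exprD.
rewrite big_split /=; congr (_ * _).
rewrite (bigD1_seq k) ?rS ?mem_head //= eqxx [X in _ * X]big1 ?mulr1 // => l /negPf.
by rewrite eq_sym => ->.
Qed.

(* Products of at most two secondary invariants of total degree at most 13 lie in [Jset]. *)
Lemma low_degree_mono (m : nat -> nat) : (forall l, l \in trL -> m l = 0%N) ->
  (\sum_(0 <= l < 28) wd l * m l <= 13)%N ->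
  exists q : mexp, [/\ forall l : 'I_12, q.2 l = m (nth 0%N baseL l),
    forall l, l \in secL -> count_mem l (nth [::] basisL q.1) = m l &
    forall x y, \prod_(0 <= l < 28) jw l x y ^+ m l = mono q x y].
Proof.
move=> m0 wm.
have pE : perm_eq (index_iota 0 28) (baseL ++ secL ++ trL) by [].
have : [seq m l | l <- secL] \in sols (map wd secL) (\sum_(l <- secL) wd l * m l)%N.
  by rewrite mem_sols // !size_map eqxx dotn_map eqxx.
have lt14 : (\sum_(l <- secL) wd l * m l < 14)%N.
  rewrite ltnS; apply: leq_trans wm; rewrite (perm_big _ pE) !big_cat /=.
  by apply: leq_trans (leq_addl _ _); apply: leq_addr.
move: (allP secL_check (\sum_(l <- secL) wd l * m l)%N); rewrite mem_iota => /(_ lt14)/allP H /H.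
case/hasP => i; rewrite mem_iota => /andP[_ i36] /eqP cE.
exists (inord i, [multinom m (nth 0%N baseL l) | l < 12]).
have cl l : l \in secL -> count_mem l (nth [::] basisL i) = m l.
  move=> ls; have := congr1 (fun s => nth 0%N s (index l secL)) cE.
  by rewrite !(nth_map 0%N) ?index_mem // nth_index.
split => [l|l|x y]; rewrite /= ?mnmE ?inordK //; first exact: cl.
rewrite (perm_big _ pE) !big_cat /= /mono /= inordK //.
rewrite [X in _ * (_ * X)]big_seq [X in _ * (_ * X)]big1 ?mulr1; last first.
  by move=> l /m0->; rewrite expr0.
congr (_ * _).
  rewrite (big_nth 0%N) big_mkord; apply: eq_bigr => l _.
  by rewrite mnmE.
rewrite /basis (@prod_count _ _ secL) //.
  by rewrite big_seq [RHS]big_seq; apply: eq_bigr => l /cl ->.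
have /allP H1 : all (fun r => all (fun k => k \in secL) r) basisL by [].
by apply/allP; apply: H1; exact: mem_nth.
Qed.

Lemma jw_scale k s x y : jw k (s *: x) (s *: y) = s ^+ wd k * jw k x y.
Proof.
rewrite (@jw_inter _ k 1%:M x y _ _ s s) ?unitmx1 ?mulmx1 ?mul1mx //.
by rewrite /wd exprD.
Qed.

(** Conjugation by [gtor 2] multiplies e by a power of 2, hence the trace of e^n, n > 0, by a power
    different from 1. *)
Lemma jw_trL_nilp l x : l \in trL -> jw l x (ymat (fun=> 0) : M6) = 0.
Proof.
move=> lt; rewrite (jw_trL x 0 _ lt).
have n2 : (2 : K) != 0 by rewrite pnatr_eq0.
have := @jw_inter _ l (gtor 2) 0 (ymat (fun=> 0)) 0 (ymat (fun=> 0)) 1 2^-1 (gtor_unit n2).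
rewrite mul0mx mulmx0 scaler0 (ymat_inter _ n2) cact0 => /(_ erefl erefl).
rewrite expr1n mul1r => /eqP; rewrite -subr_eq0 -[X in X - _]mul1r -mulrBl mulf_eq0.
case/orP => /eqP // E; exfalso.
have : (2 : K) ^+ wdy l = 1.
  by move/eqP: E; rewrite subr_eq0 exprVn eq_sym invr_eq1 => /eqP.
move/eqP; rewrite -natrX -[1]/(1%:R) eqr_nat => /eqP.
by move: lt; rewrite !inE => /or3P[] /eqP->.
Qed.

(** Putting 0 in place of [jz k0] expresses that p is a polynomial in the other 27 invariants.
    Scaling z by s then discards all monomials but those of the total degree of [jz k0]. *)
Lemma low_part (p : {mpoly K[28]}) k0 x y :
  (forall z, jz k0 z = p.@[fun l => if (l : nat) == k0 then 0 else jz l z]) ->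
  symm x -> skew y ->
  jw k0 x y = \sum_(m <- msupp p | (\sum_(l < 28) wd l * m l == wd k0)%N)
    p@_m * \prod_(l < 28) (if (l : nat) == k0 then 0 else jw l x y) ^+ m l.
Proof.
move=> E sx sy; apply: (@weight_part _ p (fun l => wd l)) => s.
have sxs : symm (s *: x) by rewrite /symm sadjZ sx.
have sys : skew (s *: y) by rewrite /skew sadjZ sy scalerN.
have := E (s *: x + s *: y); rewrite {1}/jz xpartE // ypartE // jw_scale => ->.
congr (meval _ _); apply/funext => l; case: eqP => _; first by rewrite mulr0.
by rewrite /jz xpartE // ypartE // jw_scale.
Qed.

(** At y = e both sides become combinations of the independent monomials [mono q]. The left side is
    one of them, [mono q0]; on the right [q0] cannot occur, since the exponent of j_(k0+1) is zero
    in every term that survives. *)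
Lemma jz_indecomposable_x (p : {mpoly K[28]}) k0 : (k0 < 28)%N -> k0 \notin trL ->
  ~ forall z, jz k0 z = p.@[fun l => if (l : nat) == k0 then 0 else jz l z].
Proof.
move=> k28 k0t E.
have wd13 : (wd k0 <= 13)%N.
  have /allP H : all (fun k => wd k <= 13)%N (iota 0 28) by [].
  by apply: H; rewrite mem_iota.
have sumE (m : 'X_{1..28}) : (\sum_(l < 28) wd l * m l = \sum_(0 <= l < 28) wd l * nth 0 m l)%N.
  by rewrite big_mkord; apply: eq_bigr => l _; rewrite (mnm_nth 0%N).
have prodE (m : 'X_{1..28}) x y : \prod_(l < 28) jw l x y ^+ m l =
    \prod_(0 <= l < 28) jw l x y ^+ nth 0%N m l.
  by rewrite big_mkord; apply: eq_bigr => l _; rewrite (mnm_nth 0%N).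
have [q0 [qb qs qE]] : exists q : mexp, [/\ forall l : 'I_12, q.2 l = (nth 0%N baseL l == k0),
    forall l, l \in secL -> count_mem l (nth [::] basisL q.1) = (l == k0) &
    forall x y, jw k0 x y = mono q x y].
  have [|| q [q1 q2 q3]] := @low_degree_mono (fun l => l == k0).
  - by move=> l; case: eqP => // -> lt; rewrite lt in k0t.
  - rewrite big_mkord (bigD1 (Ordinal k28)) //= eqxx muln1 [X in (_ + X)%N]big1 ?addn0 //.
    by move=> l; rewrite -val_eqE /= => /negPf->; rewrite muln0.
  exists q; split => // x y; rewrite -q3 big_mkord (bigD1 (Ordinal k28)) //= eqxx expr1.
  rewrite [X in _ * X]big1 ?mulr1 // => l.
  by rewrite -val_eqE /= => /negPf->; rewrite expr0.
(* The terms that survive: of the right total degree, free of the generator replaced by 0, and free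
   of the traces of powers of y, which vanish at e. *)
pose good (m : 'X_{1..28}) := [&& (\sum_(l < 28) wd l * m l == wd k0)%N, nth 0%N m k0 == 0%N &
  all (fun l => nth 0%N m l == 0%N) trL].
have /choice[q qP] (m : 'X_{1..28}) : exists q : mexp, good m ->
    [/\ forall l : 'I_12, q.2 l = nth 0%N m (nth 0%N baseL l),
    forall l, l \in secL -> count_mem l (nth [::] basisL q.1) = nth 0%N m l &
    forall x y, \prod_(l < 28) jw l x y ^+ m l = mono q x y].
  have [/and3P[/eqP wm m0 mt]|_] := boolP (good m); last by exists q0.
  have [|| q [q1 q2 q3]] := @low_degree_mono (nth 0%N m).
  - by move=> l lt; apply/eqP; exact: (allP mt).
  - by rewrite -sumE wm.
  by exists q; split => // x y; rewrite prodE.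
pose e : M6 := ymat (fun=> 0).
pose L := (1, q0) :: [seq (- p@_m, q m) | m <- msupp p & good m].
have := @indep_list e L (@nilpotent_indep K) _ q0; rewrite /L big_cons /= eqxx mulr1.
rewrite big_map big_filter [X in 1 + X]big1 ?addr0; last first.
  move=> m /[dup] gm /and3P[_ /eqP m0 _] /=; case: eqP => [qE'|]; last by rewrite mulr0.
  have [q1 q2 _] := qP m gm; exfalso.
  have : k0 \in baseL ++ secL.
    have /allP/(_ k0) : all (fun k => (k \in trL) || (k \in baseL ++ secL)) (iota 0 28) by [].
    by rewrite mem_iota (negPf k0t) => /(_ k28).
  rewrite mem_cat => /orP[kb|ks].
    have kl : (index k0 baseL < 12)%N by rewrite -[12%N]/(size baseL) index_mem.
    have := q1 (Ordinal kl); rewrite qE' qb /= nth_index // eqxx m0.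
    by [].
  by have := q2 k0 ks; rewrite qE' qs // eqxx m0.
move=> H; have /eqP : (1 : K) = 0.
  apply: H => v.
  rewrite big_cons big_map big_filter /= mul1r -qE (low_part E (symm_xmat v) (skew_ymat _)).
  apply/eqP; rewrite addrC addr_eq0 -sumrN; apply/eqP.
  rewrite big_mkcond [RHS]big_mkcond; apply: eq_bigr => m _; rewrite /good.
  case: eqP => wm //; rewrite andTb; case: ifP => [gm|/negbT].
    have gm' : good m by rewrite /good wm eqxx.
    have [_ _ <-] := qP m gm'; rewrite mulNr; congr (- (_ * _)); apply: eq_bigr => l _.
    case: eqP => // lk; have /andP[/eqP m0 _] := gm.
    by rewrite [m l](mnm_nth 0%N) lk m0 !expr0.
  rewrite negb_and => /orP[m0|/allPn[l lt ml]].
    rewrite (bigD1 (Ordinal k28)) //= eqxx [m _](mnm_nth 0%N) /= expr0n (negPf m0) mul0r mulr0.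
    by rewrite oppr0.
  have l28 : (l < 28)%N by move: lt; rewrite !inE => /or3P[] /eqP->.
  rewrite (bigD1 (Ordinal l28)) //= [m _](mnm_nth 0%N) /= jw_trL_nilp //.
  by case: ifP => _; rewrite expr0n (negPf ml) mul0r mulr0 oppr0.
by rewrite oner_eq0.
Qed.

Lemma jw_x0 l y : (l < 28)%N -> l \notin trL -> jw l 0 y = 0 :> K.
Proof.
move=> l28 lt; rewrite (@jw_inter _ l 1%:M 0 y _ _ 0 1) ?unitmx1 ?mulmx1 ?mul1mx ?scaler0 ?scale1r //.
have /allP/(_ l) : all (fun l => (l \in trL) || (wdx l != 0%N)) (iota 0 28) by [].
by rewrite mem_iota (negPf lt) => /(_ l28) w0; rewrite expr0n (negPf w0) !mul0r.
Qed.

Lemma trL_ydiag (q : 'I_3 -> K) : exists b, forall n k, nth [::] words k = nseq (2 * n) false ->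
  jw k 0 (ydiag b) = 2 * \sum_i q i ^+ n.
Proof.
exists (fun i => sqrtC (q i)) => n k wE; rewrite (jw_ydiag _ _ wE); congr (_ * _).
by apply: eq_bigr => i _; rewrite exprM sqrtCK.
Qed.

(** The squares b_i^2 can be prescribed, so three numbers with given power sums (p1, p2, p3) are
    wanted. The pairs are (0, 3, 0) against (3, 3, 0), then (0, 2, 0) against zero with 1, -1, 0,
    and (0, 0, 3) against zero with the cube roots of unity. *)
Lemma power_sums_separated k0 : k0 \in trL -> exists b b' : 'I_3 -> K,
  (forall l, l \in trL -> l != k0 -> jw l 0 (ydiag b) = jw l 0 (ydiag b')) /\
  jw k0 0 (ydiag b) != jw k0 0 (ydiag b').
Proof.
pose s := sqrtC (6 : K); pose t := sqrtC (- 3 : K).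
have s2 : s ^+ 2 = 6 by exact: sqrtCK.
have t2 : t ^+ 2 = -3 by exact: sqrtCK.
have sep (a a' : seq K) : exists b b' : 'I_3 -> K,
    (forall n k, nth [::] words k = nseq (2 * n) false ->
       jw k 0 (ydiag b) = 2 * (a`_0 ^+ n + a`_1 ^+ n + a`_2 ^+ n)) /\
    (forall n k, nth [::] words k = nseq (2 * n) false ->
       jw k 0 (ydiag b') = 2 * (a'`_0 ^+ n + a'`_1 ^+ n + a'`_2 ^+ n)).
  have [b bE] := trL_ydiag (fun i => a`_i); have [b' bE'] := trL_ydiag (fun i => a'`_i).
  by exists b, b'; split=> n k wE; [rewrite (bE _ _ wE) | rewrite (bE' _ _ wE)];
    rewrite !big_ord_recr big_ord0 /= add0r.
have n2 : (2 : K) != 0 by rewrite pnatr_eq0.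
rewrite !inE => /or3P[] /eqP ->.
- have [b [b' [E E']]] := sep [:: s / 2; - s / 2; 0] [:: (3 + t) / 2; (3 - t) / 2; 0].
  exists b, b'; split => [l|].
    rewrite !inE => /or3P[] /eqP -> ne; first by case/negP: ne.
      rewrite (E 2%N) // (E' 2%N) //=; congr (_ * _).
      transitivity (s ^+ 2 / 2); first by field.
      by transitivity ((9 + t ^+ 2) / 2); [rewrite s2 t2; field | field].
    rewrite (E 3%N) // (E' 3%N) //=; congr (_ * _).
    transitivity (0 : K); first by field.
    by transitivity ((27 + 9 * t ^+ 2) / 4); [rewrite t2; field | field].
  rewrite (E 1%N) // (E' 1%N) //= (inj_eq (mulfI n2)).
  have -> : (s / 2) ^+ 1 + (- s / 2) ^+ 1 + 0 ^+ 1 = 0 by field.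
  have -> : ((3 + t) / 2) ^+ 1 + ((3 - t) / 2) ^+ 1 + 0 ^+ 1 = 3 by field.
  by rewrite eq_sym pnatr_eq0.
- have [b [b' [E E']]] := sep [:: 1; -1; 0] [:: 0; 0; 0].
  exists b, b'; split => [l|].
    rewrite !inE => /or3P[] /eqP -> ne.
    - by rewrite (E 1%N) // (E' 1%N) //=; congr (_ * _); ring.
    - by case/negP: ne.
    - by rewrite (E 3%N) // (E' 3%N) //=; congr (_ * _); ring.
  rewrite (E 2%N) // (E' 2%N) //= (inj_eq (mulfI n2)).
  have -> : 1 ^+ 2 + (-1) ^+ 2 + 0 ^+ 2 = 2 :> K by ring.
  by rewrite expr0n !addr0.
- have [b [b' [E E']]] := sep [:: 1; (-1 + t) / 2; (-1 - t) / 2] [:: 0; 0; 0].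
  exists b, b'; split => [l|].
    rewrite !inE => /or3P[] /eqP -> ne; last by case/negP: ne.
      by rewrite (E 1%N) // (E' 1%N) //=; congr (_ * _); field.
    rewrite (E 2%N) // (E' 2%N) //=; congr (_ * _).
    transitivity (1 + (1 + t ^+ 2) / 2); first by field.
    by rewrite t2; field.
  rewrite (E 3%N) // (E' 3%N) //= (inj_eq (mulfI n2)).
  have -> : 1 ^+ 3 + ((-1 + t) / 2) ^+ 3 + ((-1 - t) / 2) ^+ 3 = 3 :> K.
    transitivity (1 - (1 + 3 * t ^+ 2) / 4); first by field.
    by rewrite t2; field.
  by rewrite expr0n !addr0 pnatr_eq0.
Qed.

Lemma jz_indecomposable_y (p : {mpoly K[28]}) k0 : k0 \in trL ->
  ~ forall z, jz k0 z = p.@[fun l => if (l : nat) == k0 then 0 else jz l z].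
Proof.
move=> kt E; have [b [b' [bb' /eqP]]] := power_sums_separated kt; apply.
have s0 : symm (0 : M6) by rewrite /symm /sadj trmx0 mulmx0 mul0mx.
have sy (c : 'I_3 -> K) : skew (ydiag c) by exact: skew_diag.
have := E (0 + ydiag b); have := E (0 + ydiag b'); rewrite {1 3}/jz !(xpartE s0 (sy _)) !(ypartE s0 (sy _)) => -> ->.
apply: (f_equal (fun a => meval a p)); apply/funext => l.
rewrite /jz !(xpartE s0 (sy _)) !(ypartE s0 (sy _)).
case: eqP => [//|/eqP lk]; have [lt|lt] := boolP ((l : nat) \in trL); first exact: bb'.
by rewrite !jw_x0.
Qed.

(** A proper subset misses some [jz k0] as a function, so all that it generates is polynomial in the
    remaining generators; applied to [jz k0] itself this contradicts indecomposability. *)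
Lemma trW2_minimal (T : set (M6 -> K)) : (T `<` @trW2 K)%classic ->
  generated_subalgebra T <> @Cbar K 3.
Proof.
move=> [TW nWT] gT; apply: nWT => f Wf; apply: contrapT => nTf.
have [k0 k28 fE] := trW2P Wf.
have [p pE] : exists p : {mpoly K[28]}, forall z,
    jz k0 z = p.@[fun l => if (l : nat) == k0 then 0 else jz l z].
  have : generated_subalgebra T (jz k0) by rewrite gT; exact: Cbar_jz.
  move: (jz k0) => h; apply: (generated_subalgebra_min (A := fun h => exists p : {mpoly K[28]},
    forall z, h z = p.@[fun l => if (l : nat) == k0 then 0 else jz l z])).
    split.
    - by move=> a; exists a%:MP => z; rewrite mevalC.
    - by move=> g h' [p pE] [q qE]; exists (p + q) => z; rewrite mevalD -pE -qE.
    - by move=> g h' [p pE] [q qE]; exists (p * q) => z; rewrite mevalM -pE -qE.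
  move=> g Tg; have [k k28' gE] := trW2P (TW _ Tg).
  exists 'X_(Ordinal k28') => z; rewrite mevalXU /= gE; case: eqP => // kk.
  by case: nTf; rewrite fE -kk -gE.
have [kt|kt] := boolP (k0 \in trL); first exact: jz_indecomposable_y kt pE.
exact: jz_indecomposable_x k28 kt pE.
Qed.

End Minimality.

Theorem theorem7p2 (R : realType) :
  free_basis (@Csharp R[i]) (@Cbar R[i] 3) (Jset R[i])
  /\ minimal_homogeneous_generators
       (@bihomogeneous R[i] 3) (@Cbar R[i] 3) (@trW2 R[i]).
Proof.
split; first exact: (@Jset_free_basis R[i]).
split.
- by move=> f /trW2P[k _ ->]; exact: (@Cbar_jz R[i]).
- by move=> f /trW2P[k _ ->]; exact: (@jz_bihomogeneous R[i]).
- exact: (@generated_trW2 R[i]).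
- exact: (@trW2_minimal R[i]).
Qed.
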